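(* Let $X$ be a Banach space. The following conditions are equivalent: 1. $\|f-S_n(f)\|_2\to0$ as $n\to\infty$ for all $f\in L_2^X$. 2. $X$ has the UMD-property.
   Context: For a Banach space $X$, $L_2^X$ is the Banach space of all (strongly) measurable $f:[0,1]\to X$ with $\|f\|_2:=\left(\int_0^1\|f(t)\|^2\,dt\right)^{1/2}<\infty$. Rademacher functions: $r_1(t)=+1$ for $t\in[0,\tfrac12)+\mathbb Z$, $r_1(t)=-1$ for $t\in[\tfrac12,1)+\mathbb Z$, and $r_{i+1}(t)=r_1(2^it)$. Walsh functions: for an integer $n\ge 0$ with binary expansion $n=\sum_{i\ge0}n_i2^i$, $n_i\in\{0,1\}$, put $w_n(t)=\prod_{i\ge0}r_{i+1}(t)^{n_i}$. For $f\in L_2^X$ put $\langle f,w_i\rangle=\int_0^1f(t)w_i(t)\,dt\in X$ and $S_n(f)=\sum_{i=0}^{n-1}\langle f,w_i\rangle w_i$. For a martingale $(M_0,M_1,\dots)$ put $dM_i:=M_{i+1}-M_i$. A Banach space $X$ has the UMD-property if there is a constant $c\ge0$ such that $$\left\|\sum_{i=0}^n\varepsilon_i\,dM_i\right\|_2\le c\left\|\sum_{i=0}^n dM_i\right\|_2$$ for all (square-integrable) $X$-valued martingales $(M_0,M_1,\dots)$ (relative to arbitrary filtrations), all $n\in\mathbb N$ and all signs $\varepsilon_i\in\{+1,-1\}$; here $\|\cdot\|_2$ is the norm of the $X$-valued $L_2$-space over the underlying probability space. *)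

(* Defs.v *)
From HB Require Import structures.
From mathcomp Require Import all_boot all_order all_algebra.
From mathcomp Require Import all_classical all_reals all_analysis.

Set Implicit Arguments.
Unset Strict Implicit.
Unset Printing Implicit Defensive.

Import Order.TTheory GRing.Theory Num.Theory.
Import numFieldNormedType.Exports.
Local Open Scope classical_set_scope.
Local Open Scope ring_scope.

(* Banach spaces are real; a complex Banach space is covered through its
   underlying real Banach space, since neither the Walsh functions nor the
   signs in the UMD inequality involve complex scalars. *)

Section bochner.
Context d (T : measurableType d) (R : realType) (P : probability T R).
Context (X : completeNormedModType R).
Implicit Types (G : set (set T)) (f g s : T -> X).

Definition simple G s : Prop :=
  finite_set (range s) /\ forall x, G (s @^-1` [set x]).

(* The sum has finite support when s is simple. *)
Definition simple_integral s : X :=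
  \sum_(x \in [set: X]) fine (P (s @^-1` [set x])) *: x.

(* Strong measurability with respect to a sub-sigma-algebra G, in the almost
   everywhere sense: it is invariant under modification on P-null sets, as is
   appropriate for elements of L_2. With G = measurable on Borel sets of R this
   is strong Lebesgue measurability. *)
Definition strongly_measurable_wrt G f : Prop :=
  exists s : nat -> T -> X, (forall n, simple G (s n)) /\
    {ae P, forall t, s n t @[n --> \oo] --> f t}.

Definition strongly_measurable f : Prop :=
  strongly_measurable_wrt measurable f.

Definition is_bochner_integral f (v : X) : Prop :=
  strongly_measurable f /\
  exists s : nat -> T -> X,
    [/\ forall n, simple measurable (s n),
        (\int[P]_t (`|f t - s n t|)%:E)%E @[n --> \oo] --> 0%:E
      & simple_integral (s n) @[n --> \oo] --> v].

Definition bochner_integrable f : Prop := exists v, is_bochner_integral f v.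

(* 0 when f is not Bochner integrable. *)
Definition bochner_integral f : X :=
  xget 0 [set v | is_bochner_integral f v].

Definition bochner_integral_on (A : set T) f : X :=
  bochner_integral (fun t => \1_A t *: f t).

Definition L2norm f : \bar R := Lnorm P 2%:E (fun t => (`|f t|)%:E).

Definition L2 f : Prop := strongly_measurable f /\ (L2norm f < +oo)%E.

(* g is a version of the conditional expectation E[f | G]. *)
Definition is_cond_expectation G f g : Prop :=
  [/\ strongly_measurable_wrt G g, bochner_integrable f, bochner_integrable g
    & forall A, G A -> bochner_integral_on A g = bochner_integral_on A f].

Definition filtration (F : nat -> set (set T)) : Prop :=
  [/\ forall n, sigma_algebra setT (F n),
      forall n, F n `<=` measurable
    & forall n, F n `<=` F n.+1].

Definition martingale (F : nat -> set (set T)) (M : nat -> T -> X) : Prop :=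
  [/\ filtration F,
      forall n, bochner_integrable (M n),
      forall n, strongly_measurable_wrt (F n) (M n)
    & forall n, is_cond_expectation (F n) (M n.+1) (M n)].

Definition mdiff (M : nat -> T -> X) (i : nat) : T -> X :=
  fun t => M i.+1 t - M i t.

End bochner.

Definition UMD (R : realType) (X : completeNormedModType R) : Prop :=
  exists c : R, 0 <= c /\
    forall (d : measure_display) (T : measurableType d) (P : probability T R)
      (F : nat -> set (set T)) (M : nat -> T -> X),
      martingale P F M -> (forall n, L2 P (M n)) ->
      forall (n : nat) (eps : nat -> R),
        (forall i, eps i = 1 \/ eps i = -1) ->
        (L2norm P (fun t => (\sum_(i < n.+1) eps i *: mdiff M i t)%R)
         <= c%:E * L2norm P (fun t => (\sum_(i < n.+1) mdiff M i t)%R))%E.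

Section unit_interval.
Context (R : realType).

(* Lebesgue measure on [0, 1], carried by the whole line; a function on [0, 1]
   is represented by any of its extensions to the line. *)
Definition lebesgue01 : set (measurableTypeR R) -> \bar R :=
  mrestr lebesgue_measure (measurable_itv `[0%R : R, 1%R]).

HB.instance Definition _ := Measure.on lebesgue01.

Let lebesgue01_setT : lebesgue01 setT = 1%:E.
Proof.
by rewrite /lebesgue01 /mrestr setTI lebesgue_measure_itv /= lte01 sube0.
Qed.

HB.instance Definition _ :=
  Measure_isProbability.Build _ _ _ lebesgue01 lebesgue01_setT.

End unit_interval.

Section walsh.
Context (R : realType).

Definition rademacher1 (t : R) : R :=
  if t - (Num.floor t)%:~R < 2^-1 then 1 else -1.

(* The index is shifted: rademacher i is r_(i+1). *)
Definition rademacher (i : nat) (t : R) : R := rademacher1 (2 ^+ i * t).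

(* Binary digits of n of index i >= n vanish. *)
Definition walsh (n : nat) (t : R) : R :=
  \prod_(i < n) rademacher i t ^+ (n %/ 2 ^ i %% 2)%N.

Context (X : completeNormedModType R).

Definition walsh_coef (f : R -> X) (i : nat) : X :=
  bochner_integral (@lebesgue01 R) (fun t => walsh i t *: f t).

Definition walsh_sum (n : nat) (f : R -> X) : R -> X :=
  fun t => \sum_(i < n) walsh i t *: walsh_coef f i.

End walsh.

(* Main.v *)
Require Import Defs.
From HB Require Import structures.
From mathcomp Require Import all_boot all_order all_algebra.
From mathcomp Require Import all_classical all_reals all_analysis.
From mathcomp Require Import measurable_realfun zify ring lra.

Import Order.TTheory GRing.Theory Num.Theory.
Import numFieldNormedType.Exports.
Local Open Scope classical_set_scope.
Local Open Scope ring_scope.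

Set Implicit Arguments.
Unset Strict Implicit.
Unset Printing Implicit Defensive.

(** Write r_j for the Rademacher functions, w_n for the Walsh functions, S_n for
    the Walsh partial sums and E_i for S_(2^i).  The kernel of E_i is
    prod_(j < i) (1 + r_j(t) r_j(s)), which is 2^i times the indicator of t and s
    having the same first i binary digits; so E_i is the conditional expectation
    on the i-th dyadic algebra.  Both directions rest on one identity between
    kernels ([dirichlet_kernel_transform], [walsh_sum_transform]): if n has
    binary digits n_i, then
      S_n f = w_n sum_i n_i (E_(i+1) - E_i)(w_n f).
    Walsh partial sums are thus, up to the unimodular factor w_n, martingale
    transforms of dyadic martingales with coefficients 0 and 1 that do not
    depend on the point, and every such choice of coefficients occurs.

    From UMD to convergence.  The sequence E_i (w_n f) is a martingale, and a
    coefficient 0 or 1 is the mean of 1 and a sign, so the UMD inequality bounds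
    the operators S_n on L_2 uniformly ([UMD_walsh_bounded]).  Functions of
    finitely many digits are dense ([dyadic_dense]) and are fixed by S_n as soon
    as n is large ([walsh_sum_id]), and convergence follows.

    From convergence to UMD.  A gliding hump turns pointwise convergence into a
    uniform bound for the S_n on simple functions ([walsh_uniformly_bounded]),
    hence, by the identity, into the UMD inequality for Paley-Walsh martingales
    sum_i r_i D_i with D_i a function of the first i digits
    ([paley_transform_bound]).  It remains to pass from dyadic to arbitrary
    martingales.  Following Burkholder, let U(x, y) be the supremum of
    E |Y|^2 - c^2 E |X|^2 over all finite dyadic martingales X started at x,
    Y being started at y and driven by the increments of X with deterministic
    signs.  The dyadic inequality says U(0, 0) <= 0 ([bellman00]).
    Two trees with different sign sequences can be run one after the other, each
    waiting with zero increments while the other one moves; therefore U is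
    midpoint concave along the lines a |-> (x + a, y + a) and
    a |-> (x + a, y - a), although the signs are not allowed to depend on the
    past ([bellman_mid]).  As U is bounded below on bounded sets, it is concave
    on these lines and satisfies Jensen's inequality ([bellman_jensen]).  Along any
    martingale on a finite weighted set, E U(X_k, Y_k) is then nonincreasing,
    which gives the UMD inequality for such martingales with the same constant
    ([finite_martingale_ineq]).  Finally an arbitrary L_2 martingale is close to
    a martingale with finitely many values: condition M_k on the finite algebra
    generated by simple functions s_0, ..., s_k, where s_j is measurable at time
    j and close to M_j ([martingale_approx]).

    The Bochner integral is developed for functions in L_2, which is all that
    occurs.  The basic tool is to write a simple function as v o k with k a
    measurable map to a finite type, so that integrals become finite sums, and
    to replace a strongly measurable function by an everywhere limit of simple
    functions, whose norm is measurable. *)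

(** * Measurable maps to finite types *)

Section labels.
Context d (T : measurableType d) (G : set (set T)) (sG : sigma_algebra setT G).

Definition labelling (L : finType) (k : T -> L) :=
  forall l, G (k @^-1` [set l]).

Let sigma_measurable B : G B = (@measurable _ (g_sigma_algebraType G)) B.
Proof. by rewrite /measurable/= (sigma_algebra_id sG). Qed.

(** A finite union of fibres. *)
Lemma labelling_preimage (L : finType) (k : T -> L) (A : set L) :
  labelling k -> G (k @^-1` A).
Proof.
move=> hk.
have -> : k @^-1` A = \bigcup_(l in A) (k @^-1` [set l]).
  by apply/seteqP; split=> [t At|t [l Al /= kt]]; [exists (k t)|rewrite /= kt].
rewrite sigma_measurable; apply: fin_bigcup_measurable => [|l _].
  exact: finite_finset.
by rewrite -sigma_measurable; exact: hk.
Qed.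

Lemma labelling_comp (L L' : finType) (k : T -> L) (f : L -> L') :
  labelling k -> labelling (f \o k).
Proof. by move=> hk l; rewrite comp_preimage; exact: labelling_preimage. Qed.

Lemma labelling_cst (L : finType) (l : L) : labelling (fun _ : T => l).
Proof.
have h : labelling (fun _ : T => tt).
  case; rewrite (_ : _ @^-1` _ = setT `\` set0); last first.
    by rewrite setD0; apply/seteqP; split.
  by case: sG => g0 gC _; apply: gC.
exact: (labelling_comp (fun=> l) h).
Qed.

Lemma labelling_pair (L1 L2 : finType) (k1 : T -> L1) (k2 : T -> L2) :
  labelling k1 -> labelling k2 -> labelling (fun t => (k1 t, k2 t)).
Proof.
move=> h1 h2 [l1 l2].
have -> : (fun t => (k1 t, k2 t)) @^-1` [set (l1, l2)] =
    k1 @^-1` [set l1] `&` k2 @^-1` [set l2].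
  by apply/seteqP; split=> t /=; [case=> <- <-|case=> -> ->].
by rewrite sigma_measurable; apply: measurableI; rewrite -sigma_measurable.
Qed.

Lemma labelling_ffun (I L : finType) (k : I -> T -> L) :
  (forall i, labelling (k i)) -> labelling (fun t => [ffun i => k i t]).
Proof.
move=> hk l.
have -> : (fun t => [ffun i => k i t]) @^-1` [set l] =
    \bigcap_(i in [set: I]) (k i @^-1` [set l i]).
  apply/seteqP; split=> [t /= <- i _/=|t h]; first by rewrite ffunE.
  by apply/ffunP => i; rewrite ffunE; exact: h.
rewrite sigma_measurable; apply: fin_bigcap_measurable => [|i _].
  exact: finite_finset.
by rewrite -sigma_measurable; exact: hk.
Qed.

Context (R : realType) (X : completeNormedModType R).

(** The label of t is the position of s t in a duplicate-free list of the
    range, so that distinct labels have disjoint fibres that are again level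
    sets of s. *)
Lemma simple_label (s : T -> X) : simple G s ->
  exists m (k : T -> 'I_m) (v : 'I_m -> X), labelling k /\ s = v \o k.
Proof.
move=> [/finite_seqP[r0 hr] hG].
pose r := undup r0.
have mem t : s t \in r.
  rewrite mem_undup; have : range s (s t) by exists t.
  by rewrite hr.
have lt t : (index (s t) r < size r)%N by rewrite index_mem.
exists (size r), (fun t => Ordinal (lt t)), (fun i => nth 0 r i); split; last first.
  by apply/funext => t /=; rewrite nth_index.
move=> l; have -> : (fun t => Ordinal (lt t)) @^-1` [set l] = s @^-1` [set nth 0 r l].
  apply/seteqP; split => t /=; first by move=> <-/=; rewrite nth_index.
  by move=> h; apply/val_inj => /=; rewrite h index_uniq ?undup_uniq.
exact: hG.
Qed.

Lemma label_simple (L : finType) (k : T -> L) (v : L -> X) :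
  labelling k -> simple G (v \o k).
Proof.
move=> hk; split.
  apply: (@sub_finite_set _ _ (v @` setT)); last exact/finite_image/finite_finset.
  by move=> _ [t _ <-]; exists (k t).
by move=> x; rewrite comp_preimage; exact: labelling_preimage.
Qed.
End labels.

(** * Integrals of functions with finitely many values *)

Section finite_valued.
Context d (T : measurableType d) (R : realType) (P : probability T R).
Context (X : completeNormedModType R).
Implicit Types (f g : T -> X).

Local Notation mlab := (labelling (@measurable d T)).
Let sA := @sigma_algebra_measurable d T.

Import HBNNSimple.

(** The integral of a nonnegative function is a supremum over the simple
    functions below it, hence makes sense without measurability. It depends
    only on the almost everywhere class because a simple function below f can
    be set to 0 on a null set without changing its integral. *)
Lemma ge0_integral_ae (f g : T -> \bar R) :
  (forall t, 0 <= f t)%E -> (forall t, 0 <= g t)%E ->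
  {ae P, forall t, f t = g t} -> (\int[P]_t f t = \int[P]_t g t)%E.
Proof.
wlog suff W : f g / (forall t, 0 <= f t)%E -> (forall t, 0 <= g t)%E ->
  {ae P, forall t, f t = g t} -> (\int[P]_t f t <= \int[P]_t g t)%E.
  move=> f0 g0 fg; apply/eqP; rewrite eq_le !W//.
  by apply: filterS fg => t ->.
move=> f0 g0 [N [mN N0 hN]].
rewrite (ge0_integralTE _ f0) (ge0_integralTE _ g0).
apply: ge_ereal_sup => _ [h /= hf <-].
(* Cut h down to the complement of the null set, where f and g agree. *)
pose h' := mul_nnsfun h (indic_nnsfun R (measurableC mN)).
have -> : sintegral P h = sintegral P h'.
  rewrite -!integralT_nnsfun; apply: ge0_ae_eq_integral => //.
  - by apply/measurable_EFinP; exact: measurable_funPT.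
  - by apply/measurable_EFinP; exact: measurable_funPT.
  - by move=> t _; rewrite lee_fin.
  - by move=> t _; rewrite lee_fin.
  exists N; split=> // t /= ht; apply: contrapT => nt; apply: ht => _.
  change ((h t)%:E = (h t * \1_(~` N) t)%:E).
  by rewrite indicE mem_set ?mulr1.
apply: ereal_sup_ubound; exists h' => // t /=.
change ((h t * \1_(~` N) t)%:E <= g t)%E.
rewrite indicE; have [/set_mem/= nt|_] := boolP (t \in ~` N); last by rewrite mulr0.
rewrite mulr1 (le_trans (hf t))//.
by rewrite (_ : f t = g t)//; apply: contrapT => h1; apply: nt; exact: hN.
Qed.

Lemma integral_label (L : finType) (k : T -> L) (phi : L -> R) :
  mlab k -> (forall l, 0 <= phi l) ->
  (\int[P]_t (phi (k t))%:E = \sum_l ((phi l)%:E * P (k @^-1` [set l])))%E.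
Proof.
move=> hk phi0.
have E t : ((phi (k t))%:E = \sum_l ((phi l)%:E * (\1_(k @^-1` [set l]) t)%:E))%E.
  rewrite (bigD1 (k t))//= big1 ?adde0; last first.
    move=> l lk; rewrite indicE memNset ?mule0//= => h.
    by move: lk; rewrite h eqxx.
  by rewrite indicE mem_set// mule1.
under eq_integral do rewrite E.
rewrite ge0_integral_sum//; last 2 first.
- move=> l; apply: emeasurable_funM => //; apply/measurable_EFinP.
  exact: measurable_indic.
- by move=> l t _; rewrite mule_ge0 ?lee_fin.
apply: eq_bigr => l _.
by rewrite ge0_integralZl ?integral_indic ?setIT ?lee_fin//;
  apply/measurable_EFinP; exact: measurable_indic.
Qed.

Lemma measure_label (L : finType) (k : T -> L) (A : {pred L}) : mlab k ->
  P (k @^-1` [set l | l \in A]) = (\sum_(l in A) P (k @^-1` [set l]))%E.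
Proof.
move=> hk.
have := integral_label (phi := fun l => (l \in A)%:R) hk (fun l => ler0n _ _).
rewrite (_ : (fun t => _) = (fun t => (\1_(k @^-1` [set l | l \in A]) t)%:E)); last first.
  apply/funext => t; rewrite indicE; congr ((nat_of_bool _)%:R%:E).
  by apply/idP/idP => h; [exact/mem_set|exact: (set_mem h)].
rewrite integral_indic//; last exact: labelling_preimage.
rewrite setIT => ->; rewrite [RHS]big_mkcond/=; apply: eq_bigr => l _.
by case: (l \in A); rewrite ?mul1e ?mul0e.
Qed.

(** The level sets of v o k are unions of fibres of k, and several labels may
    share a value. *)
Lemma simple_integral_label (L : finType) (k : T -> L) (v : L -> X) : mlab k ->
  simple_integral P (v \o k) = \sum_l fine (P (k @^-1` [set l])) *: v l.
Proof.
move=> hk; rewrite /simple_integral.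
pose r := undup (codom v).
have hr l : v l \in r by rewrite mem_undup codom_f.
rewrite -(@fsbig_widen _ _ _ _ [set` r])//; last first.
  move=> x [_ /= xr].
  rewrite (_ : _ @^-1` _ = set0) ?measure0 ?scale0r//.
  by rewrite -subset0 => t /= h; apply: xr; rewrite -h hr.
rewrite -(@fsbig_seq _ _ _ X r) ?undup_uniq//.
have E x : fine (P ((v \o k) @^-1` [set x])) *: x =
    \sum_(l | v l == x) fine (P (k @^-1` [set l])) *: v l.
  rewrite (_ : _ @^-1` _ = k @^-1` [set l | l \in [pred l | v l == x]]); last first.
    by apply/seteqP; split => t /=; rewrite inE => /eqP.
  rewrite measure_label// -sum_fine//; last by move=> l _; exact: fin_num_measure.
  by rewrite scaler_suml; apply: eq_bigr => l /eqP <-.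
under eq_bigr do rewrite E.
rewrite /= (exchange_big_dep xpredT)//=; apply: eq_bigr => l _.
rewrite -big_filter (_ : [seq _ <- _ | _] = [:: v l]) ?big_seq1//.
rewrite -[RHS](filter_pred1_uniq (undup_uniq _) (hr l)).
by apply: eq_filter => x /=; rewrite eq_sym.
Qed.

End finite_valued.

(** * Strong measurability *)

Section pointwise_measurable.
Context d (T : measurableType d) (R : realType) (P : probability T R).
Context (X : completeNormedModType R).
Implicit Types (f g s : T -> X).

Local Notation mlab := (labelling (@measurable d T)).
Local Notation simp := (simple (@measurable d T)).
Local Notation sm := (strongly_measurable P).
Let sA := @sigma_algebra_measurable d T.

Lemma measurable_label (L : finType) (k : T -> L) (phi : L -> R) :
  mlab k -> measurable_fun setT (fun t => phi (k t)).
Proof.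
move=> hk _ A mA; rewrite setTI.
exact: (labelling_preimage sA (phi @^-1` A) hk).
Qed.

Lemma simple_binary (Y Z : completeNormedModType R) (F : X -> Y -> Z) (s1 : T -> X) (s2 : T -> Y) :
  simp s1 -> simp s2 -> simp (fun t => F (s1 t) (s2 t)).
Proof.
move=> /simple_label[m1 [k1 [v1 [h1 ->]]]] /simple_label[m2 [k2 [v2 [h2 ->]]]].
exact: (@label_simple _ _ _ sA _ _ _ _ (fun l => F (v1 l.1) (v2 l.2))
  (labelling_pair sA h1 h2)).
Qed.

Lemma measurable_norm_simple s : simp s -> measurable_fun setT (fun t => `|s t|).
Proof.
move=> /simple_label[m [k [v [hk ->]]]].
exact: (measurable_label (fun l => `|v l|) hk).
Qed.

(** The representatives of strongly measurable functions for which the norm is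
    a measurable function. *)
Definition pointwise_measurable f := exists s : nat -> T -> X,
  (forall n, simp (s n)) /\ forall t, s n t @[n --> \oo] --> f t.

Lemma measurable_norm_pointwise f : pointwise_measurable f -> measurable_fun setT (fun t => `|f t|).
Proof.
move=> [s [hs sf]].
apply: (@measurable_fun_cvg _ _ _ _ (fun n t => `|s n t|)) => [n|t _].
  exact: measurable_norm_simple.
by apply: cvg_norm; exact: sf.
Qed.

Lemma pointwise_simple s : simp s -> pointwise_measurable s.
Proof. by move=> hs; exists (fun=> s); split=> // t; exact: cvg_cst. Qed.

Lemma pointwise_measurableD f g : pointwise_measurable f ->
  pointwise_measurable g -> pointwise_measurable (fun t => f t + g t).
Proof.
move=> [s [hs sf]] [r [hr rg]]; exists (fun n t => s n t + r n t); split => [n|t].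
  exact: (simple_binary +%R).
exact: cvgD.
Qed.

Lemma pointwise_measurableM (L : finType) (k : T -> L) (phi : L -> R) f :
  mlab k -> pointwise_measurable f -> pointwise_measurable (fun t => phi (k t) *: f t).
Proof.
move=> hk [s [hs sf]]; exists (fun n t => phi (k t) *: s n t); split => [n|t]; last first.
  by apply: cvgZl_tmp; exact: sf.
have [m [k' [v [hk' ->]]]] := simple_label (hs n).
exact: (@label_simple _ _ _ sA _ _ _ _ (fun l => phi l.1 *: v l.2)
  (labelling_pair sA hk hk')).
Qed.

Lemma pointwise_strongly_measurable f : pointwise_measurable f -> sm f.
Proof. by move=> [s [hs sf]]; exists s; split=> //; exact/nearW. Qed.

Lemma strongly_measurable_ae f g : sm f -> {ae P, forall t, f t = g t} -> sm g.
Proof.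
move=> [s [hs sf]] fg; exists s; split=> //.
by apply: filterS2 fg sf => t ->.
Qed.

(** Set f to 0 on a measurable null set outside of which the approximating
    simple functions converge. *)
Lemma strongly_measurable_rep f : sm f -> exists g, pointwise_measurable g /\ {ae P, forall t, f t = g t}.
Proof.
move=> [s [hs [N [mN N0 hN]]]].
pose c := fun t => (t \in ~` N).
have hc : mlab c.
  have mNC := measurableC mN.
  case; [rewrite (_ : _ @^-1` _ = ~` N)//|rewrite (_ : _ @^-1` _ = N)//].
    by apply/seteqP; split=> t /=; [move=> /set_mem|move=> h; exact/mem_set].
  apply/seteqP; split=> t /=.
    by rewrite /c => /negbT; rewrite notin_setE/= => /contrapT.
  by move=> Nt; rewrite /c memNset//=; exact.
exists (fun t => (c t)%:R *: f t); split.
  exists (fun n t => (c t)%:R *: s n t); split => [n|t].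
    have [m [k' [v [hk' ->]]]] := simple_label (hs n).
    exact: (@label_simple _ _ _ sA _ _ _ _ (fun l : bool * _ => (nat_of_bool l.1)%:R *: v l.2)
      (labelling_pair sA hc hk')).
  have [ct|ct] := boolP (c t); last first.
    by under eq_fun do rewrite scale0r; rewrite scale0r; exact: cvg_cst.
  under eq_fun do rewrite scale1r; rewrite scale1r.
  by apply: contrapT => h; move/set_mem: ct; apply; exact: hN.
exists N; split=> // t /= h; apply: contrapT => nt; apply: h.
by rewrite /c mem_set// scale1r.
Qed.

Lemma strongly_measurableD f g : sm f -> sm g -> sm (fun t => f t + g t).
Proof.
move=> /strongly_measurable_rep[f' [hf ff]] /strongly_measurable_rep[g' [hg gg]].
apply: (strongly_measurable_ae (pointwise_strongly_measurable (pointwise_measurableD hf hg))).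
by apply: filterS2 ff gg => t -> ->.
Qed.

Lemma strongly_measurableM (L : finType) (k : T -> L) (phi : L -> R) f :
  mlab k -> sm f -> sm (fun t => phi (k t) *: f t).
Proof.
move=> hk /strongly_measurable_rep[f' [hf ff]].
apply: (strongly_measurable_ae
  (pointwise_strongly_measurable (pointwise_measurableM phi hk hf))).
by apply: filterS ff => t ->.
Qed.

Lemma strongly_measurableZ (a : R) f : sm f -> sm (fun t => a *: f t).
Proof. exact: (strongly_measurableM (fun=> a) (labelling_cst sA tt)). Qed.

Lemma strongly_measurableB f g : sm f -> sm g -> sm (fun t => f t - g t).
Proof.
move=> hf /(strongly_measurableZ (-1)) hg; rewrite (_ : (fun _ => _) = (fun t => f t + -1 *: g t)).
  exact: strongly_measurableD.
by apply/funext => t; rewrite scaleN1r.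
Qed.

Lemma strongly_measurable_simple s : simp s -> sm s.
Proof. by move=> /pointwise_simple/pointwise_strongly_measurable. Qed.

(** Monotonicity of the integral needs measurability, and the norm of a
    strongly measurable function is only almost everywhere equal to a
    measurable function; the bound is transferred through a representative. *)
Lemma integral_norm_le p f (h : T -> \bar R) :
  sm f -> measurable_fun setT h -> (forall t, (`|f t| ^+ p)%:E <= h t)%E ->
  (\int[P]_t (`|f t| ^+ p)%:E <= \int[P]_t h t)%E.
Proof.
move=> hf mh fh.
have h0 t : (0 <= h t)%E by rewrite (le_trans _ (fh t))// lee_fin exprn_ge0.
have [f' [hf' ff]] := strongly_measurable_rep hf.
have [N [mN N0 hN]] := ff.
rewrite (@ge0_integral_ae _ _ _ P _ (fun t => (`|f' t| ^+ p)%:E)); last 3 first.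
- by move=> t; rewrite lee_fin exprn_ge0.
- by move=> t; rewrite lee_fin exprn_ge0.
- by apply: filterS ff => t ->.
apply: ae_ge0_le_integral => //.
- by apply/measurable_EFinP; apply: measurable_funX; exact: measurable_norm_pointwise.
- by apply: filterS ff => t <- _.
Qed.

End pointwise_measurable.

(** * The L2 norm *)

Section L2theory.
Context d (T : measurableType d) (R : realType) (P : probability T R).
Context (X : completeNormedModType R).
Implicit Types (f g s : T -> X).

Local Notation mlab := (labelling (@measurable d T)).
Local Notation simp := (simple (@measurable d T)).
Local Notation sm := (strongly_measurable P).

Definition sq_integral f : \bar R := (\int[P]_t (`|f t| ^+ 2)%:E)%E.

Lemma sq_integral_ge0 f : (0 <= sq_integral f)%E.
Proof. by apply: integral_ge0 => t _; rewrite lee_fin exprn_ge0. Qed.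

Lemma L2normE f : L2norm P f = sqrte (sq_integral f).
Proof.
rewrite /L2norm unlock /= -poweR12_sqrt ?sq_integral_ge0//; congr poweR.
apply: eq_integral => t _.
by rewrite /= normr_id powR_mulrn//.
Qed.

Lemma L2norm_ge0 f : (0 <= L2norm P f)%E.
Proof. exact: Lnorm_ge0. Qed.

Lemma L2norm_leP f (c : R) : 0 <= c ->
  (L2norm P f <= c%:E)%E = (sq_integral f <= (c ^+ 2)%:E)%E.
Proof.
move=> c0; rewrite L2normE.
have {1}-> : c%:E = sqrte ((c ^+ 2)%:E) by rewrite /= sqrtr_sqr ger0_norm.
by rewrite lee_sqrt// lee_fin exprn_ge0.
Qed.

Lemma sqr_L2norm f : (L2norm P f ^+ 2 = sq_integral f)%E.
Proof. by rewrite L2normE sqr_sqrte// sq_integral_ge0. Qed.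

Lemma L2norm_ae f g : {ae P, forall t, f t = g t} -> L2norm P f = L2norm P g.
Proof.
move=> fg; rewrite !L2normE; congr sqrte; apply: ge0_integral_ae.
- by move=> t; rewrite lee_fin exprn_ge0.
- by move=> t; rewrite lee_fin exprn_ge0.
- by apply: filterS fg => t ->.
Qed.

(** Minkowski's inequality for the real functions |f| and |g|, applied to
    representatives. *)
Lemma L2normD f g : sm f -> sm g ->
  (L2norm P (fun t => (f t + g t)%R) <= L2norm P f + L2norm P g)%E.
Proof.
move=> /strongly_measurable_rep[f' [hf ff]] /strongly_measurable_rep[g' [hg gg]].
rewrite (L2norm_ae ff) (L2norm_ae gg).
rewrite (@L2norm_ae _ (fun t => f' t + g' t)); last first.
  by apply: filterS2 ff gg => t -> ->.
have mf := measurable_norm_pointwise hf; have mg := measurable_norm_pointwise hg.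
apply: (le_trans _ (eminkowski _ mf mg _)) => //; last by rewrite lee_fin ler1n.
set h := _ \+ _.
have -> : Lnorm P 2%:E (EFin \o h) = sqrte (\int[P]_t (h t ^+ 2)%:E)%E.
  rewrite unlock /= -poweR12_sqrt; last first.
    by apply: integral_ge0 => t _; rewrite lee_fin exprn_even_ge0.
  congr poweR; apply: eq_integral => t _.
  by rewrite /= ger0_norm ?addr_ge0// powR_mulrn ?addr_ge0.
rewrite L2normE lee_sqrt; last first.
  by apply: integral_ge0 => t _; rewrite lee_fin exprn_even_ge0.
apply: ge0_le_integral => //.
- apply/measurable_EFinP; apply: measurable_funX; apply: measurable_norm_pointwise.
  exact: pointwise_measurableD.
- by apply/measurable_EFinP; apply: measurable_funX; exact: measurable_funD.
- move=> t _; rewrite lee_fin lerXn2r ?nnegrE ?addr_ge0//.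
  exact: ler_normD.
Qed.

Lemma L2norm_le f (h : T -> X) : sm f -> sm h -> (forall t, `|f t| <= `|h t|) ->
  (L2norm P f <= L2norm P h)%E.
Proof.
move=> hf /strongly_measurable_rep[h' [hh hhh]] fh.
have [f' [hf' ff]] := strongly_measurable_rep hf.
rewrite (L2norm_ae ff) (L2norm_ae hhh) !L2normE lee_sqrt ?sq_integral_ge0//.
apply: ae_ge0_le_integral => //.
- by apply/measurable_EFinP; apply: measurable_funX; exact: measurable_norm_pointwise.
- by apply/measurable_EFinP; apply: measurable_funX; exact: measurable_norm_pointwise.
- apply: filterS2 ff hhh => t <- <- _.
  by rewrite lee_fin lerXn2r ?nnegrE.
Qed.

Lemma L2normZ (a : R) f : sm f ->
  (L2norm P (fun t => a *: f t)%R = `|a|%:E * L2norm P f)%E.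
Proof.
move=> hf.
have [f' [hf' ff]] := strongly_measurable_rep hf.
rewrite (L2norm_ae ff) (@L2norm_ae _ (fun t => a *: f' t)); last first.
  by apply: filterS ff => t ->.
rewrite !L2normE.
have -> : `|a|%:E = sqrte ((a ^+ 2)%:E) by rewrite /= sqrtr_sqr.
rewrite -sqrteM ?lee_fin ?sqr_ge0//; congr sqrte.
rewrite /sq_integral -ge0_integralZl//.
- by apply: eq_integral => t _; rewrite normrZ exprMn real_normK ?num_real.
- by apply/measurable_EFinP; apply: measurable_funX; exact: measurable_norm_pointwise.
- by rewrite lee_fin sqr_ge0.
Qed.

Lemma L2norm_norm f (g : T -> X) : (forall t, `|f t| = `|g t|) -> L2norm P f = L2norm P g.
Proof. by move=> fg; rewrite /L2norm; apply: eq_Lnorm => t; rewrite fg. Qed.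

Lemma L2norm_bounded f (c : R) : sm f -> 0 <= c -> (forall t, `|f t| <= c) ->
  (L2norm P f <= c%:E)%E.
Proof.
move=> hf c0 fc; rewrite L2norm_leP//.
rewrite (le_trans (@integral_norm_le _ _ _ P _ 2 f (cst (c ^+ 2)%:E) hf _ _))//.
- by move=> t /=; rewrite lee_fin lerXn2r ?nnegrE.
- by rewrite integral_cst// -[X in (X <= _)%E]/((c^+2)%:E * P setT)%E probability_setT mule1.
Qed.

Lemma L2D f g : L2 P f -> L2 P g -> L2 P (fun t => f t + g t).
Proof.
move=> [hf f2] [hg g2]; split; first exact: strongly_measurableD.
by rewrite (le_lt_trans (L2normD hf hg))// lte_add_pinfty.
Qed.

Lemma L2Z (a : R) f : L2 P f -> L2 P (fun t => a *: f t).
Proof.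
move=> [hf f2]; split; first exact: strongly_measurableZ.
by rewrite L2normZ// lte_mul_pinfty// lee_fin.
Qed.

Lemma L2B f g : L2 P f -> L2 P g -> L2 P (fun t => f t - g t).
Proof.
move=> hf /(L2Z (-1)) hg.
have := L2D hf hg; congr (L2 P _); apply/funext => t; by rewrite scaleN1r.
Qed.

Lemma L2normB f g : sm f -> sm g ->
  (L2norm P (fun t => (f t - g t)%R) <= L2norm P f + L2norm P g)%E.
Proof.
move=> hf hg; have := L2normD hf (strongly_measurableZ (-1) hg).
rewrite L2normZ// normrN1 mul1e => h; apply: le_trans h.
rewrite le_eqVlt; apply/orP; left; apply/eqP; congr L2norm.
by apply/funext => t; rewrite scaleN1r.
Qed.

Lemma simple_bounded s : simp s -> exists c : R, 0 <= c /\ forall t, `|s t| <= c.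
Proof.
move=> /simple_label[m [k [v [hk ->]]]].
exists (\sum_i `|v i|); split; first by apply: sumr_ge0.
by move=> t /=; rewrite (bigD1 (k t))//= lerDl sumr_ge0.
Qed.

Lemma L2_simple s : simp s -> L2 P s.
Proof.
move=> hs; split; first exact: strongly_measurable_simple.
have [c [c0 sc]] := simple_bounded hs.
by rewrite (le_lt_trans (L2norm_bounded (strongly_measurable_simple P hs) c0 sc))// ltry.
Qed.

(** The multipliers of interest are Walsh functions, kernels and
    indicators. *)
Lemma L2M (L : finType) (k : T -> L) (phi : L -> R) f :
  mlab k -> L2 P f -> L2 P (fun t => phi (k t) *: f t).
Proof.
move=> hk [hf f2]; have hm := strongly_measurableM phi hk hf; split=> //.
pose c := \sum_l `|phi l|.
have c0 : 0 <= c by apply: sumr_ge0.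
apply: (@le_lt_trans _ _ (L2norm P (fun t => c *: f t))); last by have [] := L2Z c (conj hf f2).
apply: L2norm_le => //; first exact: strongly_measurableZ.
move=> t; rewrite !normrZ ler_wpM2r// (ger0_norm c0) /c.
by rewrite (bigD1 (k t))//= lerDl sumr_ge0.
Qed.

(** Hoelder's inequality against the constant 1, of norm 1 since P is a
    probability. *)
Lemma integral_norm_le_L2norm f : sm f -> (\int[P]_t (`|f t|)%:E <= L2norm P f)%E.
Proof.
move=> /strongly_measurable_rep[f' [hf ff]].
rewrite (L2norm_ae ff) (@ge0_integral_ae _ _ _ P _ (fun t => (`|f' t|)%:E)); last 3 first.
- by move=> t; rewrite lee_fin.
- by move=> t; rewrite lee_fin.
- by apply: filterS ff => t ->.
have mf := measurable_norm_pointwise hf.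
have e1 : 2^-1 + 2^-1 = 1 :> R by lra.
have := @hoelder _ _ _ P (fun t => `|f' t|) (cst 1) 2 2 mf (measurable_cst _)
  (ltr0n _ _) (ltr0n _ _) e1.
rewrite Lnorm1.
have -> : Lnorm P 2%:E (EFin \o cst 1) = 1%E.
  rewrite (_ : EFin \o cst 1 = cst 1%E)// Lnorm_cst1.
  by rewrite -[X in poweR X]/(P setT) probability_setT poweR1r.
rewrite mule1 => h; apply: le_trans h.
by apply: ge0_le_integral => //=; [exact/measurable_EFinP|
 under eq_fun do rewrite mulr1 normr_id; exact/measurable_EFinP|
 move=> t _; rewrite mulr1 normr_id].
Qed.

End L2theory.

(** * Density of simple functions *)

Section density.
Context d (T : measurableType d) (R : realType) (P : probability T R).
Context (X : completeNormedModType R).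
Implicit Types (f g s : T -> X).

Local Notation simp := (simple (@measurable d T)).
Local Notation sm := (strongly_measurable P).
Let sA := @sigma_algebra_measurable d T.

Lemma sq_integral_lty f : (L2norm P f < +oo)%E -> (sq_integral P f < +oo)%E.
Proof.
rewrite -sqr_L2norm; have := L2norm_ge0 P f.
by case: (L2norm P f) => //= r _ _; rewrite ltry.
Qed.

Lemma cvge_to0P (u : nat -> \bar R) : (forall n, 0 <= u n)%E ->
  u n @[n --> \oo] --> 0%E <->
  forall e : R, 0 < e -> \forall n \near \oo, (u n <= e%:E)%E.
Proof.
move=> u0; split=> [/fine_cvgP[fu /cvgrPdist_le h] e e0|h].
  apply: filterS2 fu (h e e0) => n un /=.
  rewrite sub0r normrN ger0_norm ?fine_ge0//.
  by rewrite -{2}(fineK un) lee_fin.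
apply/fine_cvgP; split.
  apply: filterS (h 1 ltr01) => n hn.
  by rewrite ge0_fin_numE// (le_lt_trans hn)// ltry.
apply/cvgrPdist_le => e e0; apply: filterS (h e e0) => n hn /=.
rewrite sub0r normrN ger0_norm ?fine_ge0//.
by rewrite -lee_fin fineK// ge0_fin_numE// (le_lt_trans hn)// ltry.
Qed.

(** Dominated convergence for the squared norms. *)
Lemma dominated_L2 (h : nat -> T -> X) (g : T -> R) :
  (forall n, pointwise_measurable (h n)) -> {ae P, forall t, h n t @[n --> \oo] --> 0} ->
  measurable_fun setT g -> (\int[P]_t (g t ^+ 2)%:E < +oo)%E ->
  (forall n t, `|h n t| <= g t) ->
  L2norm P (h n) @[n --> \oo] --> 0%E.
Proof.
move=> hh h0 mg gfin hg.
have mh n : measurable_fun setT (fun t => (`|h n t| ^+ 2)%:E).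
  by apply/measurable_EFinP; apply: measurable_funX; exact: measurable_norm_pointwise.
have H0 : {ae P, forall t, setT t -> (`|h n t| ^+ 2)%:E @[n --> \oo] --> cst 0%E t}.
  apply: filterS h0 => t ht _; apply: cvg_EFin; first exact: nearW.
  rewrite (_ : fine \o _ = (fun n => `|h n t| ^+ 2))//.
  have -> : 0 = `|0 : X| * `|0 : X| by rewrite normr0 mulr0.
  by under eq_fun do rewrite expr2; apply: cvgM; exact: cvg_norm.
have H1 : P.-integrable setT (fun t => (g t ^+ 2)%:E).
  apply/integrableP; split.
    by apply/measurable_EFinP; exact: measurable_funX.
  by under eq_integral do rewrite gee0_abs ?lee_fin ?sqr_ge0//.
have H2 : {ae P, forall t n, setT t -> (`|(`|h n t| ^+ 2)%:E| <= (g t ^+ 2)%:E)%E}.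
  apply: nearW => t n _; rewrite gee0_abs ?lee_fin ?sqr_ge0// ?exprn_ge0//.
  by rewrite lerXn2r ?nnegrE// (le_trans _ (hg n t)).
have [_ _ H] := dominated_convergence measurableT mh (measurable_cst _) H0 H1 H2.
have {}H : sq_integral P (h n) @[n --> \oo] --> 0%E.
  by rewrite -(integral0 P setT); exact: H.
apply/fine_cvgP; split.
  have /fine_cvgP[+ _] := H; apply: filterS => n.
  by rewrite L2normE sqrte_fin_num// sq_integral_ge0.
have /fine_cvgP[fn Hf] := H.
rewrite (_ : fine \o _ = fun n => Num.sqrt (fine (sq_integral P (h n)))); last first.
  apply/funext => n /=; rewrite L2normE.
  by case: (sq_integral P (h n)) => //=; rewrite sqrtr0.
rewrite -(@sqrtr0 R).
apply: (@cvg_comp _ _ _ (fine \o (fun n => sq_integral P (h n))) Num.sqrt); first exact: Hf.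
exact: sqrt_continuous.
Qed.

(** Two approximations. The truncation phi K x = K / (K + |x|) x is
    continuous, bounded by K, and tends to x as K grows, so phi K o f is close
    to f; for K fixed, phi K o s_n tends to phi K o f boundedly. Composition
    with phi K keeps the s_n simple with respect to G, which would fail for a
    truncation at a set where |f| is large. *)
Lemma L2_simple_dense G f : sigma_algebra setT G -> G `<=` measurable ->
  strongly_measurable_wrt P G f -> (L2norm P f < +oo)%E ->
  forall e : R, 0 < e -> exists s, simple G s /\
    (L2norm P (fun t => (f t - s t)%R) <= e%:E)%E.
Proof.
move=> sG Gm [s [hs sf]] f2 e e0.
have hs' n : simp (s n).
  by have [h1 h2] := hs n; split=> // x; apply/Gm/h2.
have smf : sm f by exists s.
have [f' [hf' ff]] := strongly_measurable_rep smf.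
pose phi (K : R) (x : X) := (K / (K + `|x|)) *: x.
have phic K (x : X) (u : nat -> X) : 0 < K ->
    u n @[n --> \oo] --> x -> phi K (u n) @[n --> \oo] --> phi K x.
  move=> K0 ux; apply: cvgZ => //; apply: cvgM; first exact: cvg_cst.
  apply: cvgV; first by rewrite gt_eqF// ltr_wpDr.
  by apply: cvgD; [exact: cvg_cst|exact: cvg_norm].
have phiK K (x : X) : 0 < K -> `|phi K x| <= K.
  move=> K0; have hp : 0 < K + `|x| by rewrite ltr_wpDr.
  rewrite normrZ ger0_norm; last by rewrite divr_ge0// ltW.
  rewrite mulrAC ler_pdivrMr// ler_wpM2l ?(ltW K0)//.
  by rewrite lerDr ltW.
have phix K (x : X) : 0 < K -> x - phi K x = (`|x| / (K + `|x|)) *: x.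
  move=> K0; have hp : K + `|x| != 0 by rewrite gt_eqF// ltr_wpDr.
  rewrite -{1}(scale1r x) -scalerBl; congr (_ *: _).
  by field.
have smphi K : 0 < K -> pointwise_measurable (fun t => phi K (f' t)).
  move=> K0; have [r [hr rf]] := hf'.
  exists (fun n t => phi K (r n t)); split => [n|t]; last exact/phic/rf.
  exact: (simple_binary (fun x _ : X => phi K x) (hr n) (hr n)).
have smfphi K : 0 < K -> pointwise_measurable (fun t => f' t - phi K (f' t)).
  move=> K0; have := pointwise_measurableD hf' (pointwise_measurableM (fun=> -1) (labelling_cst sA tt) (smphi K K0)).
  by congr pointwise_measurable; apply/funext => t; rewrite scaleN1r.
have e20 : 0 < e / 2 by rewrite divr_gt0.
(* The error is at most |f'| and tends to 0 pointwise. *)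
have [N hN] : exists n, (L2norm P (fun t => (f' t - phi n.+1%:R (f' t))%R) <= (e / 2)%:E)%E.
  have H : L2norm P (fun t => (f' t - phi n.+1%:R (f' t))%R) @[n --> \oo] --> 0%E.
    apply: (@dominated_L2 _ (fun t => `|f' t|)).
    - by move=> n; exact: smfphi.
    - apply: nearW => t; apply/norm_cvg0P.
      have hx : `|f' t| ^+ 2 * (@harmonic R n) @[n --> \oo] --> 0.
        by rewrite -[X in _ --> X](mulr0 (`|f' t| ^+ 2)); apply: cvgMl_tmp; exact: cvg_harmonic.
      apply: (squeeze_cvgr _ (cvg_cst 0) hx); apply: nearW => n.
      rewrite normr_ge0 phix// normrZ ger0_norm ?divr_ge0 ?addr_ge0//.
      rewrite mulrAC -expr2 ler_wpM2l ?exprn_ge0// lef_pV2 ?posrE ?ltr_wpDr//.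
      by rewrite lerDl.
    - exact: measurable_norm_pointwise.
    - rewrite -[X in (X < _)%E]/(sq_integral P f').
      by apply: sq_integral_lty; rewrite -(L2norm_ae ff).
    - move=> n t; rewrite phix// normrZ ger0_norm ?divr_ge0 ?addr_ge0//.
      rewrite ler_piMl// ler_pdivrMr ?ltr_wpDr// mul1r lerDr//.
  have /cvge_to0P := H; move=> /(_ (fun=> L2norm_ge0 _ _) _ e20) [N _ hN].
  by exists N; apply: hN => /=.
set K : R := N.+1%:R in hN.
have K0 : 0 < K by [].
(* Here K is fixed, and the constant K + K dominates. *)
have [n hn] : exists n, (L2norm P (fun t => (phi K (f' t) - phi K (s n t))%R) <= (e / 2)%:E)%E.
  have sms n : pointwise_measurable (fun t => phi K (s n t)).
    exact/pointwise_simple/(simple_binary (fun x _ : X => phi K x) (hs' n) (hs' n)).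
  have H : L2norm P (fun t => (phi K (f' t) - phi K (s n t))%R) @[n --> \oo] --> 0%E.
    apply: (@dominated_L2 _ (cst (K + K))).
    - move=> n; have := pointwise_measurableD (smphi K K0) (pointwise_measurableM (fun=> -1) (labelling_cst sA tt) (sms n)).
      by congr pointwise_measurable; apply/funext => t; rewrite scaleN1r.
    - apply: filterS2 sf ff => t st ft; rewrite -(subrr (phi K (f' t))).
      apply: cvgB; first exact: cvg_cst.
      by apply: phic => //; rewrite -ft.
    - exact: measurable_cst.
    - rewrite (integral_cst P measurableT ((K + K) ^+ 2)%:E).
      by rewrite -[X in (_ * X)%E]/(P setT) probability_setT mule1 ltry.
    - by move=> n t /=; rewrite (le_trans (ler_normB _ _))// lerD// phiK.
  have /cvge_to0P := H; move=> /(_ (fun=> L2norm_ge0 _ _) _ e20) [n _ hn].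
  by exists n; apply: hn => /=.
exists (fun t => phi K (s n t)); split.
  have [m [k [v [hk ->]]]] := simple_label (hs n).
  exact: (@label_simple _ _ _ sG _ _ _ _ (fun l => phi K (v l)) hk).
rewrite (@L2norm_ae _ _ _ _ _ _
  (fun t => (f' t - phi K (f' t)) + (phi K (f' t) - phi K (s n t)))); last first.
  by apply: filterS ff => t ->; rewrite addrA subrK.
rewrite (le_trans (L2normD _ _))//.
- exact/pointwise_strongly_measurable/smfphi.
- apply: strongly_measurableB; first exact/pointwise_strongly_measurable/smphi.
  exact/strongly_measurable_simple/(simple_binary (fun x _ : X => phi K x) (hs' n) (hs' n)).
- by rewrite (splitr e) EFinD leeD.
Qed.
End density.

(** * The Bochner integral *)

Section bochner.
Context d (T : measurableType d) (R : realType) (P : probability T R).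
Context (X : completeNormedModType R).
Implicit Types (f g s : T -> X).

Local Notation mlab := (labelling (@measurable d T)).
Local Notation simp := (simple (@measurable d T)).
Local Notation sm := (strongly_measurable P).
Let sA := @sigma_algebra_measurable d T.

(** Label two simple functions jointly. *)
Lemma simple_integral_lin s1 s2 (a : R) : simp s1 -> simp s2 ->
  simple_integral P (fun t => s1 t + a *: s2 t) =
  simple_integral P s1 + a *: simple_integral P s2.
Proof.
move=> /simple_label[m1 [k1 [v1 [h1 E1]]]] /simple_label[m2 [k2 [v2 [h2 E2]]]].
pose k t := (k1 t, k2 t).
have hk : mlab k := labelling_pair sA h1 h2.
have -> : s1 = (fun l => v1 l.1) \o k by rewrite E1.
have -> : s2 = (fun l => v2 l.2) \o k by rewrite E2.
rewrite (simple_integral_label _ _ hk) (simple_integral_label _ (fun l => v2 l.2) hk).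
rewrite (simple_integral_label _ (fun l => v1 l.1 + a *: v2 l.2) hk).
rewrite scaler_sumr -big_split/=; apply: eq_bigr => l _.
by rewrite scalerDr !scalerA mulrC.
Qed.

Lemma simple_integral_norm s : simp s ->
  ((`|simple_integral P s|)%:E <= \int[P]_t (`|s t|)%:E)%E.
Proof.
move=> /simple_label[m [k [v [hk ->]]]].
rewrite (simple_integral_label _ _ hk).
rewrite (integral_label P (phi := fun l => `|v l|) hk)//.
apply: (@le_trans _ _ (\sum_l `|fine (P (k @^-1` [set l])) *: v l|)%:E).
  by rewrite lee_fin; exact: ler_norm_sum.
rewrite -sumEFin le_eqVlt; apply/orP; left; apply/eqP; apply: eq_bigr => l _.
rewrite normrZ EFinM muleC ger0_norm ?fine_ge0// fineK//.
exact: fin_num_measure.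
Qed.

Lemma integral_norm_ge0 f : (0 <= \int[P]_t (`|f t|)%:E)%E.
Proof. by apply: integral_ge0 => t _; rewrite lee_fin. Qed.

Lemma integral_norm_ae f g : {ae P, forall t, f t = g t} ->
  (\int[P]_t (`|f t|)%:E = \int[P]_t (`|g t|)%:E)%E.
Proof.
move=> fg; apply: ge0_integral_ae.
- by move=> t; rewrite lee_fin.
- by move=> t; rewrite lee_fin.
- by apply: filterS fg => t ->.
Qed.

Lemma integral_normD f g : sm f -> sm g ->
  (\int[P]_t (`|(f t + g t)%R|)%:E <=
   \int[P]_t (`|f t|)%:E + \int[P]_t (`|g t|)%:E)%E.
Proof.
move=> /strongly_measurable_rep[f' [hf ff]] /strongly_measurable_rep[g' [hg gg]].
rewrite (integral_norm_ae ff) (integral_norm_ae gg) (@integral_norm_ae _ (fun t => f' t + g' t)); last first.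
  by apply: filterS2 ff gg => t -> ->.
have mf := measurable_norm_pointwise hf; have mg := measurable_norm_pointwise hg.
rewrite -ge0_integralD//; try by apply/measurable_EFinP.
apply: ge0_le_integral => //.
- by apply/measurable_EFinP; apply: measurable_norm_pointwise; exact: pointwise_measurableD.
- by apply/measurable_EFinP; exact: measurable_funD.
- by move=> t _; rewrite lee_fin ler_normD.
Qed.

Lemma integral_normZ (a : R) f : sm f ->
  (\int[P]_t (`|(a *: f t)%R|)%:E = `|a|%:E * \int[P]_t (`|f t|)%:E)%E.
Proof.
move=> /strongly_measurable_rep[f' [hf ff]].
rewrite (integral_norm_ae ff) (@integral_norm_ae (fun t => a *: f t) (fun t => a *: f' t)); last first.
  by apply: filterS ff => t ->.
rewrite -ge0_integralZl//; first by apply: eq_integral => t _; rewrite normrZ.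
by apply/measurable_EFinP; exact: measurable_norm_pointwise.
Qed.

Lemma is_bochner_lin f g (a : R) (v w : X) :
  is_bochner_integral P f v -> is_bochner_integral P g w ->
  is_bochner_integral P (fun t => f t + a *: g t) (v + a *: w).
Proof.
move=> [hf [s [hs sf sv]]] [hg [r [hr rg rw]]].
split; first by apply: strongly_measurableD => //; exact: strongly_measurableZ.
exists (fun n t => s n t + a *: r n t); split.
- by move=> n; exact: (simple_binary (fun x y => x + a *: y) (hs n) (hr n)).
- apply/cvge_to0P => [n|e e0]; first by apply: integral_ge0 => t _; rewrite lee_fin.
  have e1 : 0 < e / 2 by rewrite divr_gt0.
  have e2 : 0 < e / 2 / (1 + `|a|) by rewrite divr_gt0// ltr_pwDl.
  have /cvge_to0P/(_ _ e1) h1 := sf.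
  have /cvge_to0P/(_ _ e2) h2 := rg.
  have {}h1 := h1 (fun=> integral_norm_ge0 _).
  have {}h2 := h2 (fun=> integral_norm_ge0 _).
  apply: filterS2 h1 h2 => n h1 h2.
  rewrite (@integral_norm_ae _ (fun t => (f t - s n t) + a *: (g t - r n t))); last first.
    by apply: nearW => t; rewrite scalerBr opprD addrACA.
  have sm1 : sm (fun t => f t - s n t) by apply: strongly_measurableB => //; exact: strongly_measurable_simple.
  have sm2 : sm (fun t => g t - r n t) by apply: strongly_measurableB => //; exact: strongly_measurable_simple.
  rewrite (le_trans (integral_normD sm1 (strongly_measurableZ a sm2)))//.
  rewrite (splitr e) EFinD leeD// integral_normZ//.
  rewrite (@le_trans _ _ (`|a|%:E * (e / 2 / (1 + `|a|))%:E)%E)//.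
    by rewrite lee_wpmul2l.
  rewrite -EFinM lee_fin mulrCA ler_piMr ?(ltW e1)//.
  by rewrite ler_pdivrMr ?ltr_pwDl// mul1r lerDr.
- under eq_fun do rewrite simple_integral_lin//.
  by apply: cvgD => //; apply: cvgZl_tmp.
Qed.

(** Pass to the limit in |int s_n| <= int |s_n| <= int |f| + int |f - s_n|. *)
Lemma is_bochner_norm f v : is_bochner_integral P f v ->
  (`|v|%:E <= \int[P]_t (`|f t|)%:E)%E.
Proof.
move=> [hf [s [hs sf sv]]].
have i0 (h : T -> X) : (0 <= \int[P]_t (`|h t|)%:E)%E.
  by apply: integral_ge0 => t _; rewrite lee_fin.
have [E|] := eqVneq (\int[P]_t (`|f t|)%:E)%E +oo%E; first by rewrite E leey.
have := i0 f; move E : (\int[P]_t (`|f t|)%:E)%E => I.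
case: I E => // r E _ _; rewrite lee_fin.
apply/ler_addgt0Pr => e e0.
apply: (cvgr_to_le (cvg_norm sv)).
have /cvge_to0P := sf; move=> /(_ (fun=> i0 _) _ e0); apply: filterS => n hn.
rewrite -lee_fin EFinD -E (le_trans (simple_integral_norm (hs n)))//.
rewrite (@integral_norm_ae _ (fun t => f t + -1 *: (f t - s n t))); last first.
  by apply: nearW => t; rewrite scaleN1r opprB addrC subrK.
have sm1 : sm (fun t => f t - s n t) by apply: strongly_measurableB => //; exact: strongly_measurable_simple.
rewrite (le_trans (integral_normD hf (strongly_measurableZ _ sm1)))// leeD2l//.
by rewrite integral_normZ// normrN1 mul1e.
Qed.

(** The difference of two values is a Bochner integral of the zero
    function. *)
Lemma is_bochner_unique f v w :
  is_bochner_integral P f v -> is_bochner_integral P f w -> v = w.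
Proof.
move=> hv hw; have /is_bochner_norm := is_bochner_lin (-1) hv hw.
rewrite (@integral_norm_ae _ (cst 0)); last first.
  by apply: nearW => t; rewrite scaleN1r subrr.
under eq_integral do rewrite normr0.
rewrite integral0 lee_fin normr_le0 scaleN1r subr_eq0.
by move=> /eqP.
Qed.

Lemma bochner_integral_eq f v : is_bochner_integral P f v -> bochner_integral P f = v.
Proof.
move=> hv; apply: (is_bochner_unique _ hv).
by rewrite /bochner_integral; case: xgetP => [w -> //|/(_ v)].
Qed.

Lemma is_bochner_simple s : simp s -> is_bochner_integral P s (simple_integral P s).
Proof.
move=> hs; split; first exact: strongly_measurable_simple.
exists (fun=> s); split=> //; last exact: cvg_cst.
rewrite (_ : (fun n => _) = cst 0%E); first exact: cvg_cst.
apply/funext => n /=; rewrite (@integral_norm_ae _ (cst 0)); last first.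
  by apply: nearW => t; rewrite subrr.
by under eq_integral do rewrite normr0; rewrite integral0.
Qed.

(** Choose simple functions at L2 distance 1 / (n + 1); their integrals form a
    Cauchy sequence because the L1 norm is at most the L2 norm. *)
Lemma L2_bochner_integrable f : L2 P f -> bochner_integrable P f.
Proof.
move=> [hf f2].
have /(_ _) H : forall n : nat, exists s, simp s /\
    (L2norm P (fun t => (f t - s t)%R) <= (n.+1%:R^-1)%:E)%E.
  by move=> n; apply: L2_simple_dense.
have [s Hs] := choice H.
have hs n : simp (s n) by have [] := Hs n.
have sm1 n : sm (fun t => f t - s n t) by apply: strongly_measurableB => //; exact: strongly_measurable_simple.
have sL n : (\int[P]_t (`|(f t - s n t)%R|)%:E <= (n.+1%:R^-1)%:E)%E.
  by have [_] := Hs n; apply: le_trans; exact: integral_norm_le_L2norm.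
have ev (e : R) : 0 < e -> \forall n \near \oo, n.+1%:R^-1 <= e.
  move=> e0; have /cvgrPdist_le/(_ _ e0) := @cvg_harmonic R.
  by apply: filterS => n /=; rewrite sub0r normrN ger0_norm.
have cS : cvg (simple_integral P (s n) @[n --> \oo]).
  apply/cauchy_cvgP/cauchy_ballP => e e0.
  have e1 : 0 < e / 2 / 2 by rewrite !divr_gt0.
  have [N _ hN] := ev _ e1.
  exists ([set simple_integral P (s n) | n in [set n | (N <= n)%N]],
          [set simple_integral P (s n) | n in [set n | (N <= n)%N]]) => /=.
    by split; exists N => // n Nn; exists n.
  move=> [_ _] [/= [n Nn <-] [m Nm <-]].
  rewrite -ball_normE/= -scaleN1r -simple_integral_lin//.
  rewrite -lte_fin.
  have hsl := simple_binary (fun x y : X => x + -1 *: y) (hs n) (hs m).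
  apply: (le_lt_trans (simple_integral_norm hsl)).
  rewrite (@integral_norm_ae _ (fun t => (f t - s m t) + -1 *: (f t - s n t))); last first.
    by apply: nearW => t; rewrite !scaleN1r opprB [RHS]addrC addrA subrK.
  apply: (le_lt_trans (integral_normD (sm1 m) (strongly_measurableZ _ (sm1 n)))).
  rewrite integral_normZ// normrN1 mul1e.
  apply: (@le_lt_trans _ _ ((e / 2 / 2) + (e / 2 / 2))%:E).
    rewrite EFinD leeD// (le_trans (sL _))// lee_fin; exact: hN.
  by rewrite -splitr lte_fin ltr_pdivrMr// ltr_pMr// ltr1n.
exists (lim (simple_integral P (s n) @[n --> \oo])); split=> //; exists s; split=> //.
apply/cvge_to0P => [n|e e0]; first by apply: integral_ge0 => t _; rewrite lee_fin.
apply: filterS (ev e e0) => n hn; rewrite (le_trans (sL n))// lee_fin.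
Qed.

Lemma bochner_integralP f : L2 P f -> is_bochner_integral P f (bochner_integral P f).
Proof.
by move=> /L2_bochner_integrable[v hv]; rewrite (bochner_integral_eq hv).
Qed.

End bochner.

(** * Conditional means with respect to a finite partition *)

Section condexp.
Context d (T : measurableType d) (R : realType) (P : probability T R).
Context (X : completeNormedModType R).
Implicit Types (f g s : T -> X).

Local Notation mlab := (labelling (@measurable d T)).
Local Notation simp := (simple (@measurable d T)).
Local Notation sm := (strongly_measurable P).
Local Notation bI := (@bochner_integral d T R P X).
Let sA := @sigma_algebra_measurable d T.

Lemma bochner_integral_lin f g (a : R) : L2 P f -> L2 P g ->
  bI (fun t => f t + a *: g t) = bI f + a *: bI g.
Proof.
move=> /bochner_integralP hf /bochner_integralP hg.
exact/bochner_integral_eq/is_bochner_lin.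
Qed.

Lemma bochner_integral_simple s : simp s -> bI s = simple_integral P s.
Proof. by move=> hs; apply/bochner_integral_eq/is_bochner_simple. Qed.

Lemma L2_0 : L2 P (fun=> 0 : X).
Proof.
apply: L2_simple.
exact: (@label_simple _ _ _ sA _ _ _ _ (fun=> 0) (labelling_cst sA tt)).
Qed.

Lemma bochner_integral0 : bI (fun=> 0) = 0.
Proof.
rewrite bochner_integral_simple; last exact: (@label_simple _ _ _ sA _ _ _ _ (fun=> 0) (labelling_cst sA tt)).
rewrite (simple_integral_label _ (fun=> 0) (labelling_cst sA tt)).
by rewrite big1// => i _; rewrite scaler0.
Qed.

Lemma bochner_integralD f g : L2 P f -> L2 P g -> bI (fun t => f t + g t) = bI f + bI g.
Proof.
move=> hf hg; rewrite -[bI g]scale1r -bochner_integral_lin//.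
by congr bI; apply/funext => t; rewrite scale1r.
Qed.

Lemma bochner_integralB f g : L2 P f -> L2 P g -> bI (fun t => f t - g t) = bI f - bI g.
Proof.
move=> hf hg; rewrite -[bI g]scale1r -scaleNr -bochner_integral_lin//.
by congr bI; apply/funext => t; rewrite scaleN1r.
Qed.

Lemma bochner_integralZ (a : R) f : L2 P f -> bI (fun t => a *: f t) = a *: bI f.
Proof.
move=> hf; rewrite -[RHS]add0r -bochner_integral0 -bochner_integral_lin//; last exact: L2_0.
by congr bI; apply/funext => t; rewrite add0r.
Qed.

Lemma L2_sum (I : Type) (r : seq I) (Q : pred I) (F : I -> T -> X) :
  (forall i, L2 P (F i)) -> L2 P (fun t => \sum_(i <- r | Q i) F i t).
Proof.
move=> hF; elim: r => [|i r ih].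
  by under eq_fun do rewrite big_nil; exact: L2_0.
under eq_fun do rewrite big_cons.
by case: (Q i) => //; exact: L2D.
Qed.

Lemma bochner_integral_sum (I : Type) (r : seq I) (Q : pred I) (F : I -> T -> X) :
  (forall i, L2 P (F i)) ->
  bI (fun t => \sum_(i <- r | Q i) F i t) = \sum_(i <- r | Q i) bI (F i).
Proof.
move=> hF; elim: r => [|i r ih].
  by under eq_fun do rewrite big_nil; rewrite big_nil bochner_integral0.
under eq_fun do rewrite big_cons; rewrite big_cons.
case: (Q i) => //; rewrite bochner_integralD ?ih//; exact: L2_sum.
Qed.

Lemma norm_bochner_integral_le f : L2 P f -> ((`|bI f|)%:E <= L2norm P f)%E.
Proof.
move=> hf; have [sf _] := hf.
exact: (le_trans (is_bochner_norm (bochner_integralP hf)) (integral_norm_le_L2norm sf)).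
Qed.

(** The Cauchy-Schwarz inequality against the indicator of A. *)
Lemma bochner_integral_cauchy_schwarz (A : set T) g : measurable A -> L2 P g ->
  (forall t, ~ A t -> g t = 0) ->
  ((`|bI g| ^+ 2)%:E <= P A * sq_integral P g)%E.
Proof.
move=> mA hg gA; have [smg _] := hg.
have [g' [hg' gg]] := strongly_measurable_rep smg.
have mg := measurable_norm_pointwise hg'.
have e1 : 2^-1 + 2^-1 = 1 :> R by lra.
have mA1 : measurable_fun setT (\1_A : T -> R) by exact: measurable_indic.
have := @hoelder _ _ _ P \1_A (fun t => `|g' t|) 2 2 mA1 mg
  (ltr0n _ _) (ltr0n _ _) e1.
have -> : Lnorm P 2%:E (EFin \o \1_A) = sqrte (P A).
  rewrite unlock/= -poweR12_sqrt//; congr poweR.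
  rewrite -[in RHS](setIT A) -integral_indic//; apply: eq_integral => t _.
  by rewrite /= indicE; case: (t \in A); rewrite ?normr1 ?powR1 ?normr0 ?powR0.
rewrite -[X in (_ <= _ * X)%E -> _]/(L2norm P g') -(L2norm_ae gg) Lnorm1 L2normE.
rewrite -sqrteM// => h.
rewrite -lee_sqrt; last by rewrite mule_ge0 ?sq_integral_ge0.
rewrite [X in (X <= _)%E]/= sqrtr_sqr ger0_norm//; apply: le_trans h.
apply: (le_trans (is_bochner_norm (bochner_integralP hg))).
rewrite le_eqVlt; apply/orP; left; apply/eqP; apply: ge0_integral_ae.
- by move=> t; rewrite lee_fin.
- by move=> t; exact: abse_ge0.
apply: filterS gg => t gt; rewrite /= indicE normrM normr_id -gt.
have [_|/negP] := boolP (t \in A); first by rewrite normr1 mul1r.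
by move=> h'; rewrite gA ?normr0 ?mulr0// => At; apply: h'; exact/mem_set.
Qed.

(** The conditional expectation of f given k: the mean of f over the fibre of
    k through t. On fibres of measure 0 it is 0. *)
Definition cond_mean (L : finType) (k : T -> L) f (t : T) : X :=
  (fine (P (k @^-1` [set k t])))^-1 *: bI (fun u => (k u == k t)%:R *: f u).

Lemma sum_sq_integral_label (L : finType) (k : T -> L) f : mlab k -> sm f ->
  (\sum_l sq_integral P (fun u => ((k u == l)%:R *: f u)%R) = sq_integral P f)%E.
Proof.
move=> hk /strongly_measurable_rep[f' [hf' ff]].
have E (u v : T -> X) : {ae P, forall t, u t = v t} -> sq_integral P u = sq_integral P v.
  by move=> uv; rewrite -!sqr_L2norm (L2norm_ae uv).
rewrite (E _ _ ff).
under eq_bigr => l _.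
  rewrite (E _ (fun u => (k u == l)%:R *: f' u)); last by apply: filterS ff => t ->.
  over.
rewrite /sq_integral -ge0_integral_sum//.
  apply: eq_integral => t _; rewrite (bigD1 (k t))//= eqxx scale1r big1 ?adde0//.
  by move=> l; rewrite eq_sym => /negPf ->; rewrite scale0r normr0 expr0n.
move=> l; apply/measurable_EFinP; apply: measurable_funX; apply: measurable_norm_pointwise.
exact: (pointwise_measurableM (fun l' => (l' == l)%:R)).
Qed.

(** On each fibre of measure p the squared mean times p is at most the
    integral of |f|^2 over the fibre, by Cauchy-Schwarz; sum over the
    fibres. *)
Lemma cond_mean_contract (L : finType) (k : T -> L) f : mlab k -> L2 P f ->
  (L2norm P (cond_mean k f) <= L2norm P f)%E.
Proof.
move=> hk hf; have [smf f2] := hf.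
rewrite !L2normE lee_sqrt ?sq_integral_ge0//.
pose e (l : L) := (fine (P (k @^-1` [set l])))^-1 *: bI (fun u => (k u == l)%:R *: f u).
rewrite /sq_integral (integral_label P (phi := fun l => `|e l| ^+ 2) hk); last first.
  by move=> l; rewrite exprn_ge0.
rewrite -[X in (_ <= X)%E]/(sq_integral P f) -(sum_sq_integral_label hk smf).
apply: lee_sum => l _.
have hl : L2 P (fun u => (k u == l)%:R *: f u) := L2M (fun l' => (l' == l)%:R) hk hf.
have h0 t : ~ (k @^-1` [set l]) t -> (k t == l)%:R *: f t = 0.
  by move=> tl; case: eqP => [/tl//|_]; rewrite scale0r.
have := bochner_integral_cauchy_schwarz (hk l) hl h0.
rewrite /e; set B := bI _; set q := sq_integral _ _.
have : (q < +oo)%E by apply: sq_integral_lty; have [] := hl.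
have : (0 <= q)%E := sq_integral_ge0 _ _.
have : P (k @^-1` [set l]) \is a fin_num := fin_num_measure P _ (hk l).
have : (0 <= P (k @^-1` [set l]))%E by [].
case: (P _) => // p p0 _; case: q => // q q0 _; rewrite !lee_fin in p0 q0 *.
rewrite /= normrZ exprMn => h.
have [->|pn] := eqVneq p 0; first by rewrite mulr0.
have pp : 0 < p by rewrite lt_def pn.
rewrite ger0_norm ?invr_ge0// exprVn -mulrA mulrC ler_pdivrMr ?exprn_gt0//.
by rewrite expr2 mulrA (mulrC q) ler_wpM2r.
Qed.

Lemma cond_meanB (L : finType) (k : T -> L) f g t : mlab k -> L2 P f -> L2 P g ->
  cond_mean k (fun u => f u - g u) t = cond_mean k f t - cond_mean k g t.
Proof.
move=> hk hf hg; rewrite /cond_mean -scalerBr -bochner_integralB.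
- by congr (_ *: bI _); apply/funext => u; rewrite scalerBr.
- exact: (L2M (fun l => (l == k t)%:R) hk hf).
- exact: (L2M (fun l => (l == k t)%:R) hk hg).
Qed.

Lemma bochner_integral_label (L : finType) (k : T -> L) (v : L -> X) : mlab k ->
  bI (v \o k) = \sum_l fine (P (k @^-1` [set l])) *: v l.
Proof.
move=> hk; rewrite bochner_integral_simple; first exact: simple_integral_label.
exact: label_simple.
Qed.

(** Equality can only fail on the fibres of measure 0, finite in number. *)
Lemma cond_mean_label (L : finType) (k : T -> L) (v : L -> X) : mlab k ->
  {ae P, forall t, cond_mean k (v \o k) t = v (k t)}.
Proof.
move=> hk.
have E t : P (k @^-1` [set k t]) != 0%E -> cond_mean k (v \o k) t = v (k t).
  move=> Pt; rewrite /cond_mean (@bochner_integral_label _ k (fun l => (l == k t)%:R *: v l))//.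
  rewrite (bigD1 (k t))//= eqxx scale1r big1 ?addr0; last first.
    by move=> l /negPf ->; rewrite scale0r scaler0.
  rewrite scalerA mulVf ?scale1r// fine_eq0// fin_num_measure//.
apply: (@negligibleS _ _ _ _ (k @^-1` [set l | P (k @^-1` [set l]) = 0%E])).
  by move=> t /= h; apply: contrapT => h0; apply: h; apply: E; exact/eqP.
pose A : {pred L} := [pred l | P (k @^-1` [set l]) == 0%E].
exists (k @^-1` [set l | l \in A]); split.
- exact: labelling_preimage.
- by apply: (etrans (measure_label P A hk)); rewrite big1// => l /eqP.
- by move=> t /= h; rewrite inE; apply/eqP.
Qed.

End condexp.

(** * Binary digits under Lebesgue measure *)

Section translation.
Context (R : realType).

(** Both measures agree on half-open intervals. *)
Lemma lebesgue_measure_translate (c : R) (A : set (measurableTypeR R)) : measurable A ->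
  lebesgue_measure ((fun t => t + c) @^-1` A) = lebesgue_measure A.
Proof.
move=> mA.
have mT : measurable_fun setT (fun t : measurableTypeR R => t + c : measurableTypeR R).
  exact: measurable_funD.
pose mu := pushforward (@lebesgue_measure R) (fun t : measurableTypeR R => t + c : measurableTypeR R).
have H : forall Y : set R, ocitv Y -> lebesgue_measure Y = mu Y.
  move=> _ [[a b] _ <-]; rewrite /mu /pushforward/=.
  rewrite (_ : _ @^-1` _ = `]a - c, b - c]%classic); last first.
    by apply/seteqP; split=> t /=; rewrite !in_itv/= ltrBlDr lerBrDr.
  rewrite [LHS]lebesgue_measure_itv [RHS]lebesgue_measure_itv/= !lte_fin ltrD2r.
  by rewrite -!EFinB opprB addrA subrK.
rewrite [RHS](@lebesgue_measure_unique _ (pushforward (@lebesgue_measure R)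
  (fun t : measurableTypeR R => t + c : measurableTypeR R)) H)//.
Qed.
End translation.

Section rademacher.
Context (R : realType).
Local Notation r := (@rademacher R).
Local Notation P := (@lebesgue01 R).
Local Notation TR := (measurableTypeR R).

Lemma rademacherP j t : (r j t = 1) \/ (r j t = -1).
Proof. by rewrite /rademacher /rademacher1; case: ifP; [left|right]. Qed.

Lemma rademacher_sqr j t : r j t * r j t = 1.
Proof. by case: (rademacherP j t) => ->; rewrite ?mulr1// mulrNN mulr1. Qed.

Lemma one_neqN1 : (1 : R) <> -1.
Proof. by move=> h; lra. Qed.

Lemma rademacher_eq1 j t : (r j t = 1) <-> 2 ^+ j * t - (Num.floor (2 ^+ j * t))%:~R < 2^-1.
Proof.
rewrite /rademacher /rademacher1; case: ifP => // h; split=> // h'.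
by case: one_neqN1.
Qed.

Lemma measurable_rademacher j : measurable [set t : TR | r j t = 1].
Proof.
have -> : [set t : TR | r j t = 1] = (fun t : TR => 2 ^+ j * t) @^-1`
    (\bigcup_(z : int) `[z%:~R, z%:~R + 2^-1[%classic).
  apply/seteqP; split=> t /=.
    move=> /rademacher_eq1 h; exists (Num.floor (2 ^+ j * t)) => //=.
    by rewrite in_itv/= floor_le/= -ltrBlDl.
  move=> [z _ /=]; rewrite in_itv/= => /andP[h1 h2]; apply/rademacher_eq1.
  rewrite (_ : Num.floor _ = z) ?ltrBlDl//; apply: floor_def.
  by rewrite h1 (lt_trans h2)// intrD ltrD2l; lra.
rewrite -[X in measurable X]setTI.
have mm : measurable_fun setT (fun t : TR => 2 ^+ j * t : TR) by exact: measurable_funM.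
by apply: mm => //; apply: countable_bigcupT_measurable => [|z]; [exact: countableP|exact: measurable_itv].
Qed.

(** The signs r_j t for j < i are the first i binary digits of the fractional
    part of t. *)
Definition same_digits (i : nat) (t s : R) := forall j, (j < i)%N -> r j t = r j s.
Definition dyadic (i : nat) (Y : Type) (h : R -> Y) := forall t s, same_digits i t s -> h t = h s.

Lemma same_digitsS i t s : same_digits i.+1 t s <-> same_digits i t s /\ r i t = r i s.
Proof.
split=> [h|[h e] j]; first by split=> [j ji|]; apply: h => //; exact: ltnW.
by rewrite ltnS leq_eqVlt => /predU1P[->//|]; exact: h.
Qed.

Lemma same_digits_le i j t s : (i <= j)%N -> same_digits j t s -> same_digits i t s.
Proof. by move=> ij h l li; apply: h; exact: leq_trans ij. Qed.

Lemma dyadic_le i j (Y : Type) (h : R -> Y) : (i <= j)%N -> dyadic i h -> dyadic j h.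
Proof. by move=> ij H t s /(same_digits_le ij); exact: H. Qed.

Lemma dyadic_rademacher j : dyadic j.+1 (r j).
Proof. by move=> t s; apply. Qed.

(** The next binary digit, read off by the first Rademacher function. *)
Lemma floor_double (x : R) : Num.floor (2 * x) =
  2 * Num.floor x + (if x - (Num.floor x)%:~R < 2^-1 then 0 else 1).
Proof.
have /andP[h1 h2] := floor_itv x; rewrite intrD in h2.
by apply: floor_def; case: ifPn => h; rewrite !(intrD, intrM)/=; lra.
Qed.

Lemma same_digits_floor i t s : Num.floor (2 ^+ i * t) = Num.floor (2 ^+ i * s) -> same_digits i t s.
Proof.
elim: i => [//|i ih]; rewrite !exprS -!mulrA !floor_double => h.
apply/same_digitsS; move: ih h; rewrite /rademacher /rademacher1.
set a := Num.floor (2 ^+ i * t); set b := Num.floor (2 ^+ i * s).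
case: ifP => _; case: ifP => _ ih h.
- by split=> //; apply: ih; lia.
- by lia.
- by lia.
- by split=> //; apply: ih; lia.
Qed.

Lemma floor_same_digits i t s : 0 <= t < 1 -> 0 <= s < 1 -> same_digits i t s ->
  Num.floor (2 ^+ i * t) = Num.floor (2 ^+ i * s).
Proof.
move=> ht hs; elim: i => [_|i ih /same_digitsS[d e]].
  rewrite expr0 !mul1r (@floor_def _ t 0) ?(@floor_def _ s 0)//.
rewrite !exprS -!mulrA !floor_double -(ih d).
congr (_ + _); move: e; rewrite /rademacher /rademacher1 -(ih d).
by case: ifP; case: ifP => // _ _ h; [case: one_neqN1|case: one_neqN1; rewrite h].
Qed.

(** Points of [0, 1) with the same first i digits lie in the same dyadic
    interval of length 2^-i. *)
Lemma same_digits_dist i t s : 0 <= t < 1 -> 0 <= s < 1 -> same_digits i t s -> t < s + 2^-i.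
Proof.
move=> ht hs d; have := floor_same_digits ht hs d.
have /andP[_ h1] := floor_itv (2 ^+ i * t); have /andP[h2 _] := floor_itv (2 ^+ i * s).
move=> e; rewrite e intrD in h1; have h3 := lt_le_trans h1 (lerD h2 (lexx _)).
have p2 : 0 < 2 ^+ i :> R by rewrite exprn_gt0.
by rewrite -(ltr_pM2l p2) mulrDr mulfV// gt_eqF.
Qed.

(** Translation by 2^-(j+1) maps the points of A in [0, 1) whose digit of
    index j is 0 onto those where it is 1: it does not change floor (2^j t),
    hence none of the earlier digits, on which A depends. The point 1, where
    the digits start again, has measure 0. *)
Lemma rademacher_half (j : nat) (A : set TR) : measurable A -> dyadic j A ->
  P (A `&` [set t | r j t = 1]) = P (A `&` [set t | r j t = -1]).
Proof.
move=> mA iA.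
have mm1 : measurable [set t : TR | r j t = -1].
  rewrite (_ : [set t | _] = ~` [set t : TR | r j t = 1]); last first.
    apply/seteqP; split=> t /=; first by move=> ->; exact/nesym/one_neqN1.
    by case: (rademacherP j t).
  by apply: measurableC; exact: measurable_rademacher.
pose I : set TR := `[0, 1[%classic.
have PE (B : set TR) : measurable B -> P B = lebesgue_measure (B `&` I).
  move=> mB; rewrite [LHS]/(lebesgue_measure (B `&` `[0, 1]%classic)).
  have -> : B `&` `[0, 1]%classic = (B `&` I) `|` (B `&` [set 1]).
    apply/seteqP; split=> t /=; rewrite !in_itv/=.
      move=> [Bt /andP[t0]]; rewrite le_eqVlt => /predU1P[t1|t1]; first by right.
      by left; split=> //; rewrite /I/= in_itv/= t0.
    move=> [[Bt]|[Bt t1]]; last by split=> //; rewrite t1 ler01 lexx.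
    by rewrite /I/= in_itv/= => /andP[-> /ltW->].
  apply: measureU0; [|exact: measurableI|].
  - by apply: measurableI => //; exact: measurable_itv.
  - apply/eqP; rewrite eq_le measure_ge0 andbT -(lebesgue_measure_set1 (1 : R)).
    by apply: le_measure; rewrite ?inE//; exact: measurableI.
rewrite !PE; [|exact: measurableI|apply: measurableI => //; exact: measurable_rademacher].
set B := (X in _ = lebesgue_measure X).
have mB : measurable B by apply: measurableI; [exact: measurableI|exact: measurable_itv].
rewrite -(lebesgue_measure_translate (2 ^- j.+1) mB); congr lebesgue_measure.
have p2 : 0 < 2 ^+ j :> R by rewrite exprn_gt0.
have hE (t : R) : 2 ^+ j * (t + 2 ^- j.+1) = 2 ^+ j * t + 2^-1.
  by rewrite mulrDr; congr (_ + _); rewrite exprSr invfM mulrA mulfV ?mul1r ?gt_eqF.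
have h0 : 0 < 2 ^- j.+1 :> R by rewrite invr_gt0 exprn_gt0.
(* The fractional part of 2^j t is below 1/2, so adding 1/2 changes no earlier
   digit. *)
have fl t : r j t = 1 -> Num.floor (2 ^+ j * (t + 2 ^- j.+1)) = Num.floor (2 ^+ j * t).
  move=> /rademacher_eq1 h; apply: floor_def; rewrite hE.
  have /andP[h1 h2] := floor_itv (2 ^+ j * t).
  by rewrite intrD; lra.
have fl' t : r j (t + 2 ^- j.+1) = -1 -> Num.floor (2 ^+ j * (t + 2 ^- j.+1)) = Num.floor (2 ^+ j * t).
  move=> h; have : ~ (r j (t + 2 ^- j.+1) = 1) by rewrite h; exact/nesym/one_neqN1.
  move=> /rademacher_eq1/negP; rewrite hE -leNgt => h'; apply/esym.
  have /andP[h1 h2] := floor_itv (2 ^+ j * t + 2^-1).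
  by apply: floor_def; move: h2; rewrite !intrD; lra.
apply/seteqP; split=> t; rewrite /B /I /= !in_itv/=.
  move=> [[At rt] /andP[t0 t1]]; have f := fl t rt; split; first split.
  - by rewrite (iA _ t)//; apply: same_digits_floor.
  - case: (rademacherP j (t + 2 ^- j.+1)) => // /rademacher_eq1.
    rewrite f hE => h.
    have /andP[h1 _] := floor_itv (2 ^+ j * t); lra.
  - rewrite addr_ge0 ?(ltW h0)//=.
    have : (Num.floor (2 ^+ j * t) < (2 ^ j)%N%:Z)%R.
      rewrite floor_lt_int -[X in _ < X]/((2 ^ j)%N%:R) natrX -[X in _ < X]mulr1.
      by rewrite ltr_pM2l.
    rewrite -lezD1 => h2; have : (Num.floor (2 ^+ j * t) + 1)%:~R <= 2 ^+ j :> R.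
      by rewrite -[X in _ <= X]natrX -[X in _ <= X]/((2 ^ j)%N%:Z%:~R) ler_int.
    move: rt => /rademacher_eq1; rewrite intrD => h3 h4.
    by rewrite -(ltr_pM2l p2) hE mulr1; lra.
move=> [[At rt] /andP[t0 t1]]; have f := fl' t rt.
have d : r j t = 1.
  apply/rademacher_eq1; rewrite -f.
  have /andP[_ h2] := floor_itv (2 ^+ j * (t + 2 ^- j.+1)).
  by move: h2; rewrite hE intrD; lra.
split; first split=> //.
- by rewrite (iA _ (t + 2 ^- j.+1))//; apply: same_digits_floor; rewrite f.
- apply/andP; split; last by rewrite (lt_trans _ t1)// ltrDl.
  have : ~ (r j (t + 2 ^- j.+1) = 1) by rewrite rt; exact/nesym/one_neqN1.
  move=> /rademacher_eq1/negP; rewrite -leNgt hE => h.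
  have : 0 <= Num.floor (2 ^+ j * (t + 2 ^- j.+1)).
    by rewrite floor_ge0 mulr_ge0 // ltW.
  rewrite hE -(ler0z R) => h5.
  by rewrite -(pmulr_rge0 _ p2); lra.
Qed.

End rademacher.

Section digits.
Context (R : realType).
Local Notation r := (@rademacher R).
Local Notation P := (@lebesgue01 R).
Local Notation TR := (measurableTypeR R).
Local Notation mlab := (labelling (@measurable _ TR)).
Let sA := @sigma_algebra_measurable _ TR.

Definition digits (i : nat) (t : TR) : {ffun 'I_i -> bool} := [ffun j : 'I_i => r j t == 1].

Lemma digitsP i t s : digits i t = digits i s <-> same_digits i t s.
Proof.
split=> [/ffunP h j ji|h]; last by apply/ffunP => j; rewrite !ffunE h.
have := h (Ordinal ji); rewrite !ffunE/= => e.
case: (rademacherP j t) => ht; case: (rademacherP j s) => hs; rewrite ht hs//.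
  by move: e; rewrite ht hs eqxx => /esym/eqP.
by move: e; rewrite ht hs eqxx => /eqP.
Qed.

Lemma digits_labelling i : mlab (digits i).
Proof.
move=> l.
have -> : digits i @^-1` [set l] =
    \bigcap_(j in [set: 'I_i]) [set t : TR | (r j t == 1) = l j].
  apply/seteqP; split=> [t /= <- j _/=|t h]; first by rewrite ffunE.
  by apply/ffunP => j; rewrite ffunE; exact: h.
apply: fin_bigcap_measurable => [|j _]; first exact: finite_finset.
have mj := @measurable_rademacher R j.
case: (l j); [rewrite (_ : [set t | _] = [set t : TR | r j t = 1])//|
  rewrite (_ : [set t | _] = ~` [set t : TR | r j t = 1]) ; last first].
- by apply/seteqP; split=> t /= /eqP.
- apply/seteqP; split=> t /=; first by move=> /negbT/eqP.
  by move=> /eqP/negbTE.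
- exact: measurableC.
Qed.

(** A function of the first i digits factors through them; a digit string is
    represented by any point that has it. *)
Lemma dyadic_label i (Y : Type) (h : R -> Y) : dyadic i h -> exists v, h = v \o digits i.
Proof.
move=> ih; exists (fun l => h (xget 0 [set t | digits i t = l])).
apply/funext => t /=; apply: ih; apply/digitsP.
by case: xgetP => [s _ /= ->//|/(_ t)]; case.
Qed.

Lemma dyadic_measurable i (A : set TR) : dyadic i A -> measurable A.
Proof.
move=> /dyadic_label[v ->].
exact: (@labelling_preimage _ _ _ sA _ (digits i) v (@digits_labelling i)).
Qed.

Lemma measurable_same_digits i t : measurable [set s : TR | same_digits i t s].
Proof.
apply: (@dyadic_measurable i) => s1 s2 h; apply/propext.
by split=> h1 j ji; rewrite h1// h.
Qed.

(** Each further digit halves the measure, by [rademacher_half]. *)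
Lemma lebesgue01_same_digits i t : P [set s : TR | same_digits i t s] = (2 ^- i)%:E.
Proof.
elim: i => [|i ih].
  rewrite (_ : [set s | _] = setT); last by apply/seteqP; split.
  by rewrite probability_setT expr0 invr1.
have iA : dyadic i [set s : TR | same_digits i t s].
  by move=> s1 s2 h; apply/propext; split=> h1 j ji; rewrite h1// h.
have mA := measurable_same_digits i t.
have hh := rademacher_half mA iA.
set A := [set s : TR | same_digits i t s] in ih iA mA hh.
have m1 := @measurable_rademacher R i.
have E : [set s | r i s = -1] = ~` [set s : TR | r i s = 1].
  apply/seteqP; split=> s /=; first by move=> ->; exact/nesym/one_neqN1.
  by case: (rademacherP i s).
have m2 : measurable [set s : TR | r i s = -1] by rewrite E; exact: measurableC.
have : P A = (P (A `&` [set s | r i s = 1%R]) + P (A `&` [set s | r i s = (-1)%R]))%E.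
  rewrite -measureU; [|exact: measurableI|exact: measurableI|]; last first.
    by rewrite E setIACA setICr setI0.
  by rewrite -setIUr E setUCr setIT.
rewrite hh ih => e.
have -> : [set s | same_digits i.+1 t s] = A `&` [set s | r i s = r i t].
  by apply/seteqP; split=> s /= => [/same_digitsS[h1 ->]//|[h1 h2]]; apply/same_digitsS.
have {hh} -> : P (A `&` [set s | r i s = r i t]) = P (A `&` [set s | r i s = -1]).
  by case: (rademacherP i t) => ->.
have : P (A `&` [set s | r i s = -1]) \is a fin_num.
  by apply: fin_num_measure; exact: measurableI.
move: e; case: (P _) => // p [e] _; congr (_%:E).
rewrite exprS invfM e; lra.
Qed.

End digits.

(** * Walsh kernels *)

Section kernels.
Context (R : realType).
Local Notation r := (@rademacher R).
Local Notation w := (@walsh R).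

(** The digits n_i of the integer n, as opposed to those of a point. *)
Definition digit (n i : nat) : nat := (n %/ 2 ^ i %% 2)%N.

Lemma digit_eq0 n i : (n < 2 ^ i)%N -> digit n i = 0%N.
Proof. by move=> h; rewrite /digit divn_small// mod0n. Qed.

Lemma walsh_wide n N t : (n < 2 ^ N)%N -> w n t = \prod_(i < N) r i t ^+ digit n i.
Proof.
move=> nN; rewrite /walsh -!(big_mkord xpredT (fun i => r i t ^+ digit n i)).
have wide a b : (n < 2 ^ a)%N -> (a <= b)%N ->
    \prod_(0 <= i < b) r i t ^+ digit n i = \prod_(0 <= i < a) r i t ^+ digit n i.
  move=> na ab; rewrite (big_cat_nat (n := a))//=.
  rewrite [X in _ * X]big_nat_cond [X in _ * X]big1 ?mulr1//.
  move=> i /andP[/andP[ai _] _]; rewrite digit_eq0 ?expr0// (leq_trans na)//.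
  by rewrite leq_exp2l.
have nn : (n < 2 ^ n)%N by rewrite ltn_expl.
by case/orP: (leq_total n N) => h; [rewrite -(wide n N)|rewrite (wide N n)].
Qed.

Lemma walsh_dyadic n N : (n < 2 ^ N)%N -> dyadic N (w n).
Proof.
move=> nN t s h; rewrite !(walsh_wide _ nN); apply: eq_bigr => i _.
by rewrite h.
Qed.

Lemma walsh_sqr n t : w n t * w n t = 1.
Proof.
rewrite /walsh -big_split/= big1// => i _.
by rewrite -exprMn rademacher_sqr expr1n.
Qed.

Lemma walsh_norm n t : `|w n t| = 1.
Proof.
apply/eqP; rewrite -(@eqrXn2 _ 2)// expr1n -normrX expr2 walsh_sqr normr1 eqxx//.
Qed.

Lemma walsh_top n N t : (n < 2 ^ N)%N -> w (2 ^ N + n) t = r N t * w n t.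
Proof.
move=> nN; rewrite (@walsh_wide _ N.+1); last by rewrite expnS mul2n -addnn ltn_add2l.
rewrite (walsh_wide _ nN) big_ord_recr/= mulrC; congr (_ * _).
  by rewrite /digit divnDl// divnn expn_gt0/= divn_small// addn0 expr1.
apply: eq_bigr => i _; congr (_ ^+ _); rewrite /digit.
have -> : (2 ^ N = 2 ^ (N - i.+1) * 2 * 2 ^ i)%N.
  by rewrite -expnSr -expnD; congr (_ ^ _)%N; have := ltn_ord i; lia.
by rewrite divnMDl ?expn_gt0// modnMDl.
Qed.

Definition dirichlet_kernel (n : nat) (t s : R) := \sum_(k < n) w k t * w k s.
(** The kernel of the conditional expectation on the first i digits, see
    [cond_kernel_same_digits]. *)
Definition cond_kernel (i : nat) (t s : R) := \prod_(j < i) (1 + r j t * r j s).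

Lemma dirichlet_kernel_split N n t s : (n <= 2 ^ N)%N ->
  dirichlet_kernel (2 ^ N + n) t s = dirichlet_kernel (2 ^ N) t s + r N t * r N s * dirichlet_kernel n t s.
Proof.
move=> nN; rewrite /dirichlet_kernel big_split_ord/= mulr_sumr; congr (_ + _).
apply: eq_bigr => k _; have kN : (k < 2 ^ N)%N by rewrite (leq_trans _ nN).
by rewrite !walsh_top//; ring.
Qed.

(** Expanding the product over j < i gives the sum over all subsets of {0,
    ..., i - 1}, that is, over all Walsh functions of index below 2^i. *)
Lemma dirichlet_kernel_pow N t s : dirichlet_kernel (2 ^ N) t s = cond_kernel N t s.
Proof.
elim: N => [|N ih].
  by rewrite /dirichlet_kernel /cond_kernel big_ord0 expn0 big_ord1 /walsh !big_ord0 mulr1.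
rewrite expnS mul2n -addnn dirichlet_kernel_split// ih /cond_kernel big_ord_recr/=.
by ring.
Qed.

Lemma cond_kernel_same_digits i t s : cond_kernel i t s = (2 ^ i)%:R * (`[< same_digits i t s >])%:R.
Proof.
elim: i => [|i ih]; first by rewrite /cond_kernel big_ord0 mul1r asboolT.
rewrite /cond_kernel big_ord_recr/= -/(cond_kernel i t s) ih.
have [d|d] := pselect (same_digits i t s); last first.
  rewrite !asboolF ?mulr0 ?mul0r//.
  by move=> /same_digitsS[].
rewrite (asboolT d) mulr1.
have [e|e] := eqVneq (r i t) (r i s).
  rewrite asboolT ?same_digitsS// e rademacher_sqr expnS mulr1 natrM mulrC; congr (_ * _).
rewrite asboolF; last by move=> /same_digitsS[_ h]; rewrite h eqxx in e.
rewrite mulr0 (_ : 1 + _ = 0) ?mulr0//.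
move: e; case: (rademacherP i t) => ->; case: (rademacherP i s) => ->;
  rewrite ?eqxx// => _; rewrite ?mulr1 ?mul1r subrr//.
Qed.

(** The kernel vanishes unless t and s have the same first N digits, and then
    w_n t = w_n s. *)
Lemma cond_kernel_walsh n N t s : (n < 2 ^ N)%N -> w n t * w n s * cond_kernel N t s = cond_kernel N t s.
Proof.
move=> nN; rewrite cond_kernel_same_digits; have [d|d] := pselect (same_digits N t s).
  by rewrite (walsh_dyadic nN d) walsh_sqr mul1r.
by rewrite asboolF ?mulr0.
Qed.

(** Induction on the top digit. For n = 2^N + m with m < 2^N one has D_n = K_N
    + r_N(t) r_N(s) D_m and w_n = r_N w_m; multiplying the formula for m by
    r_N(t) r_N(s) gives all terms with i < N, and the term i = N equals K_N by
    [cond_kernel_walsh]. *)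
Lemma dirichlet_kernel_transform n N t s : (n < 2 ^ N)%N ->
  dirichlet_kernel n t s = w n t * w n s * \sum_(i < N) (digit n i)%:R * (cond_kernel i.+1 t s - cond_kernel i t s).
Proof.
elim: N n => [|N ih] n nN.
  by rewrite (_ : n = 0%N) /dirichlet_kernel ?big_ord0 ?mulr0//; case: n nN.
rewrite big_ord_recr/=.
have [h|h] := ltnP n (2 ^ N)%N.
  by rewrite (digit_eq0 h) mul0r addr0; exact: ih.
have [m mN En] : exists2 m, (m < 2 ^ N)%N & n = (2 ^ N + m)%N.
  exists (n - 2 ^ N)%N; last by rewrite subnKC.
  by move: nN; rewrite expnS; lia.
rewrite {}En in nN *.
have -> : digit (2 ^ N + m) N = 1%N.
  by rewrite /digit divnDl// divnn expn_gt0/= divn_small// addn0.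
have -> : \sum_(i < N) (digit (2 ^ N + m) i)%:R * (cond_kernel i.+1 t s - cond_kernel i t s) =
    \sum_(i < N) (digit m i)%:R * (cond_kernel i.+1 t s - cond_kernel i t s).
  apply: eq_bigr => i _; congr (_%:R * _); rewrite /digit.
  have -> : (2 ^ N = 2 ^ (N - i.+1) * 2 * 2 ^ i)%N.
    by rewrite -expnSr -expnD; congr (_ ^ _)%N; have := ltn_ord i; lia.
  by rewrite divnMDl ?expn_gt0// modnMDl.
rewrite dirichlet_kernel_split 1?ltnW// (ih m mN) dirichlet_kernel_pow !walsh_top//.
have -> : cond_kernel N.+1 t s = cond_kernel N t s * (1 + r N t * r N s) by rewrite /cond_kernel big_ord_recr.
have cw := cond_kernel_walsh t s mN.
set S := \sum_(_ < _) _.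
have e1 := rademacher_sqr N t; have e2 := rademacher_sqr N s.
transitivity (w m t * w m s * cond_kernel N t s * (r N t * r N t) *
  (r N s * r N s) + r N t * r N s * (w m t * w m s * S)).
  by rewrite e1 e2 !mulr1 cw.
ring.
Qed.

End kernels.

(** * Walsh partial sums and dyadic conditional expectations *)

Section operators.
Context (R : realType) (X : completeNormedModType R).
Local Notation r := (@rademacher R).
Local Notation w := (@walsh R).
Local Notation P := (@lebesgue01 R).
Local Notation TR := (measurableTypeR R).
Local Notation simp := (simple (@measurable _ TR)).
Local Notation L2 := (@L2 _ TR R P X).
Local Notation bI := (@bochner_integral _ TR R P X).
Let sA := @sigma_algebra_measurable _ TR.
Implicit Types (f g h : R -> X) (t s : R).

Lemma dyadic_simple i h : dyadic i h -> simp h.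
Proof.
move=> /dyadic_label[v ->].
exact: (@label_simple _ _ _ sA _ _ _ _ v (@digits_labelling R i)).
Qed.

Lemma dyadic_L2 i h : dyadic i h -> L2 h.
Proof. by move=> /dyadic_simple; exact: L2_simple. Qed.

Lemma dyadicM_L2 i (phi : R -> R) f : dyadic i phi -> L2 f -> L2 (fun t => phi t *: f t).
Proof.
move=> /dyadic_label[v ->] hf; exact: (L2M v (@digits_labelling R i) hf).
Qed.

Lemma dyadic_scale i (phi : R -> R) h : dyadic i phi -> dyadic i h -> dyadic i (fun t => phi t *: h t).
Proof. by move=> hp hh t s d; rewrite (hp _ _ d) (hh _ _ d). Qed.

Lemma dyadic_cond_kernel i t : dyadic i (cond_kernel i t).
Proof.
move=> s1 s2 d; rewrite /cond_kernel; apply: eq_bigr => j _; by rewrite (d j).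
Qed.

(** By [rademacher_half] the values of h are taken with the same weight where
    r_j = 1 and where r_j = -1. *)
Lemma rademacher_mean j h : dyadic j h -> bI (fun t => r j t *: h t) = 0.
Proof.
move=> ih; have [v hv] := dyadic_label ih.
pose c (t : TR) : bool := (r j t == 1).
have cE : c @^-1` [set true] = [set t : TR | r j t = 1].
  by apply/seteqP; split=> t /= /eqP.
have cE' : c @^-1` [set false] = [set t : TR | r j t = -1].
  apply/seteqP; split=> t /=; last first.
    by move=> h1; apply/negbTE/eqP => h2; apply: (@one_neqN1 R); rewrite -h1 h2.
  by case: (rademacherP j t) => // h1; rewrite /c h1 eqxx.
have hc : labelling measurable c.
  case; first by rewrite cE; exact: measurable_rademacher.
  rewrite cE' (_ : [set t | _] = ~` [set t : TR | r j t = 1]).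
    by apply: measurableC; exact: measurable_rademacher.
  by rewrite -cE' -cE; apply/seteqP; split=> t /=; case: (c t).
pose k t := (c t, digits j t).
have hk : labelling measurable k := labelling_pair sA hc (@digits_labelling R j).
pose phi (b : bool) : R := if b then 1 else -1.
have -> : (fun t => r j t *: h t) = (fun l => phi l.1 *: v l.2) \o k.
  apply/funext => t; rewrite /= hv/=; congr (_ *: _); rewrite /phi /c.
  by case: (rademacherP j t) => ->; rewrite ?eqxx//; case: eqP => // /esym/one_neqN1.
rewrite (bochner_integral_label P (fun l => phi l.1 *: v l.2) hk).
transitivity (\sum_b \sum_l fine (P (k @^-1` [set (b, l)])) *: (phi b *: v l)).
  by rewrite pair_big; apply: eq_big => -[].
rewrite big_bool/= -big_split/= big1// => l _.
rewrite scale1r scaleN1r scalerN -scalerBl.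
have kE b : k @^-1` [set (b, l)] = (digits j @^-1` [set l]) `&` (c @^-1` [set b]).
  by apply/seteqP; split=> t /=; [case=> <- <-|case=> <- <-].
rewrite !kE cE cE' rademacher_half ?subrr ?scale0r//.
  exact: digits_labelling.
move=> t s /digitsP d; apply/propext => /=; rewrite d//.
Qed.

(** The operator E_i of conditional expectation on the first i digits. *)
Definition dyadic_mean (i : nat) f (t : R) : X := bI (fun s => cond_kernel i t s *: f s).

Lemma cond_kernel_diff i t s : cond_kernel i.+1 t s - cond_kernel i t s = r i t * (r i s * cond_kernel i t s).
Proof. by rewrite {1}/cond_kernel big_ord_recr/= -/(cond_kernel i t s); ring. Qed.

Lemma cond_kernel_L2 i t f : L2 f -> L2 (fun s => cond_kernel i t s *: f s).
Proof. exact: (dyadicM_L2 (@dyadic_cond_kernel i t)). Qed.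

(** This puts the martingale E_i f into Paley-Walsh form, since the integral
    on the right depends on t only through its first i digits. *)
Lemma dyadic_mean_diff i f t : L2 f -> dyadic_mean i.+1 f t - dyadic_mean i f t =
  r i t *: bI (fun s => (r i s * cond_kernel i t s) *: f s).
Proof.
move=> hf; rewrite /dyadic_mean -bochner_integralB; try exact: cond_kernel_L2.
rewrite -bochner_integralZ; last first.
  apply: (@dyadicM_L2 i.+1) => // s1 s2 /same_digitsS[d e].
  by rewrite e (dyadic_cond_kernel t d).
by congr bI; apply/funext => s; rewrite -scalerBl cond_kernel_diff scalerA.
Qed.

Lemma dyadic_dyadic_mean i f : dyadic i (dyadic_mean i f).
Proof.
move=> t s d; rewrite /dyadic_mean; congr bI; apply/funext => u; congr (_ *: _).
by rewrite /cond_kernel; apply: eq_bigr => j _; rewrite (d j).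
Qed.

(** By induction on i, as the increments of the kernel have mean 0 in s. *)
Lemma cond_kernel_cst i t (x : X) : bI (fun s => cond_kernel i t s *: x) = x.
Proof.
have hx : L2 (fun=> x) by apply: (@dyadic_L2 0).
elim: i => [|i ih].
  rewrite (_ : (fun _ => _) = (fun=> x) \o (fun=> tt)); last first.
    by apply/funext => s; rewrite /cond_kernel big_ord0 scale1r.
  rewrite (bochner_integral_label P (fun=> x) (labelling_cst sA tt)) (bigD1 tt)//= big1 ?addr0; last by case.
  by rewrite (_ : _ @^-1` _ = setT) ?probability_setT ?scale1r//; apply/seteqP; split.
have := dyadic_mean_diff i t hx; rewrite /dyadic_mean ih => /eqP; rewrite subr_eq => /eqP ->.
under eq_fun do rewrite -scalerA.
rewrite rademacher_mean ?scaler0 ?add0r//.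
by apply: dyadic_scale => //; exact: dyadic_cond_kernel.
Qed.

(** The kernel only sees points s with the digits of t, where h s = h t. *)
Lemma dyadic_mean_id i h : dyadic i h -> dyadic_mean i h = h.
Proof.
move=> ih; apply/funext => t; rewrite -[RHS](cond_kernel_cst i t); congr bI.
apply/funext => s; rewrite cond_kernel_same_digits; have [d|d] := pselect (same_digits i t s).
  by rewrite (ih _ _ d).
by rewrite asboolF// mulr0 !scale0r.
Qed.

(** The kernel times h is a function of the first j digits. *)
Lemma dyadic_mean_rademacher i j h : (i <= j)%N -> dyadic j h -> dyadic_mean i (fun t => r j t *: h t) = fun=> 0.
Proof.
move=> ij ih; apply/funext => t; rewrite /dyadic_mean.
rewrite (_ : (fun _ => _) = (fun s => r j s *: (cond_kernel i t s *: h s))); last first.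
  by apply/funext => s; rewrite !scalerA mulrC.
apply: rademacher_mean; apply: dyadic_scale => //; exact: (dyadic_le ij (@dyadic_cond_kernel i t)).
Qed.

Lemma dyadic_mean_cond_mean i f : L2 f -> dyadic_mean i f = cond_mean P (digits i) f.
Proof.
move=> hf; apply/funext => t; rewrite /cond_mean.
rewrite (_ : digits i @^-1` [set digits i t] = [set s : TR | same_digits i t s]); last first.
  by apply/seteqP; split=> s /=; [move=> /esym/digitsP|move=> /digitsP/esym].
rewrite -[fine _]/(fine (lebesgue01 [set s : TR | same_digits i t s])).
rewrite lebesgue01_same_digits /= invrK -bochner_integralZ; last first.
  exact: (L2M (fun l => (l == digits i t)%:R) (@digits_labelling R i) hf).
congr bI; apply/funext => s; rewrite cond_kernel_same_digits scalerA natrX; congr ((_ * _%:R) *: _).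
by congr nat_of_bool; apply/asboolP/eqP => [/digitsP/esym|/esym/digitsP].
Qed.

Lemma dyadic_mean_contract i f : L2 f -> (L2norm P (dyadic_mean i f) <= L2norm P f)%E.
Proof. by move=> hf; rewrite dyadic_mean_cond_mean//; apply: cond_mean_contract => //; exact: digits_labelling. Qed.

Lemma walsh_dyadicn n : dyadic n (w n).
Proof. by apply: walsh_dyadic; rewrite ltn_expl. Qed.

Lemma walsh_L2 n f : L2 f -> L2 (fun t => w n t *: f t).
Proof. exact: (dyadicM_L2 (@walsh_dyadicn n)). Qed.

Lemma walsh_sumE n f t : L2 f -> walsh_sum n f t = bI (fun s => dirichlet_kernel n t s *: f s).
Proof.
move=> hf; rewrite /walsh_sum /walsh_coef.
under eq_bigr => i _ do rewrite -(bochner_integralZ _ (walsh_L2 i hf)).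
rewrite -bochner_integral_sum; last by move=> i; apply: L2Z; exact: walsh_L2.
congr bI; apply/funext => s; rewrite /dirichlet_kernel scaler_suml.
by apply: eq_bigr => i _; rewrite scalerA.
Qed.

Lemma walsh_sum_pow i f t : L2 f -> walsh_sum (2 ^ i) f t = dyadic_mean i f t.
Proof.
move=> hf; rewrite walsh_sumE// /dyadic_mean; congr bI.
by apply/funext => s; rewrite dirichlet_kernel_pow.
Qed.

(** [dirichlet_kernel_transform] integrated against f. *)
Lemma walsh_sum_transform n N f t : (n < 2 ^ N)%N -> L2 f ->
  walsh_sum n f t = w n t *: \sum_(i < N) (digit n i)%:R *:
    (dyadic_mean i.+1 (fun s => w n s *: f s) t - dyadic_mean i (fun s => w n s *: f s) t).
Proof.
move=> nN hf; rewrite walsh_sumE//.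
have hwf := walsh_L2 n hf.
have hd i : L2 (fun s => (cond_kernel i.+1 t s - cond_kernel i t s) *: (w n s *: f s)).
  apply: (@dyadicM_L2 i.+1) => // s1 s2 d.
  by rewrite (dyadic_cond_kernel t d) (dyadic_cond_kernel t (same_digits_le (leqnSn i) d)).
rewrite (_ : \sum_(i < N) _ = \sum_(i < N) bI (fun s => (digit n i)%:R *:
  ((cond_kernel i.+1 t s - cond_kernel i t s) *: (w n s *: f s)))); last first.
  apply: eq_bigr => i _; rewrite bochner_integralZ//; congr (_ *: _).
  rewrite /dyadic_mean -bochner_integralB; try exact: cond_kernel_L2.
  by congr bI; apply/funext => s; rewrite scalerBl.
rewrite -bochner_integral_sum; last by move=> i; exact: L2Z.
rewrite -bochner_integralZ; last by apply: L2_sum => i; exact: L2Z.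
congr bI; apply/funext => s; rewrite (dirichlet_kernel_transform _ _ nN).
under [in RHS]eq_bigr => i _ do rewrite !scalerA [_ * w n s]mulrC -scalerA.
rewrite -scaler_sumr -scaler_suml !scalerA; congr (_ *: _).
by rewrite -!mulrA; congr (_ * _).
Qed.

Lemma walsh_sumB n f g t : L2 f -> L2 g ->
  walsh_sum n (fun s => f s - g s) t = walsh_sum n f t - walsh_sum n g t.
Proof.
move=> hf hg; rewrite /walsh_sum -sumrB; apply: eq_bigr => i _.
rewrite -scalerBr /walsh_coef -bochner_integralB; try exact: walsh_L2.
by congr (_ *: bI _); apply/funext => s; rewrite scalerBr.
Qed.

Lemma walsh_sumZ n (a : R) f t : L2 f ->
  walsh_sum n (fun s => a *: f s) t = a *: walsh_sum n f t.
Proof.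
move=> hf; rewrite /walsh_sum scaler_sumr; apply: eq_bigr => i _.
rewrite scalerA mulrC -scalerA /walsh_coef -(bochner_integralZ a); last exact: walsh_L2.
by congr (_ *: bI _); apply/funext => s; rewrite !scalerA mulrC.
Qed.

Lemma walsh_sum_dyadic n f : dyadic n (walsh_sum n f).
Proof.
move=> t s d; rewrite /walsh_sum; apply: eq_bigr => i _; congr (_ *: _).
by apply: (walsh_dyadicn); apply: same_digits_le d; exact: ltnW.
Qed.

Lemma walsh_sum_L2 n f : L2 (walsh_sum n f).
Proof. exact: dyadic_L2 (@walsh_sum_dyadic n f). Qed.

(** For k >= 2^i write w_k = r_j w_m with j >= i the top digit of k; the
    coefficient of h is then the mean of r_j times a function of the first j
    digits. So S_n h = S_(2^i) h = E_i h = h. *)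
Lemma walsh_sum_id i h n : dyadic i h -> (2 ^ i <= n)%N -> walsh_sum n h = h.
Proof.
move=> ih hn; apply/funext => t.
rewrite -[RHS](congr1 (fun u => u t) (dyadic_mean_id ih)) -walsh_sum_pow; last exact: dyadic_L2 ih.
rewrite /walsh_sum -!(big_mkord xpredT (fun k => w k t *: walsh_coef h k)).
rewrite (big_cat_nat (n := (2 ^ i)%N))//= [X in _ + X]big_nat_cond [X in _ + X]big1 ?addr0//.
move=> k /andP[/andP[ki _] _].
have k0 : (0 < k)%N by rewrite (leq_trans _ ki)// expn_gt0.
pose j := trunc_log 2 k.
have /andP[jk kj] : (2 ^ j <= k < 2 ^ j.+1)%N by exact: trunc_log_bounds.
have ij : (i <= j)%N.
  by rewrite -ltnS -(@ltn_exp2l 2)// (leq_ltn_trans ki).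
rewrite /walsh_coef (_ : (fun _ => _) = (fun s => r j s *: (w (k - 2 ^ j) s *: h s))).
  rewrite rademacher_mean ?scaler0//; apply: dyadic_scale; last exact: dyadic_le ih.
  by apply: walsh_dyadic; move: kj; rewrite expnS; lia.
apply/funext => s; rewrite scalerA -walsh_top ?subnKC//.
by move: kj; rewrite expnS; lia.
Qed.

(** A crude bound growing with n, sufficient for the continuity of each single
    S_n. *)
Lemma walsh_sum_bound n f : L2 f -> (L2norm P (walsh_sum n f) <= n%:R%:E * L2norm P f)%E.
Proof.
move=> hf; have [smf f2] := hf.
have fr : L2norm P f \is a fin_num by rewrite ge0_fin_numE// L2norm_ge0.
rewrite -(fineK fr) -EFinM; apply: L2norm_bounded.
- by have [] := walsh_sum_L2 n f.
- by rewrite mulr_ge0// fine_ge0// L2norm_ge0.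
move=> t; rewrite (le_trans (ler_norm_sum _ _ _))//.
rewrite -[X in X%:R]card_ord mulr_natl -sumr_const; apply: ler_sum => i _.
rewrite normrZ walsh_norm mul1r -lee_fin fineK//.
rewrite (le_trans (norm_bochner_integral_le (walsh_L2 i hf)))// le_eqVlt; apply/orP; left; apply/eqP.
by apply: L2norm_norm => s; rewrite normrZ walsh_norm mul1r.
Qed.

End operators.

(** * Density of functions of finitely many digits *)

Section dyadic_dense.
Context (R : realType).
Local Notation P := (@lebesgue01 R).
Local Notation TR := (measurableTypeR R).

(** Sets that are approximated in measure by sets defined by finitely many
    digits. They turn out to be all Borel sets, since they form a
    sigma-algebra containing the rays. *)
Definition dyadic_approx (A : set TR) := measurable A /\
  forall e : R, 0 < e -> exists i (D : set TR), dyadic i D /\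
    (P ((A `\` D) `|` (D `\` A)) <= e%:E)%E.

Lemma dyadic_approxC A : dyadic_approx A -> dyadic_approx (~` A).
Proof.
move=> [mA H]; split; first exact: measurableC.
move=> e /H[i [D [iD h]]]; exists i, (~` D); split.
  by move=> t s d; rewrite /setC/= (iD _ _ d).
apply: le_trans h; rewrite le_eqVlt; apply/orP; left; apply/eqP; congr (lebesgue01 _).
by apply/seteqP; split=> t /= [[h1 h2]|[h1 h2]]; (try by right; split=> //; apply: contrapT);
   left; split=> //; apply: contrapT.
Qed.

Lemma lebesgue01_le (A B : set TR) : measurable A -> measurable B -> A `<=` B -> (P A <= P B)%E.
Proof. by move=> mA mB AB; apply: le_measure; rewrite ?inE. Qed.

Lemma dyadic_approxU A B : dyadic_approx A -> dyadic_approx B -> dyadic_approx (A `|` B).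
Proof.
move=> [mA HA] [mB HB]; split; first exact: measurableU.
move=> e e0; have e2 : 0 < e / 2 by rewrite divr_gt0.
have [i [D [iD hD]]] := HA _ e2; have [j [E [jE hE]]] := HB _ e2.
have mD := dyadic_measurable iD; have mE := dyadic_measurable jE.
exists (maxn i j), (D `|` E); split.
  move=> t s d; rewrite /setU/=.
  by rewrite (iD _ _ (same_digits_le (leq_maxl i j) d)) (jE _ _ (same_digits_le (leq_maxr i j) d)).
have m1 : measurable ((A `\` D) `|` (D `\` A)) by apply: measurableU; exact: measurableD.
have m2 : measurable ((B `\` E) `|` (E `\` B)) by apply: measurableU; exact: measurableD.
apply: (@le_trans _ _ (P ((A `\` D) `|` (D `\` A)) + P ((B `\` E) `|` (E `\` B)))%E).
  apply: (le_trans _ (measureU2 _ m1 m2)); apply: lebesgue01_le.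
  - by apply: measurableU; apply: measurableD; exact: measurableU.
  - exact: measurableU.
  - by move=> t /=; tauto.
by rewrite (splitr e) EFinD leeD.
Qed.

(** Approximate a finite union that exhausts the union up to measure e / 2. *)
Lemma dyadic_approx_bigcup (A : nat -> set TR) : (forall k, dyadic_approx (A k)) ->
  dyadic_approx (\bigcup_k A k).
Proof.
move=> hA; have mA k : measurable (A k) by have [] := hA k.
pose F n := \big[setU/set0]_(k < n) A k.
have hF n : dyadic_approx (F n).
  rewrite /F; elim: n => [|n ih].
    rewrite big_ord0; split=> // e e0; exists 0%N, set0; split=> //.
    by rewrite setD0 setU0 measure0 lee_fin ltW.
  by rewrite big_ord_recr/=; exact: dyadic_approxU.
have mF n : measurable (F n) by have [] := hF n.
have mU : measurable (\bigcup_k A k) by exact: bigcupT_measurable.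
split=> // e e0; have e2 : 0 < e / 2 by rewrite divr_gt0.
have FE : \bigcup_n F n = \bigcup_k A k.
  apply/seteqP; split=> t.
    by move=> [n _]; rewrite /F -bigcup_mkord => -[k _ At]; exists k.
  by move=> [k _ At]; exists k.+1 => //; rewrite /F -bigcup_mkord; exists k => /=.
have ndF : nondecreasing_seq F.
  move=> m n mn; apply/subsetPset; rewrite /F -!bigcup_mkord => t [k /= km At].
  by exists k => //=; exact: leq_trans mn.
have := nondecreasing_cvg_mu (mu := P) mF _ ndF; rewrite FE => /(_ mU) cF.
have [n hn] : exists n, (P (\bigcup_k A k) - P (F n) <= (e / 2)%:E)%E.
  have pf (B : set TR) : measurable B -> P B \is a fin_num := fin_num_measure P B.
  have cF' : P (F n) @[n --> \oo] --> (fine (P (\bigcup_k A k)))%:E.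
    by rewrite (fineK (pf _ mU)); exact: cF.
  have [_ /cvgrPdist_le H] := (fine_cvgP _ _).1 cF'.
  have [n _ /(_ n (leqnn n)) hn] := H _ e2.
  exists n; rewrite -(fineK (pf _ (mF n))) -(fineK (pf _ mU)) -EFinB lee_fin.
  by rewrite (le_trans (ler_norm _)).
have [_ /(_ _ e2)[i [D [iD hD]]]] := hF n.
have mD := dyadic_measurable iD.
exists i, D; split=> //.
have FU : F n `<=` \bigcup_k A k by rewrite -FE; exact: bigcup_sup.
have m1 : measurable (\bigcup_k A k `\` F n) by exact: measurableD.
have m2 : measurable ((F n `\` D) `|` (D `\` F n)) by apply: measurableU; exact: measurableD.
apply: (@le_trans _ _ (P (\bigcup_k A k `\` F n) + P ((F n `\` D) `|` (D `\` F n)))%E).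
  apply: (le_trans _ (measureU2 _ m1 m2)); apply: lebesgue01_le.
  - by apply: measurableU; exact: measurableD.
  - exact: measurableU.
  - move=> t /= [[h1 h2]|[h1 h2]].
      by have [h|h] := pselect (F n t); [right; left|left].
    by right; right; split=> // /FU.
rewrite (splitr e) EFinD leeD//; apply: le_trans hn.
rewrite measureD//; last first.
  by rewrite ltey_eq (fin_num_measure P).
by rewrite setIC; move/setIidPl: FU => ->.
Qed.

(** Take the points sharing their first i digits with a point of [0, 1) not
    above a. In [0, 1) this enlarges the ray at most by an interval of length
    2^-i. *)
Lemma dyadic_approx_ray (a : R) : dyadic_approx `]-oo, a]%classic.
Proof.
have mA : measurable (`]-oo, a]%classic : set TR) by exact: measurable_itv.
split=> // e e0.
have [i hi] : exists i, 2 ^- i <= e :> R.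
  exists (Num.bound e^-1); rewrite -[leRHS]invrK lef_pV2 ?posrE ?invr_gt0 ?exprn_gt0//.
  by apply: ltW; exact: upper_nthrootP.
pose D : set TR := [set t | exists s, [/\ 0 <= s < 1, s <= a & same_digits i t s]].
have iD : dyadic i D.
  move=> t t' d; apply/propext; split=> -[s [h1 h2 h3]]; exists s; split=> // j ji.
    by rewrite -(d _ ji); exact: h3.
  by rewrite (d _ ji); exact: h3.
exists i, D; split=> //; have mD := dyadic_measurable iD.
set B := _ `|` _.
have mB : measurable B by apply: measurableU; exact: measurableD.
pose C : set TR := `]a, a + 2^-i[%classic `|` [set 1].
have mC : measurable C by apply: measurableU => //; exact: measurable_itv.
rewrite [P B]/(lebesgue_measure (B `&` `[0, 1]%classic)).
apply: (@le_trans _ _ (lebesgue_measure C)).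
  apply: le_measure; rewrite ?inE//; first by apply: measurableI => //; exact: measurable_itv.
  move=> t [Bt]; rewrite /= in_itv/= => /andP[t0].
  rewrite le_eqVlt => /predU1P[->|t1]; first by right.
  left; move: Bt; rewrite /B /D /= !in_itv/= => -[[h1 h2]|[[s [h1 h2 h3]] /negP]].
    by exfalso; apply: h2; exists t; split=> //; rewrite t0.
  rewrite -ltNge => ->/=.
  have t01 : 0 <= t < 1 by rewrite t0.
  by rewrite (lt_le_trans (same_digits_dist t01 h1 h3))// lerD2r.
apply: (@le_trans _ _ (2 ^- i)%:E); last by rewrite lee_fin.
rewrite /C measureU0; last 3 first.
- exact: measurable_itv.
- exact: measurable_set1.
- exact: lebesgue_measure_set1.
rewrite [X in (X <= _)%E]lebesgue_measure_itv/= lte_fin ltrDl.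
case: ifP => _; last by rewrite lee_fin invr_ge0 exprn_ge0.
by rewrite -EFinB lee_fin addrAC subrr add0r.
Qed.

Lemma dyadic_approx_measurable (A : set TR) : measurable A -> dyadic_approx A.
Proof.
have sC : sigma_algebra setT dyadic_approx.
  split.
  - split=> // e e0; exists 0%N, set0; split=> //.
    by rewrite setD0 setU0 measure0 lee_fin ltW.
  - by move=> B hB; rewrite setTD; exact: dyadic_approxC.
  - exact: dyadic_approx_bigcup.
move=> mA; apply: (@smallest_sub _ (sigma_algebra setT) _ dyadic_approx sC _ A mA).
move=> _ [[a b] _ <-].
have -> : `]a, b]%classic = ~` (~` `]-oo, b]%classic `|` `]-oo, a]%classic) :> set TR.
  apply/seteqP; split=> t /=; rewrite !in_itv/=.
    by move=> /andP[h1 h2] [//|]; apply/negP; rewrite -ltNge.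
  move=> h; rewrite ltNge; apply/andP; split.
    by apply/negP => h1; apply: h; right.
  by apply: contrapT => h1; apply: h; left.
by apply: dyadic_approxC; apply: dyadic_approxU;
  [apply: dyadic_approxC|]; exact: dyadic_approx_ray.
Qed.

End dyadic_dense.

(** * From UMD to convergence of Walsh series *)

Section umd_to_walsh.
Context (R : realType) (X : completeNormedModType R).
Local Notation r := (@rademacher R).
Local Notation w := (@walsh R).
Local Notation P := (@lebesgue01 R).
Local Notation TR := (measurableTypeR R).
Local Notation L2 := (@L2 _ TR R P X).
Local Notation bI := (@bochner_integral _ TR R P X).
Implicit Types (f g h : R -> X) (t s : R).

(** Approximate f by a simple function, and each of its level sets by a set
    defined by finitely many digits. *)
Lemma dyadic_dense f : L2 f -> forall e : R, 0 < e ->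
  exists i h, dyadic i h /\ (L2norm P (fun t => (f t - h t)%R) <= e%:E)%E.
Proof.
move=> [smf f2] e e0; have e2 : 0 < e / 2 by rewrite divr_gt0.
have [s [hs hfs]] := L2_simple_dense (@sigma_algebra_measurable _ TR)
  (fun _ mA => mA) smf f2 e2.
have [m [k [v [hk Es]]]] := simple_label hs.
have H l (c : R) : 0 < c -> exists i h, dyadic i h /\
    (L2norm P (fun t => (k t == l)%:R *: v l - h t)%R <= c%:E)%E.
  (* The measure b^2 of the symmetric difference gives an error |v l| b <= c. *)
  move=> c0; pose b := c / (1 + `|v l|).
  have vp : 0 < 1 + `|v l| by rewrite ltr_pwDl.
  have b0 : 0 < b by rewrite divr_gt0.
  have [mA /(_ (b ^+ 2) (exprn_gt0 _ b0))[i [D [iD hD]]]] := dyadic_approx_measurable (hk l).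
  have mD := dyadic_measurable iD.
  exists i, (fun t => \1_D t *: v l); split.
    move=> t s' d; congr (_ *: _); rewrite !indicE; congr ((nat_of_bool _)%:R).
    by apply/idP/idP => /set_mem h; apply/mem_set; [rewrite -(iD _ _ d)|rewrite (iD _ _ d)].
  rewrite L2norm_leP; last exact: ltW.
  set B := _ `|` _ in hD.
  have mB : measurable B by apply: measurableU; exact: measurableD.
  have -> : sq_integral P (fun t => (k t == l)%:R *: v l - \1_D t *: v l) =
      ((`|v l| ^+ 2)%:E * P B)%E.
    rewrite -[in RHS](setIT B) -integral_indic// -ge0_integralZl//; last first.
      by apply/measurable_EFinP; exact: measurable_indic.
    apply: eq_integral => t _; rewrite -EFinM; congr (_%:E).
    rewrite -scalerBl normrZ exprMn mulrC; congr (_ * _).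
    rewrite !indicE; have [kt|kt] := eqVneq (k t) l.
      have [tD|tD] := boolP (t \in D).
        rewrite subrr normr0 expr0n memNset// => -[[_]|[_]]; last by [].
        by apply; exact: set_mem.
      rewrite subr0 normr1 expr1n mem_set//; left; split=> //.
      by move=> h; move: tD; rewrite mem_set.
    have [tD|tD] := boolP (t \in D).
      rewrite sub0r normrN normr1 expr1n mem_set//; right; split; first exact: set_mem.
      by move=> /= h; rewrite h eqxx in kt.
    rewrite subrr normr0 expr0n memNset// => -[[h _]|[h _]].
      by rewrite h eqxx in kt.
    by move: tD; rewrite mem_set.
  rewrite (@le_trans _ _ ((`|v l| ^+ 2)%:E * (b ^+ 2)%:E)%E)//.
    by rewrite lee_wpmul2l ?lee_fin ?exprn_ge0.
  rewrite -EFinM lee_fin -exprMn lerXn2r ?nnegrE ?mulr_ge0 ?(ltW c0) ?(ltW b0)//.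
  by rewrite /b mulrCA ger_pMr// ler_pdivrMr// mul1r lerDr.
have Q (q : seq 'I_m) (c : R) : 0 < c -> exists i h, dyadic i h /\
    (L2norm P (fun t => \sum_(l <- q) (k t == l)%:R *: v l - h t)%R <= c%:E)%E.
  elim: q c => [|l q ih] c c0.
    exists 0%N, (fun=> 0); split=> //.
    under eq_fun do rewrite big_nil subr0.
    apply: L2norm_bounded => //; [by have [] := @L2_0 _ TR R P X|exact: ltW|].
    by move=> t; rewrite normr0 ltW.
  have c2 : 0 < c / 2 by rewrite divr_gt0.
  have [i [h1 [ih1 hh1]]] := H l _ c2; have [j [h2 [ih2 hh2]]] := ih _ c2.
  exists (maxn i j), (fun t => h1 t + h2 t); split.
    move=> t s' d.
    by rewrite (ih1 _ _ (same_digits_le (leq_maxl i j) d)) (ih2 _ _ (same_digits_le (leq_maxr i j) d)).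
  under eq_fun do rewrite big_cons opprD addrACA.
  have hl l' : L2 (fun t => (k t == l')%:R *: v l').
    exact: (L2M (fun l'' => (l'' == l')%:R) hk (@dyadic_L2 R X 0 (fun=> v l') (fun _ _ _ => erefl))).
  rewrite (le_trans (L2normD _ _))//.
  - apply: strongly_measurableB; first by have [] := hl l.
    by have [] := dyadic_L2 ih1.
  - apply: strongly_measurableB; last by have [] := dyadic_L2 ih2.
    by have [] := L2_sum q xpredT hl.
  - by rewrite (splitr c) EFinD leeD.
have [i [h [ih hh]]] := Q (index_enum 'I_m) _ e2.
exists i, h; split=> //.
have sE : s = (fun t => \sum_l (k t == l)%:R *: v l).
  rewrite Es; apply/funext => t /=.
  rewrite (bigD1 (k t))//= eqxx scale1r big1 ?addr0// => l.
  by rewrite eq_sym => /negPf ->; rewrite scale0r.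
rewrite (_ : (fun t => _) = (fun t => (f t - s t) + (s t - h t))); last first.
  by apply/funext => t; rewrite addrA subrK.
have [sms _] := L2_simple P hs.
rewrite (le_trans (L2normD _ _))//.
- exact: strongly_measurableB.
- by apply: strongly_measurableB => //; have [] := dyadic_L2 ih.
- by rewrite (splitr e) EFinD leeD// sE.
Qed.

Definition dyadic_filtration (i : nat) : set (set TR) := [set A | dyadic i A].

Lemma dyadic_sigma i : sigma_algebra setT (dyadic_filtration i).
Proof.
split=> [//|A hA t s d|A hA t s d].
  by rewrite /setD/= (hA _ _ d).
apply/propext; split=> -[k _ Ak]; exists k => //.
  by rewrite -(hA k _ _ d).
by rewrite (hA k _ _ d).
Qed.

(** The increment of E_i g is r_i times a function of the first i digits;
    multiplied by the indicator of a set of the i-th algebra it keeps this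
    form, and so has integral 0. *)
Lemma dyadic_mean_martingale g : L2 g -> martingale P dyadic_filtration (fun i => dyadic_mean i g).
Proof.
move=> hg.
have hF : filtration dyadic_filtration.
  split; first exact: dyadic_sigma.
  - by move=> i A; exact: dyadic_measurable.
  - by move=> i A; exact: dyadic_le.
have hL i : L2 (dyadic_mean i g) by exact: dyadic_L2 (@dyadic_dyadic_mean R X i g).
have hm i : strongly_measurable_wrt P (dyadic_filtration i) (dyadic_mean i g).
  exists (fun=> dyadic_mean i g); split; last by apply: nearW => t; exact: cvg_cst.
  move=> _; have [v ->] := dyadic_label (@dyadic_dyadic_mean R X i g).
  apply: label_simple; first exact: dyadic_sigma.
  by move=> l t s /digitsP d; rewrite /preimage/= d.
split; [exact: hF|by move=> i; exact: L2_bochner_integrable|exact: hm|].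
move=> i; split; [exact: hm|exact: L2_bochner_integrable|exact: L2_bochner_integrable|].
move=> A iA; rewrite /bochner_integral_on.
have iA1 : dyadic i (\1_A : R -> R).
  move=> t s d; rewrite !indicE; congr ((nat_of_bool _)%:R).
  by apply/idP/idP => /set_mem h; apply/mem_set; [rewrite -(iA _ _ d)|rewrite (iA _ _ d)].
apply/esym/eqP; rewrite -subr_eq0 -bochner_integralB; last 2 first.
- exact: dyadicM_L2 iA1 (hL _).
- exact: dyadicM_L2 iA1 (hL _).
apply/eqP; rewrite (_ : (fun _ => _) = (fun t => r i t *: (\1_A t *:
    bI (fun s => (r i s * cond_kernel i t s) *: g s)))).
  apply: rademacher_mean; apply: (dyadic_scale iA1) => t s d.
  congr bI; apply/funext => u; congr ((_ * _) *: _).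
  by rewrite /cond_kernel; apply: eq_bigr => j _; rewrite (d j).
by apply/funext => t; rewrite -scalerBr dyadic_mean_diff// !scalerA mulrC.
Qed.

(** A coefficient n_i in {0, 1} is the mean of 1 and of the sign 2 n_i - 1, so
    the transform of [walsh_sum_transform] is bounded by (1 + c) / 2 times the
    norm of E_(n+1) g - E_0 g, where g = w_n f, hence by (1 + c) times the
    norm of f. *)
Lemma UMD_walsh_bounded : UMD X -> exists C : R, 0 <= C /\ forall n f, L2 f ->
  (L2norm P (walsh_sum n f) <= C%:E * L2norm P f)%E.
Proof.
move=> [c [c0 hc]]; exists (1 + c); split; first by rewrite addr_ge0.
move=> n f hf; pose g t := w n t *: f t; have hg : L2 g := walsh_L2 n hf.
have gf : L2norm P g = L2norm P f.
  by apply: L2norm_norm => t; rewrite normrZ walsh_norm mul1r.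
pose M i := dyadic_mean i g.
have hL i : L2 (M i) by exact: dyadic_L2 (@dyadic_dyadic_mean R X i g).
have hd i : L2 (mdiff M i) by exact: L2B.
pose eps (i : nat) : R := if digit n i == 1%N then 1 else -1.
have heps i : eps i = 1 \/ eps i = -1 by rewrite /eps; case: ifP; [left|right].
have := hc _ TR P _ M (dyadic_mean_martingale hg) hL n eps heps.
pose D t := \sum_(i < n.+1) mdiff M i t.
pose E t := \sum_(i < n.+1) eps i *: mdiff M i t.
have LD : L2 D by apply: L2_sum => i; exact: hd.
have LE : L2 E by apply: L2_sum => i; apply: L2Z; exact: hd.
rewrite -/D -/E => hE.
have nN : (n < 2 ^ n.+1)%N by rewrite (ltn_trans (ltnSn n))// ltn_expl.
rewrite (@L2norm_norm _ _ _ P X _ (fun t => 2^-1 *: (E t + D t))); last first.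
  move=> t; rewrite (walsh_sum_transform t nN hf) normrZ walsh_norm mul1r; congr `|_|.
  rewrite /E /D -big_split/= scaler_sumr; apply: eq_bigr => i _.
  rewrite -[X in _ = _ *: (_ + X)]scale1r -scalerDl scalerA /eps /mdiff -/g -/(M _); congr (_ *: _).
  have : (digit n i < 2)%N by rewrite /digit ltn_mod.
  by case: (digit n i) => [|[|//]] _ /=; rewrite ?addNr ?mulr0// mulVf.
have [sE _] := LE; have [sD _] := LD.
rewrite L2normZ; last exact: strongly_measurableD.
have nD : (L2norm P D <= 2%:E * L2norm P f)%E.
  have -> : D = (fun t => M n.+1 t - M 0%N t).
    apply/funext => t; rewrite /D /mdiff -(big_mkord xpredT (fun i => M i.+1 t - M i t)).
    by rewrite telescope_sumr.
  have [s1 _] := hL n.+1; have [s2 _] := hL 0%N.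
  rewrite (le_trans (L2normB s1 s2))// -gf.
  rewrite (_ : 2%:E = 1 + 1)%E; last by rewrite -EFinD; congr (_%:E); lra.
  by rewrite ge0_muleDl// !mul1e leeD// dyadic_mean_contract.
have L0 := L2norm_ge0 P f.
rewrite (@le_trans _ _ (2^-1%:E * ((1 + c)%:E * L2norm P D))%E)//.
  rewrite ger0_norm ?invr_ge0// lee_wpmul2l ?lee_fin ?invr_ge0//.
  rewrite (le_trans (L2normD sE sD))// EFinD ge0_muleDl ?lee_fin// mul1e addeC.
  by rewrite leeD2l.
rewrite muleA (@le_trans _ _ (2^-1%:E * (1 + c)%:E * (2%:E * L2norm P f))%E)//.
  by rewrite lee_wpmul2l// -EFinM lee_fin mulr_ge0 ?invr_ge0 ?addr_ge0.
rewrite muleA -!EFinM le_eqVlt; apply/orP; left; apply/eqP; congr ((_%:E * _)%E).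
by lra.
Qed.

Lemma UMD_walsh_converges : UMD X -> forall f, L2 f ->
  L2norm P (fun t => f t - walsh_sum n f t) @[n --> \oo] --> 0%:E.
Proof.
move=> /UMD_walsh_bounded[C [C0 hC]] f hf.
apply/cvge_to0P => [n|e e0]; first exact: L2norm_ge0.
have d0 : 0 < e / (1 + C) by rewrite divr_gt0// ltr_pwDl.
have [i [h [ih hh]]] := dyadic_dense hf d0.
exists (2 ^ i)%N => // n /= hn.
have Lh := dyadic_L2 ih; have Lfh := L2B hf Lh.
rewrite (_ : (fun t => _) = (fun t => (f t - h t) - walsh_sum n (fun s => f s - h s) t)); last first.
  by apply/funext => t; rewrite walsh_sumB// (walsh_sum_id ih hn) opprB addrA subrK.
have [s1 _] := Lfh; have [s2 _] := walsh_sum_L2 n (fun s => f s - h s).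
rewrite (le_trans (L2normB s1 s2))//.
apply: (@le_trans _ _ ((1 + C)%:E * (e / (1 + C))%:E)%E).
  rewrite EFinD ge0_muleDl ?lee_fin ?divr_ge0 ?addr_ge0 ?(ltW e0)// mul1e.
  rewrite leeD// (le_trans (hC n _ Lfh))// lee_wpmul2l//.
by rewrite -EFinM mulrCA divff ?mulr1// gt_eqF// ltr_pwDl.
Qed.

End umd_to_walsh.

(** * Absolutely convergent series of simple functions in L2 *)

Lemma limn_einf_ub (R : realType) (u : (\bar R)^nat) (c : \bar R) (k : nat) :
  (forall m, (k <= m)%N -> (u m <= c)%E) -> (limn_einf u <= c)%E.
Proof.
move=> h; rewrite limn_einf_lim; apply: lime_le; first exact: is_cvg_einfs.
apply: nearW => n; apply: (@le_trans _ _ (u (maxn n k))); last by apply: h; exact: leq_maxr.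
by apply: ereal_inf_lbound; exists (maxn n k) => //=; exact: leq_maxl.
Qed.

Lemma halving_sum (R : realType) (dl : nat -> R) : (forall k, 0 <= dl k) ->
  (forall k, dl k.+1 <= dl k / 2) ->
  forall m k, \sum_(k <= j < k + m) dl j <= 2 * dl k.
Proof.
move=> d0 dh; elim=> [|m ih] k.
  by rewrite addn0 big_geq// mulr_ge0.
rewrite big_ltn; last by rewrite addnS ltnS leq_addr.
rewrite -addSnnS (le_trans (lerD (lexx _) (ih k.+1)))//.
by have := dh k; lra.
Qed.

Section riesz_fischer.
Context d (T : measurableType d) (R : realType) (P : probability T R).
Context (X : completeNormedModType R).
Local Notation simp := (simple (@measurable d T)).
Local Notation sm := (strongly_measurable P).
Let sA := @sigma_algebra_measurable d T.

Variables (y : nat -> T -> X) (dl : nat -> R).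
Hypotheses (hy : forall k, simp (y k)) (dl0 : forall k, 0 <= dl k)
  (dlh : forall k, dl k.+1 <= dl k / 2)
  (ydl : forall k, (L2norm P (y k) <= (dl k)%:E)%E).

Let S n t := \sum_(0 <= k < n) y k t.

Let simpS n : simp (S n).
Proof.
elim: n => [|n ih].
  rewrite (_ : S 0%N = fun=> 0); last by apply/funext => t; rewrite /S big_geq.
  exact: (@label_simple _ _ _ sA _ _ _ _ (fun=> 0) (labelling_cst sA tt)).
rewrite (_ : S n.+1 = fun t => S n t + y n t).
  exact: (simple_binary +%R ih (hy n)).
by apply/funext => t; rewrite /S big_nat_recr.
Qed.

Let ae_summable : {ae P, forall t, cvgn (series (y ^~ t))}.
Proof.
pose G t := (\sum_(0 <= k <oo) (`|y k t|)%:E)%E.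
have mY k : measurable_fun setT (fun t => (`|y k t|)%:E).
  by apply/measurable_EFinP; exact: measurable_norm_simple.
have G0 t : (0 <= G t)%E by apply: nneseries_ge0 => k _ _; rewrite lee_fin.
have mG : measurable_fun setT G.
  by apply: ge0_emeasurable_sum => // k t _ _; rewrite lee_fin.
have iG : (\int[P]_t G t <= (2 * dl 0%N)%:E)%E.
  rewrite integral_nneseries//.
  apply: lime_le.
    by apply: is_cvg_nneseries => n _ _; apply: integral_ge0 => t _; rewrite lee_fin.
  apply: nearW => n.
  apply: (@le_trans _ _ (\sum_(0 <= k < n) dl k)%:E).
    rewrite -sumEFin; apply: lee_sum => k _; apply: le_trans (ydl k).
    by apply: integral_norm_le_L2norm; exact: strongly_measurable_simple.
  by rewrite lee_fin -{1}(add0n n); exact: halving_sum.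
have inG : P.-integrable setT G.
  apply/integrableP; split=> //.
  under eq_integral do rewrite gee0_abs//.
  by apply: le_lt_trans iG _; rewrite ltry.
have := integrable_ae measurableT inG; apply: filterS => t /(_ Logic.I) Gt.
apply: normed_cvg; apply: nondecreasing_is_cvgn.
  apply/nondecreasing_seqP => n; rewrite [leRHS]seriesSr lerDl; exact: normr_ge0.
exists (fine (G t)) => _ [n _ <-]; rewrite -lee_fin fineK//.
rewrite -[X in (X%:E <= _)%E]/(\sum_(0 <= k < n) `|y k t|) -sumEFin.
by apply: nneseries_lim_ge => k _; rewrite lee_fin.
Qed.

(** Since the norms of the y_k are summable in L1, the series converges almost
    everywhere; Fatou's lemma bounds the tails. The terms are simple so that
    the partial sums witness the strong measurability of the limit. *)
Lemma simple_series_L2 : exists x, L2 P x /\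
  forall k, (L2norm P (fun t => x t - S k t)%R <= (2 * dl k)%:E)%E.
Proof.
pose x t := limn (series (y ^~ t)).
have Sx : {ae P, forall t, S n t @[n --> \oo] --> x t}.
  by apply: filterS ae_summable => t ht; exact: ht.
have smx : sm x by exists S.
have bound k : (L2norm P (fun t => x t - S k t)%R <= (2 * dl k)%:E)%E.
  rewrite L2norm_leP ?mulr_ge0//.
  rewrite /sq_integral (@ge0_integral_ae _ _ _ P _
    (fun t => limn_einf (fun m => (`|S m t - S k t| ^+ 2)%:E))); last 3 first.
  - by move=> t; rewrite lee_fin exprn_ge0.
  - move=> t; rewrite limn_einf_lim; apply: lime_ge; first exact: is_cvg_einfs.
    by apply: nearW => n; apply: le_ereal_inf_tmp => _ [m _ <-]; rewrite lee_fin exprn_ge0.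
  - apply: filterS Sx => t ht; apply/esym.
    have hc : (`|S m t - S k t| ^+ 2)%:E @[m --> \oo] --> (`|x t - S k t| ^+ 2)%:E.
      apply: cvg_EFin; first exact: nearW.
      rewrite (_ : fine \o _ = (fun m => `|S m t - S k t| ^+ 2))// expr2.
      under eq_fun do rewrite expr2.
      by apply: cvgM; apply: cvg_norm; apply: cvgB => //; exact: cvg_cst.
    by have [-> _] := cvg_limn_einf_sup hc.
  have simpB m : simp (fun t => S m t - S k t) := simple_binary (fun a b => a - b) (simpS m) (simpS k).
  have F1 m : measurable_fun setT (fun t => (`|S m t - S k t| ^+ 2)%:E).
    by apply/measurable_EFinP; apply: measurable_funX; exact: measurable_norm_simple.
  have F2 m t : setT t -> (0 <= (`|S m t - S k t| ^+ 2)%:E)%E.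
    by rewrite lee_fin exprn_ge0.
  apply: (le_trans (fatou P measurableT F1 F2)).
  apply: (@limn_einf_ub _ _ _ k) => m km.
  rewrite -[X in (X <= _)%E]/(sq_integral P (fun t => S m t - S k t)) -L2norm_leP ?mulr_ge0//.
  apply: (@le_trans _ _ (\sum_(k <= j < m) dl j)%:E); last first.
    by rewrite lee_fin -(subnKC km); exact: halving_sum.
  elim: m km {simpB} => [|m ih].
    rewrite leqn0 => /eqP ->; under eq_fun do rewrite subrr.
    rewrite big_geq// L2norm_bounded//; last by move=> t; rewrite normr0.
    by have [] := @L2_0 _ T R P X.
  rewrite leq_eqVlt => /predU1P[<-|km].
    under eq_fun do rewrite subrr.
    rewrite big_geq// L2norm_bounded//; last by move=> t; rewrite normr0.
    by have [] := @L2_0 _ T R P X.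
  rewrite (_ : (fun t => _) = (fun t => (S m t - S k t) + y m t)); last first.
    by apply/funext => t; rewrite /S big_nat_recr//= addrAC.
  rewrite ltnS in km; rewrite big_nat_recr//= EFinD.
  rewrite (le_trans (L2normD _ _))//; last by rewrite leeD// ih.
    apply: strongly_measurableB; exact: strongly_measurable_simple.
  exact: strongly_measurable_simple.
exists x; split=> //; split=> //.
have := bound 0%N; rewrite /S; under eq_fun do rewrite big_geq// subr0.
by move=> h; apply: le_lt_trans h _; rewrite ltry.
Qed.

End riesz_fischer.

(** * Uniform boundedness of Walsh partial sums *)

Section gliding_hump.
Context (R : realType) (X : completeNormedModType R).
Local Notation P := (@lebesgue01 R).
Local Notation TR := (measurableTypeR R).
Local Notation simp := (simple (@measurable _ TR)).
Local Notation L2 := (@L2 _ TR R P X).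

Let sA := @sigma_algebra_measurable _ TR.

Hypothesis conv : forall f : R -> X, L2 f ->
  L2norm P (fun t => f t - walsh_sum n f t) @[n --> \oo] --> 0%:E.

Let L2_fin (f : R -> X) : L2 f -> exists2 a : R, 0 <= a & L2norm P f = a%:E.
Proof.
move=> [_ f2]; have f0 := L2norm_ge0 P f.
have ff : L2norm P f \is a fin_num by rewrite ge0_fin_numE.
by exists (fine (L2norm P f)); rewrite ?fineK// fine_ge0.
Qed.

(** A convergent sequence is bounded; the finitely many first terms are
    controlled by [walsh_sum_bound]. *)
Lemma walsh_sums_bounded (f : R -> X) : L2 f ->
  exists B : R, forall n, (L2norm P (walsh_sum n f) <= B%:E)%E.
Proof.
move=> hf; have [a a0 fa] := L2_fin hf.
have /cvge_to0P := conv hf; move=> /(_ (fun=> L2norm_ge0 _ _) 1 ltr01) [N _ hN].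
exists (N%:R * a + (a + 1)) => n.
have [nN|Nn] := ltnP n N.
  rewrite (le_trans (walsh_sum_bound n hf))// fa -EFinM lee_fin.
  rewrite (@le_trans _ _ (N%:R * a))//; last by rewrite lerDl addr_ge0.
  by rewrite ler_wpM2r// ler_nat ltnW.
apply: (@le_trans _ _ (a + 1)%:E); last by rewrite lee_fin lerDr mulr_ge0.
rewrite (_ : walsh_sum n f = fun t => f t - (f t - walsh_sum n f t)); last first.
  by apply/funext => t; rewrite opprB addrC subrK.
have [smf _] := hf; have [sms _] := walsh_sum_L2 n f.
by rewrite (le_trans (L2normB smf (strongly_measurableB smf sms)))// EFinD fa leeD2l// hN.
Qed.

(** Scale a function on which S_n is large to norm dl, and call it y. As S_n
    (x + y) - S_n (x - y) = 2 S_n y, one of the two choices of sign works. *)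
Lemma walsh_hump : (forall C : R, 0 <= C -> exists (f : R -> X) n, simp f /\
    ~ (L2norm P (walsh_sum n f) <= C%:E * L2norm P f)%E) ->
  forall (x : R -> X) (dl K : R), simp x -> 0 < dl -> 0 <= K ->
  exists q : nat * (R -> X), [/\ simp q.2, (L2norm P q.2 <= dl%:E)%E &
    (K%:E <= L2norm P (walsh_sum q.1 (fun t => (x t + q.2 t)%R)))%E].
Proof.
move=> unb x dl K sx d0 K0.
have [f [n [sf /negP]]] := unb (K / dl) (divr_ge0 K0 (ltW d0)).
have hf := L2_simple P sf; have [a a0 fa] := L2_fin hf.
have hS := walsh_sum_L2 n f; have [b b0 Sb] := L2_fin hS.
rewrite -ltNge fa Sb -EFinM lte_fin => hb.
have ap : 0 < a.
  rewrite lt_def a0 andbT; apply/eqP => a00.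
  have := walsh_sum_bound n hf; rewrite fa Sb a00 -EFinM mulr0 lee_fin => b1.
  by move: hb; rewrite a00 mulr0 ltNge b1.
have Lx := L2_simple P sx.
pose y (e : R) t := (e * (dl / a)) *: f t.
have sy e : simp (y e).
  exact: (simple_binary (fun u _ : X => (e * (dl / a)) *: u) sf sf).
have Ly e := L2_simple P (sy e).
have ny e : `|e| = 1 -> (L2norm P (y e) <= dl%:E)%E.
  move=> e1; rewrite /y L2normZ; last by have [] := hf.
  rewrite normrM e1 mul1r ger0_norm; last by rewrite divr_ge0// ltW.
  rewrite fa -EFinM lee_fin.
  by rewrite -mulrA mulVf ?mulr1// gt_eqF.
have key : (K%:E <= L2norm P (walsh_sum n (fun t => (x t + y 1 t)%R)))%E \/
    (K%:E <= L2norm P (walsh_sum n (fun t => (x t + y (-1) t)%R)))%E.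
  have L1 := walsh_sum_L2 n (fun t => x t + y 1 t).
  have L1' := walsh_sum_L2 n (fun t => x t + y (-1) t).
  have [u u0 Eu] := L2_fin L1; have [v v0 Ev] := L2_fin L1'.
  have [m1 _] := L1; have [m2 _] := L1'.
  have := L2normB m1 m2; rewrite Eu Ev.
  rewrite (_ : (fun t => _ - _) = (fun t => (2 * (dl / a)) *: walsh_sum n f t)); last first.
    apply/funext => t; rewrite -walsh_sumB; try exact: L2D.
    rewrite -walsh_sumZ//; congr (walsh_sum n _ t); apply/funext => s.
    rewrite /y opprD addrACA subrr add0r -scalerBl; congr (_ *: _).
    by rewrite mulN1r mul1r opprK; ring.
  have [mS _] := hS.
  rewrite L2normZ// Sb -EFinD -EFinM !lee_fin ger0_norm ?mulr_ge0 ?invr_ge0 ?(ltW d0)//.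
  have h2 : K < dl / a * b.
    move: hb; rewrite -(ltr_pM2l (x := dl / a)) ?divr_gt0//.
    have -> : dl / a * (K / dl * a) = K by field; rewrite !gt_eqF.
    by [].
  by move=> h; case: (leP K u) => Ku; [left|right]; lra.
case: key => h; [exists (n, y 1)|exists (n, y (-1))]; split=> //=; apply: ny.
  by rewrite normr1.
by rewrite normrN1.
Qed.

(** Gliding hump. If there were no uniform bound, build x as a sum of simple
    functions y_k such that some S_(n_k) is at least k on the k-th partial
    sum. Once n_k is chosen, all later terms are kept below 1 / (n_k + 1) in
    total up to a factor 2, so that they change S_(n_k) by at most 2. Then the
    norms of S_n x are unbounded, against [walsh_sums_bounded]. *)
Lemma walsh_uniformly_bounded : exists C : R, 0 <= C /\
  forall (f : R -> X) n, simp f -> (L2norm P (walsh_sum n f) <= C%:E * L2norm P f)%E.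
Proof.
apply: contrapT => /forallNP nb.
have unb : forall C : R, 0 <= C -> exists (f : R -> X) n, simp f /\
    ~ (L2norm P (walsh_sum n f) <= C%:E * L2norm P f)%E.
  move=> C C0; apply: contrapT => /forallNP h; apply: (nb C); split=> // f n sf.
  by apply: contrapT => h2; apply: (h f); exists n.
have hump := walsh_hump unb.
have H (p : (R -> X) * R * nat) : exists q : nat * (R -> X),
   simp p.1.1 -> 0 < p.1.2 -> [/\ simp q.2, (L2norm P q.2 <= p.1.2%:E)%E &
    (p.2%:R%:E <= L2norm P (walsh_sum q.1 (fun t => (p.1.1 t + q.2 t)%R)))%E].
  have [[h1 h2]|h] := pselect (simp p.1.1 /\ 0 < p.1.2).
    by have [q hq] := hump p.1.1 p.1.2 p.2%:R h1 h2 (ler0n _ _); exists q.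
  by exists (0%N, fun=> 0) => h1 h2; exfalso; apply: h.
have [g hg] := choice H.
(* The state is the current partial sum together with a bound for the norm of
   the next term. *)
pose st := fix st k : (R -> X) * R := if k is k'.+1 then
    let q := g (st k', k') in
    (fun t => (st k').1 t + q.2 t, Num.min ((st k').2 / 2) (q.1.+1%:R^-1))
  else (fun=> 0, 1).
pose y k := (g (st k, k)).2; pose n k := (g (st k, k)).1; pose dl k := (st k).2.
have stP k : simp (st k).1 /\ 0 < (st k).2.
  elim: k => [|k [ih1 ih2]] /=.
    split=> //; exact: (@label_simple _ _ _ sA _ _ _ _ (fun=> 0) (labelling_cst sA tt)).
  have [h1 _ _] := hg (st k, k) ih1 ih2.
  split; first exact: (simple_binary +%R ih1 h1).
  by rewrite lt_min divr_gt0//= invr_gt0.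
have xE k t : (st k).1 t = \sum_(0 <= j < k) y j t.
  by elim: k => [|k ih]; [rewrite big_geq|rewrite big_nat_recr//= -ih].
have hy k : simp (y k) by have [h1 h2] := stP k; have [] := hg (st k, k) h1 h2.
have ydl k : (L2norm P (y k) <= (dl k)%:E)%E.
  by have [h1 h2] := stP k; have [] := hg (st k, k) h1 h2.
have dl0 k : 0 <= dl k by have [_ /ltW] := stP k.
have dlh k : dl k.+1 <= dl k / 2 by rewrite /dl /= ge_min lexx.
have [x [Lx hx]] := simple_series_L2 hy dl0 dlh ydl.
have [B hB] := walsh_sums_bounded Lx.
have big k : (k%:R%:E <= (B + 2)%:E :> \bar R)%E.
  have [h1 h2] := stP k; have [_ _] := hg (st k, k) h1 h2.
  rewrite -/(n k) -/(y k) => /le_trans; apply.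
  have E : (fun t => (st k, k).1.1 t + y k t) = (fun t => \sum_(0 <= j < k.+1) y j t).
    by apply/funext => t; rewrite big_nat_recr//= xE.
  rewrite E; set S := (fun t => _).
  have LS : L2 S.
    by apply: L2_sum => j; apply: L2_simple.
  rewrite (_ : walsh_sum (n k) S = fun t => walsh_sum (n k) x t -
      walsh_sum (n k) (fun s => x s - S s) t); last first.
    by apply/funext => t; rewrite walsh_sumB// opprB addrC subrK.
  have LD := L2B Lx LS.
  have [s1 _] := walsh_sum_L2 (n k) x.
  have [s2 _] := walsh_sum_L2 (n k) (fun s => x s - S s).
  rewrite (le_trans (L2normB s1 s2))// EFinD leeD// (le_trans (walsh_sum_bound _ LD))//.
  rewrite (@le_trans _ _ ((n k)%:R%:E * (2 * dl k.+1)%:E)%E)//.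
    by rewrite lee_wpmul2l ?lee_fin// hx.
  rewrite -EFinM lee_fin.
  have : dl k.+1 <= (n k).+1%:R^-1 by rewrite /dl /= ge_min lexx orbT.
  move=> h; rewrite (@le_trans _ _ ((n k)%:R * (2 * (n k).+1%:R^-1)))//.
    by rewrite ler_wpM2l// ler_wpM2l.
  by rewrite mulrCA ger_pMr// ler_pdivrMr// mul1r ler_nat.
have := big (Num.bound (B + 2)); rewrite lee_fin => h.
have B0 : 0 <= B + 2 by apply: le_trans h.
by have := archi_boundP B0; rewrite ltNge h.
Qed.

End gliding_hump.

(** * The UMD inequality for Paley-Walsh martingales *)

Lemma digits_exist N (b : nat -> bool) : exists n, (n < 2 ^ N)%N /\
  forall i, (i < N)%N -> digit n i = b i :> nat.
Proof.
elim: N => [|N [n [nN hn]]]; first by exists 0%N.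
exists (b N * 2 ^ N + n)%N; split.
  by rewrite expnS; case: (b N) => /=; lia.
move=> i; rewrite ltnS leq_eqVlt => /predU1P[->|iN].
  by rewrite /digit divnMDl ?expn_gt0// divn_small// addn0; case: (b N).
rewrite -(hn i iN) /digit.
have -> : (b N * 2 ^ N = b N * 2 ^ (N - i.+1) * 2 * 2 ^ i)%N.
  by rewrite -!mulnA; congr (_ * _)%N; rewrite -expnS -expnD; congr (_ ^ _)%N; lia.
by rewrite divnMDl ?expn_gt0// modnMDl.
Qed.

Section dyadic_umd.
Context (R : realType) (X : completeNormedModType R).
Local Notation r := (@rademacher R).
Local Notation w := (@walsh R).
Local Notation P := (@lebesgue01 R).
Local Notation TR := (measurableTypeR R).
Local Notation simp := (simple (@measurable _ TR)).
Local Notation L2 := (@L2 _ TR R P X).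

Variables (C : R).
Hypothesis C0 : 0 <= C.
Hypothesis bounded : forall (f : R -> X) n, simp f ->
  (L2norm P (walsh_sum n f) <= C%:E * L2norm P f)%E.

(** The term of index j is a function of the first j + 1 digits and has
    conditional mean 0 given the first j. *)
Lemma dyadic_mean_paley (D : nat -> R -> X) (hD : forall i, dyadic i (D i)) N i : (i <= N)%N ->
  dyadic_mean i (fun t => \sum_(j < N) r j t *: D j t) = fun t => \sum_(j < i) r j t *: D j t.
Proof.
move=> iN.
have hL j : L2 (fun t => r j t *: D j t).
  by apply: (@dyadic_L2 _ _ j.+1); apply: dyadic_scale; [exact: dyadic_rademacher|exact: (dyadic_le (leqnSn j))].
have avgD (f g : R -> X) : L2 f -> L2 g ->
    dyadic_mean i (fun t => f t + g t) = fun t => dyadic_mean i f t + dyadic_mean i g t.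
  move=> hf hg; apply/funext => t; rewrite /dyadic_mean -bochner_integralD; try exact: cond_kernel_L2.
  by congr bochner_integral; apply/funext => s; rewrite scalerDr.
elim: N iN => [|N ih].
  rewrite leqn0 => /eqP ->; rewrite dyadic_mean_id => [|t s _]; last by rewrite !big_ord0.
  by [].
rewrite leq_eqVlt => /predU1P[->|iN].
  rewrite dyadic_mean_id// => t s d; apply: eq_bigr => j _.
  by rewrite (d j)// (hD j _ _ (same_digits_le (ltnW (ltn_ord j)) d)).
under eq_fun do rewrite big_ord_recr/=.
rewrite avgD//; last by apply: L2_sum => j; exact: hL.
by rewrite ih// dyadic_mean_rademacher//; apply/funext => t; rewrite addr0.
Qed.

(** Choose n with digits n_i = 1 exactly where the sign is 1. Then w_n S_n
    (w_n p) is the sum of the terms of p with sign 1, and the signed sum is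
    twice it minus p. *)
Lemma paley_transform_bound (D : nat -> R -> X) N (eps : nat -> R) :
  (forall i, dyadic i (D i)) -> (forall i, eps i = 1 \/ eps i = -1) ->
  (L2norm P (fun t => (\sum_(i < N) eps i *: (r i t *: D i t))%R) <=
   (2 * C + 1)%:E * L2norm P (fun t => (\sum_(i < N) r i t *: D i t)%R))%E.
Proof.
move=> hD heps; pose p t := \sum_(i < N) r i t *: D i t.
have ip : dyadic N p.
  move=> t s d; apply: eq_bigr => j _.
  by rewrite (d j)// (hD j _ _ (same_digits_le (ltnW (ltn_ord j)) d)).
have [n [nN hn]] := digits_exist N (fun i => eps i == 1).
have iw : dyadic N (fun t => w n t *: p t) by apply: dyadic_scale => //; exact: walsh_dyadic.
have Lp := dyadic_L2 ip; have Lw := dyadic_L2 iw.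
have E t : walsh_sum n (fun t => w n t *: p t) t =
    w n t *: \sum_(i < N) (eps i == 1)%:R *: (r i t *: D i t).
  rewrite (walsh_sum_transform t nN Lw); congr (_ *: _); apply: eq_bigr => i _.
  have -> : (fun s => w n s *: (w n s *: p s)) = p.
    by apply/funext => s; rewrite scalerA walsh_sqr scale1r.
  rewrite hn// !dyadic_mean_paley//; last exact: ltnW.
  by rewrite big_ord_recr/= [X in X - _]addrC addrK.
rewrite -/p (_ : (fun t => _) = (fun t => 2 *: (w n t *: walsh_sum n (fun t => w n t *: p t) t) - p t)); last first.
  apply/funext => t; rewrite E [w n t *: (w n t *: _)]scalerA walsh_sqr scale1r /p scaler_sumr -sumrB.
  apply: eq_bigr => i _; set q := r i t *: D i t.
  rewrite -[X in _ = _ - X]scale1r scalerA -scalerBl; congr (_ *: _).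
  case: (heps i) => ->; first by rewrite eqxx mulr1 -[2]/(1 + 1) addrK.
  rewrite (_ : (-1 == 1) = false) ?mulr0 ?sub0r//.
  by apply/negbTE/eqP => /esym/one_neqN1.
have LwS := walsh_L2 n (walsh_sum_L2 n (fun t => w n t *: p t)).
have [s1 _] := LwS; have [s2 _] := Lp.
rewrite (le_trans (L2normB (strongly_measurableZ 2 s1) s2))// L2normZ// ger0_norm//.
rewrite [(2 * C + 1)%:E]EFinD ge0_muleDl ?lee_fin ?mulr_ge0// mul1e leeD2r// EFinM -muleA.
rewrite lee_wpmul2l//.
have -> : L2norm P (fun t => w n t *: walsh_sum n (fun t => w n t *: p t) t) =
    L2norm P (walsh_sum n (fun t => w n t *: p t)).
  by apply: L2norm_norm => t; rewrite normrZ walsh_norm mul1r.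
have <- : L2norm P (fun t => w n t *: p t) = L2norm P p.
  by apply: L2norm_norm => t; rewrite normrZ walsh_norm mul1r.
exact: bounded n (dyadic_simple iw).
Qed.

(** Values of finite dyadic trees. In a tree with signs es started at (x, y),
    the first coordinate moves by +a or -a with probability 1/2 each, the
    second by +e a or -e a, where a may depend on the past but e is fixed at
    each level; u and v are the means of |Y|^2 and |X|^2 at the leaves. *)
Fixpoint reach (es : seq R) (x y : X) (u v : R) : Prop :=
  if es is e :: es' then
    exists a u1 v1 u2 v2, [/\ reach es' (x + a) (y + e *: a) u1 v1,
      reach es' (x - a) (y - e *: a) u2 v2, u = (u1 + u2) / 2 & v = (v1 + v2) / 2]
  else u = `|y| ^+ 2 /\ v = `|x| ^+ 2.

(** A tree is realised on any set A depending on the first m digits by using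
    the digits from the m-th on as coin tosses: the digit of index m splits A
    into two sets of equal measure, on which the two subtrees are realised by
    induction. *)
Lemma reach_realise es x y u v : reach es x y u v ->
  forall m (A : set TR), dyadic m A -> exists D : nat -> R -> X,
  [/\ forall i, dyadic (m + i) (D i),
   (\int[P]_(t in A) (`|(y + \sum_(i < size es) es`_i *: (r (m + i) t *: D i t))%R| ^+ 2)%:E = u%:E * P A)%E
   & (\int[P]_(t in A) (`|(x + \sum_(i < size es) r (m + i) t *: D i t)%R| ^+ 2)%:E = v%:E * P A)%E].
Proof.
elim: es x y u v => [|e es ih] x y u v /=.
  move=> [-> ->] m A iA; exists (fun _ _ => 0); split=> //.
    under eq_integral do rewrite big_ord0 addr0.
    by rewrite integral_cst//; exact: dyadic_measurable iA.
  under eq_integral do rewrite big_ord0 addr0.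
  by rewrite integral_cst//; exact: dyadic_measurable iA.
move=> [a [u1 [v1 [u2 [v2 [h1 h2 -> ->]]]]]] m A iA.
have mA := dyadic_measurable iA.
pose A1 := A `&` [set t | r m t = 1]; pose A2 := A `&` [set t | r m t = -1].
have iA1 : dyadic m.+1 A1.
  by move=> t s /same_digitsS[d d']; rewrite /A1 /setI/= (iA _ _ d) d'.
have iA2 : dyadic m.+1 A2.
  by move=> t s /same_digitsS[d d']; rewrite /A2 /setI/= (iA _ _ d) d'.
have mA1 := dyadic_measurable iA1; have mA2 := dyadic_measurable iA2.
have AE : A = A1 `|` A2.
  apply/seteqP; split=> t; last by move=> [] [].
  by move=> At; case: (rademacherP m t) => h; [left|right].
have dA : [disjoint A1 & A2].
  apply/eqP/seteqP; split=> t // [[_ /= h] [_ /= h']].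
  by apply: (@one_neqN1 R); rewrite -h' h.
have PA12 : P A1 = P A2 := rademacher_half mA iA.
have PA : P A = (P A1 + P A2)%E.
  by rewrite {1}AE measureU//; apply/eqP; rewrite -[_ == _]/([disjoint A1 & A2]).
have [D1 [iD1 hy1 hx1]] := ih _ _ _ _ h1 m.+1 A1 iA1.
have [D2 [iD2 hy2 hx2]] := ih _ _ _ _ h2 m.+1 A2 iA2.
(* The first increment is constant; the later ones are those of the subtree
   selected by the digit of index m. *)
pose D i : R -> X := if i is i'.+1 then
  fun t => if r m t == 1 then D1 i' t else D2 i' t else fun=> a.
have iD i : dyadic (m + i) (D i).
  case: i => [//|i] t s d /=; rewrite (d m) ?addnS ?ltnS ?leq_addr//.
  by rewrite addnS -addSn in d; rewrite (iD1 i _ _ d) (iD2 i _ _ d).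
have step (z : X) (c : nat -> R) n :
    (\int[P]_(t in A) (`|(z + \sum_(i < n.+1) c i *: (r (m + i) t *: D i t))%R| ^+ 2)%:E =
     \int[P]_(t in A1) (`|(z + c 0%N *: a + \sum_(i < n) c i.+1 *: (r (m.+1 + i) t *: D1 i t))%R| ^+ 2)%:E +
     \int[P]_(t in A2) (`|(z - c 0%N *: a + \sum_(i < n) c i.+1 *: (r (m.+1 + i) t *: D2 i t))%R| ^+ 2)%:E)%E.
  have mF : measurable_fun setT (fun t =>
      (`|(z + \sum_(i < n.+1) c i *: (r (m + i) t *: D i t))%R| ^+ 2)%:E).
    apply/measurable_EFinP; apply: measurable_funX; apply: measurable_norm_simple.
    apply: (@dyadic_simple _ _ (m + n.+1)) => t s d; congr (_ + _).
    apply: eq_bigr => i _; rewrite (d (m + i)%N) ?ltn_add2l//.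
    by rewrite (iD i _ _ (same_digits_le _ d))// leq_add2l ltnW.
  rewrite {1}AE ge0_integral_setU//; last first.
    exact: measurable_funTS.
  congr (_ + _)%E; apply: eq_integral => t /set_mem[_ /= rt].
    rewrite big_ord_recl addn0 rt scale1r addrA; congr ((`|_ + _| ^+ 2)%:E).
    by apply: eq_bigr => i _; rewrite /= addnS rt eqxx.
  rewrite big_ord_recl addn0 rt scaleN1r scalerN addrA; congr ((`|_ + _| ^+ 2)%:E).
  apply: eq_bigr => i _; rewrite /= addnS rt (_ : (-1 == 1) = false)//.
  by apply/negbTE/eqP => /esym/one_neqN1.
have fin1 : P A1 \is a fin_num := fin_num_measure P _ mA1.
exists D; split=> //.
  rewrite (step y (fun i => (e :: es)`_i)) /= hy1 hy2 PA PA12.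
  rewrite PA12 in fin1; case: (P A2) fin1 => // q _.
  by rewrite -!(EFinM, EFinD); congr (_%:E); lra.
under eq_integral do under eq_bigr do rewrite -[_ *: D _ _]scale1r.
rewrite (step x (fun=> 1)) scale1r.
under [X in (X + _)%E]eq_integral do under eq_bigr do rewrite scale1r.
under [X in (_ + X)%E]eq_integral do under eq_bigr do rewrite scale1r.
rewrite hx1 hx2 PA PA12.
rewrite PA12 in fin1; case: (P A2) fin1 => // q _.
by rewrite -!(EFinM, EFinD); congr (_%:E); lra.
Qed.

(** The UMD inequality for the Paley-Walsh martingale that realises the
    tree. *)
Lemma reach00 es u v : all (fun e => (e == 1) || (e == -1)) es ->
  reach es 0 0 u v -> u <= (2 * C + 1) ^+ 2 * v.
Proof.
move=> /allP hes /reach_realise/(_ 0%N setT (fun _ _ _ => erefl))[D [iD hu hv]].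
have PT : (P : probability _ _) setT = 1%E by exact: probability_setT.
rewrite PT mule1 in hu; rewrite PT mule1 in hv.
pose eps i : R := if es`_i == 1 then 1 else -1.
have heps i : eps i = 1 \/ eps i = -1 by rewrite /eps; case: ifP; [left|right].
have c0 : 0 <= 2 * C + 1 by rewrite addr_ge0// mulr_ge0.
have := paley_transform_bound (size es) iD heps.
have -> : L2norm P (fun t => (\sum_(i < size es) eps i *: (r i t *: D i t))%R) = (Num.sqrt u)%:E.
  rewrite L2normE -[RHS]/(sqrte u%:E) -hu; congr sqrte; apply: eq_integral => t _.
  rewrite add0r; congr ((`|_| ^+ 2)%:E); apply: eq_bigr => i _; congr (_ *: _).
  rewrite /eps; case: eqP => [->//|e1].
  by have /hes := mem_nth 0 (ltn_ord i); case/orP => /eqP // ->.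
have -> : L2norm P (fun t => (\sum_(i < size es) r i t *: D i t)%R) = (Num.sqrt v)%:E.
  rewrite L2normE -[RHS]/(sqrte v%:E) -hv; congr sqrte; apply: eq_integral => t _.
  by rewrite add0r.
have u0 : 0 <= u by rewrite -lee_fin -hu; apply: integral_ge0 => t _; rewrite lee_fin exprn_ge0.
have v0 : 0 <= v by rewrite -lee_fin -hv; apply: integral_ge0 => t _; rewrite lee_fin exprn_ge0.
rewrite -EFinM lee_fin => h.
rewrite -(sqr_sqrtr u0) -(sqr_sqrtr v0) -exprMn lerXn2r// nnegrE ?sqrtr_ge0//.
by rewrite mulr_ge0// sqrtr_ge0.
Qed.
End dyadic_umd.

(** * Midpoint concavity and Jensen's inequality *)

Section midpoint_concave.
Context (R : realType) (X : normedModType R).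
Variable g : X -> R.
Hypothesis midpoint : forall z a, g (z + a) + g (z - a) <= 2 * g z.
Hypothesis lb : forall M : R, exists B : R, forall a, `|a| <= M -> - B <= g a.

(** Subtract from g on the segment its affine interpolation; the difference h
    is midpoint concave and vanishes at both ends. Each point of [0, 1] is the
    midpoint of an end and of another point of [0, 1], so a lower bound -B for
    h improves to -B / 2, and by iteration to 0. *)
Lemma midpoint_concave (a b : X) (l : R) : 0 <= l <= 1 ->
  l * g a + (1 - l) * g b <= g (l *: a + (1 - l) *: b).
Proof.
pose h (l : R) := g (l *: a + (1 - l) *: b) - (l * g a + (1 - l) * g b).
suff: forall l, 0 <= l <= 1 -> 0 <= h l by move=> H /H; rewrite subr_ge0.
have h0 : h 0 = 0 by rewrite /h scale0r add0r subr0 scale1r mul0r mul1r add0r subrr.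
have h1 : h 1 = 0 by rewrite /h scale1r !subrr scale0r addr0 mul0r mul1r addr0 subrr.
have hmid s t : h s + h t <= 2 * h ((s + t) / 2).
  have := midpoint (((s + t) / 2) *: a + (1 - (s + t) / 2) *: b)
    (((s - t) / 2) *: a - ((s - t) / 2) *: b).
  have -> : ((s + t) / 2) *: a + (1 - (s + t) / 2) *: b +
      (((s - t) / 2) *: a - ((s - t) / 2) *: b) = s *: a + (1 - s) *: b.
    rewrite addrACA -scalerDl -scalerBl; congr (_ *: _ + _ *: _); by field.
  have -> : ((s + t) / 2) *: a + (1 - (s + t) / 2) *: b -
      (((s - t) / 2) *: a - ((s - t) / 2) *: b) = t *: a + (1 - t) *: b.
    rewrite opprD opprK addrACA -scalerBl -scalerDl.
    by congr (_ *: _ + _ *: _); field.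
  by rewrite /h; lra.
have [B hB] : exists B, 0 <= B /\ forall l, 0 <= l <= 1 -> - B <= h l.
  have [B0 hB0] := lb (`|a| + `|b|).
  exists (`|B0| + (`|g a| + `|g b|)); split; first by rewrite !addr_ge0.
  move=> {}l /andP[l0 l1]; rewrite /h opprD lerD//.
    rewrite (@le_trans _ _ (- B0))//; first by rewrite lerN2 ler_norm.
    apply: hB0; rewrite (le_trans (ler_normD _ _))// !normrZ !ger0_norm ?subr_ge0//.
    by rewrite lerD// ler_piMl// gerBl.
  rewrite lerN2 lerD//.
    rewrite (@le_trans _ _ (l * `|g a|))//; first by rewrite ler_wpM2l// ler_norm.
    by rewrite ler_piMl.
  rewrite (@le_trans _ _ ((1 - l) * `|g b|))//; first by rewrite ler_wpM2l ?subr_ge0// ler_norm.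
  by rewrite ler_piMl// gerBl.
have [B0 {}hB] := hB.
have hk k : forall l, 0 <= l <= 1 -> - (B / 2 ^+ k) <= h l.
  elim: k => [|k ih] {}l /andP[l0 l1].
    by rewrite expr0 divr1; apply: hB; rewrite l0.
  rewrite exprS invfM mulrCA.
  have [lh|lh] := leP l 2^-1.
    have h2l : 0 <= 2 * l <= 1 by lra.
    have := ih _ h2l; have := hmid 0 (2 * l); rewrite h0 add0r.
    by rewrite (_ : (0 + 2 * l) / 2 = l); [lra|field].
  have h2l : 0 <= 2 * l - 1 <= 1 by lra.
  have := ih _ h2l; have := hmid 1 (2 * l - 1); rewrite h1 add0r.
  by rewrite (_ : (1 + (2 * l - 1)) / 2 = l); [lra|field].
move=> {}l hl; rewrite leNgt; apply/negP => neg.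
pose k := Num.bound (B / - h l).
have neg' : 0 < - h l by rewrite oppr_gt0.
have := hk k l hl; rewrite lerNl leNgt => /negP; apply.
rewrite ltr_pdivrMr ?exprn_gt0// mulrC -ltr_pdivrMr//.
exact: upper_nthrootP.
Qed.

Lemma jensen_pos (I : Type) (s : seq I) (i0 : I) (mu : I -> R) (a : I -> X) :
  (forall i, 0 < mu i) ->
  \sum_(i <- i0 :: s) mu i * g (a i) <= (\sum_(i <- i0 :: s) mu i) *
    g ((\sum_(i <- i0 :: s) mu i)^-1 *: \sum_(i <- i0 :: s) mu i *: a i).
Proof.
move=> mu0; elim: s i0 => [|i1 s ih] i0.
  by rewrite !big_seq1 scalerA mulVf ?scale1r// gt_eqF.
rewrite big_cons [in X in _ <= X * _]big_cons [X in (X)^-1]big_cons [X in _ *: X]big_cons.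
set m := \sum_(i <- i1 :: s) mu i; set v := \sum_(i <- i1 :: s) mu i *: a i.
have m0 : 0 < m.
  rewrite /m big_cons ltr_pwDl// sumr_ge0// => i _; exact: ltW.
have M0 : 0 < mu i0 + m by rewrite addr_gt0.
have [l lE] : exists l, l = mu i0 / (mu i0 + m) by eexists.
have l01 : 0 <= l <= 1.
  rewrite lE divr_ge0 ?(ltW (mu0 _)) ?(ltW M0)//=.
  by rewrite ler_pdivrMr// mul1r lerDl ltW.
have l1 : 1 - l = m / (mu i0 + m) by rewrite lE; field; rewrite gt_eqF.
have := ler_wpM2l (ltW M0) (midpoint_concave (a i0) (m^-1 *: v) l01).
rewrite l1 mulrDr !mulrA.
rewrite (_ : (mu i0 + m) * l = mu i0); last by rewrite lE mulrC divfK// gt_eqF.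
rewrite (_ : (mu i0 + m) * m / (mu i0 + m) = m); last by rewrite mulrAC divff ?mul1r// gt_eqF.
rewrite (_ : l *: a i0 + (m / (mu i0 + m)) *: (m^-1 *: v) = (mu i0 + m)^-1 *: (mu i0 *: a i0 + v)); last first.
  rewrite scalerDr !scalerA; congr (_ *: _ + _ *: _); first by rewrite lE mulrC.
  by rewrite mulrAC divff ?mul1r// gt_eqF.
by apply: le_trans; rewrite lerD2l; exact: ih.
Qed.

(** The points of weight 0 are dropped first, because the induction of
    [jensen_pos] normalises by the weights. *)
Lemma jensen_centered (L : finType) (Q : pred L) (mu : L -> R) (a : L -> X) :
  (forall i, 0 <= mu i) -> \sum_(i | Q i) mu i *: a i = 0 ->
  \sum_(i | Q i) mu i * g (a i) <= (\sum_(i | Q i) mu i) * g 0.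
Proof.
move=> mu0 a0.
pose Q' i := Q i && (0 < mu i).
have E (V : zmodType) (F : L -> V) : (forall i, mu i = 0 -> F i = 0) ->
    \sum_(i | Q i) F i = \sum_(i | Q' i) F i.
  move=> F0; rewrite [LHS](bigID (fun i => 0 < mu i))/= [X in _ + X]big1 ?addr0//.
  move=> i /andP[_]; rewrite -leNgt => mi; apply: F0; apply/eqP; rewrite eq_le mi mu0//.
rewrite (E _ (fun i => mu i *: a i)) in a0; last by move=> i ->; rewrite scale0r.
rewrite (E _ (fun i => mu i * g (a i))); last by move=> i ->; rewrite mul0r.
rewrite (E _ mu)//.
pose mu' i := if 0 < mu i then mu i else 1.
have mu'0 i : 0 < mu' i by rewrite /mu'; case: ifP.
have E' (V : zmodType) (F F' : L -> V) : (forall i, 0 < mu i -> F i = F' i) ->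
    \sum_(i | Q' i) F i = \sum_(i <- [seq i <- index_enum L | Q' i]) F' i.
  by move=> FF; rewrite big_filter; apply: eq_bigr => i /andP[_]; exact: FF.
have muE i : 0 < mu i -> mu i = mu' i by rewrite /mu' => ->.
rewrite (E' _ (fun i => mu i *: a i) (fun i => mu' i *: a i)) in a0; last by move=> i /muE ->.
rewrite (E' _ (fun i => mu i * g (a i)) (fun i => mu' i * g (a i))); last by move=> i /muE ->.
rewrite (E' _ mu mu')//.
case: [seq i <- index_enum L | Q' i] a0 => [|i0 s] a0; first by rewrite !big_nil mul0r.
by have := jensen_pos s i0 a mu'0; rewrite a0 scaler0.
Qed.

End midpoint_concave.

(** * The Burkholder function and martingales on finite sets *)

(** The UMD inequality with constant c for martingales on a finite set L with
    weights mu. The algebra at time k is generated by pi k; the third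
    hypothesis makes N 0, ..., N k functions of pi k, and the fourth says that
    the increments have mean 0 on each atom. *)
Definition finite_UMD (R : realType) (X : completeNormedModType R) (c : R) : Prop :=
  forall (L K : finType) (mu : L -> R) (n : nat)
    (pi : nat -> L -> K) (N : nat -> L -> X) (eps : nat -> R),
  (forall l, 0 <= mu l) -> (forall i, (eps i == 1) || (eps i == -1)) ->
  (forall k l l', (k <= n)%N -> pi k l = pi k l' -> forall j, (j <= k)%N -> N j l = N j l') ->
  (forall k b, (k < n)%N -> \sum_(l | pi k l == b) mu l *: (N k.+1 l - N k l) = 0) ->
  \sum_l mu l * `|\sum_(i < n) eps i *: (N i.+1 l - N i l)| ^+ 2 <=
  c ^+ 2 * \sum_l mu l * `|\sum_(i < n) (N i.+1 l - N i l)| ^+ 2.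

Section bellman.
Context (R : realType) (X : completeNormedModType R).
Variable c : R.
Local Notation sgn := (fun e : R => (e == 1) || (e == -1)).
Hypothesis reach_le : forall es u v, all sgn es -> reach es (0 : X) 0 u v -> u <= c ^+ 2 * v.

(** A tree may wait before it starts moving, with zero increments. *)
Lemma reach_prefix es' es (x y : X) u v : reach es x y u v -> reach (es' ++ es) x y u v.
Proof.
move=> h; elim: es' => [//|e es' ih] /=.
exists 0, u, v, u, v; rewrite scaler0 !subr0 !addr0; split=> //; lra.
Qed.

(** A tree may wait after it has stopped. *)
Lemma reach_suffix es' es (x y : X) u v : reach es x y u v -> reach (es ++ es') x y u v.
Proof.
elim: es x y u v => [|e es ih] x y u v.
  by move=> h; have := reach_prefix es' h; rewrite cats0.
move=> /= [a [u1 [v1 [u2 [v2 [h1 h2 -> ->]]]]]].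
by exists a, u1, v1, u2, v2; split=> //; exact: ih.
Qed.

Definition tree_values (x y : X) : set R :=
  [set z | exists es u v, [/\ all sgn es, reach es x y u v & z = u - c ^+ 2 * v]].

Lemma tree_values_leaf x y : tree_values x y (`|y| ^+ 2 - c ^+ 2 * `|x| ^+ 2).
Proof. by exists [::], (`|y| ^+ 2), (`|x| ^+ 2). Qed.

(** Join two trees below a common root. They may have different signs; the
    first one moves during the levels es1 and the second one during the levels
    es2. *)
Lemma tree_values_mid e x y a z1 z2 : sgn e ->
  tree_values (x + a) (y + e *: a) z1 -> tree_values (x - a) (y - e *: a) z2 ->
  tree_values x y ((z1 + z2) / 2).
Proof.
move=> se [es1 [u1 [v1 [s1 h1 ->]]]] [es2 [u2 [v2 [s2 h2 ->]]]].
exists (e :: es1 ++ es2), ((u1 + u2) / 2), ((v1 + v2) / 2); split.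
- by rewrite /= se all_cat s1.
- exists a, u1, v1, u2, v2; split=> //; [exact: reach_suffix|exact: reach_prefix].
- lra.
Qed.

Lemma tree_values00 z : tree_values 0 0 z -> z <= 0.
Proof. by move=> [es [u [v [s h ->]]]]; rewrite subr_le0; exact: reach_le h. Qed.

(** Finiteness of the supremum propagates from (0, 0), where it is
    nonpositive: if the midpoint of two points has bounded values, so has each
    of them, because the other one has the value of the trivial tree. The
    lines through (0, 0) reach all points (p, p) and (p, -p), and from (p, p)
    the line with sign -1 reaches (p + q, p - q). *)
Lemma tree_values_ub x y : has_ubound (tree_values x y).
Proof.
have diag p e : sgn e -> has_ubound (tree_values p (e *: p)).
  move=> se; exists (- (`|- (e *: p)| ^+ 2 - c ^+ 2 * `|- p| ^+ 2)) => z hz.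
  have := @tree_values_mid e 0 0 p z (`|- (e *: p)| ^+ 2 - c ^+ 2 * `|- p| ^+ 2) se.
  rewrite !add0r => /(_ hz (tree_values_leaf _ _)) /tree_values00.
  by lra.
pose p := 2^-1 *: (x + y); pose q := 2^-1 *: (x - y).
have half (u : X) : 2^-1 *: u + 2^-1 *: u = u.
  by rewrite -scalerDl (_ : 2^-1 + 2^-1 = 1) ?scale1r//; lra.
have xE : x = p + q.
  by rewrite /p /q -scalerDr addrACA subrr addr0 scalerDr half.
have yE : y = p + -1 *: q.
  by rewrite /p /q scaleN1r -scalerBr opprD opprK addrACA subrr add0r scalerDr half.
have s1 : sgn 1 by rewrite eqxx.
have [b hb] := diag p 1 s1; rewrite scale1r in hb.
set w := `|p - -1 *: q| ^+ 2 - c ^+ 2 * `|p - q| ^+ 2.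
exists (2 * b - w) => z; rewrite xE yE => hz.
have se : sgn (-1) by rewrite eqxx orbT.
have := hb _ (tree_values_mid se hz (tree_values_leaf _ _)).
by rewrite -/w; lra.
Qed.

(** Burkholder's function U. *)
Definition bellman x y := sup (tree_values x y).

Lemma bellman_ge x y z : tree_values x y z -> z <= bellman x y.
Proof. by move=> hz; apply: ub_le_sup => //; exact: tree_values_ub. Qed.

Lemma bellman00 : bellman 0 0 <= 0.
Proof.
apply: ge_sup; first by exists (`|0 : X| ^+ 2 - c ^+ 2 * `|0 : X| ^+ 2); exact: tree_values_leaf.
by move=> z; exact: tree_values00.
Qed.

(** Take suprema in [tree_values_mid]. *)
Lemma bellman_mid e x y a : sgn e ->
  bellman (x + a) (y + e *: a) + bellman (x - a) (y - e *: a) <= 2 * bellman x y.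
Proof.
move=> se; rewrite -lerBrDr; apply: ge_sup.
  by eexists; exact: tree_values_leaf.
move=> z1 hz1; rewrite lerBrDr addrC -lerBrDr; apply: ge_sup.
  by eexists; exact: tree_values_leaf.
move=> z2 hz2; rewrite lerBrDr.
by have := bellman_ge (tree_values_mid se hz1 hz2); lra.
Qed.

Lemma bellman_jensen e x y (L : finType) (Q : pred L) (mu : L -> R) (a : L -> X) :
  sgn e -> (forall i, 0 <= mu i) -> \sum_(i | Q i) mu i *: a i = 0 ->
  \sum_(i | Q i) mu i * bellman (x + a i) (y + e *: a i) <=
  (\sum_(i | Q i) mu i) * bellman x y.
Proof.
move=> se mu0 a0.
pose g a := bellman (x + a) (y + e *: a).
have gm z b : g (z + b) + g (z - b) <= 2 * g z.
  by rewrite /g !addrA scalerDr scalerBr !addrA; exact: bellman_mid.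
have gl (M : R) : exists B : R, forall a, `|a| <= M -> - B <= g a.
  exists (c ^+ 2 * (`|x| + M) ^+ 2) => b bM.
  apply: (le_trans _ (bellman_ge (tree_values_leaf _ _))).
  have h1 : c ^+ 2 * `|x + b| ^+ 2 <= c ^+ 2 * (`|x| + M) ^+ 2.
    rewrite ler_wpM2l ?sqr_ge0// lerXn2r ?nnegrE ?addr_ge0//.
      exact: le_trans bM.
    by rewrite (le_trans (ler_normD _ _))// lerD2l.
  have h2 : 0 <= `|y + e *: b| ^+ 2 by rewrite exprn_ge0.
  by lra.
have := jensen_centered gm gl mu0 a0.
by rewrite /g scaler0 !addr0.
Qed.

(** Put X_k = sum_(i < k) dN_i and Y_k = sum_(i < k) eps_i dN_i. By
    [bellman_jensen] on each atom of the k-th algebra, the mean of U (X_k,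
    Y_k) decreases in k; it is nonpositive at the start by [bellman00], and it
    dominates the mean of |Y_k|^2 - c^2 |X_k|^2. *)
Lemma finite_martingale_ineq : finite_UMD X c.
Proof.
move=> L K mu n pi N eps mu0 heps ad mart.
pose x k l := \sum_(i < k) (N i.+1 l - N i l).
pose y k l := \sum_(i < k) eps i *: (N i.+1 l - N i l).
suff H k : (k <= n)%N -> \sum_l mu l * bellman (x k l) (y k l) <= 0.
  rewrite mulr_sumr -subr_le0 -sumrB; apply: le_trans (H n (leqnn n)).
  apply: ler_sum => l _; rewrite [c ^+ 2 * (_ * _)]mulrCA -mulrBr ler_wpM2l//.
  exact/bellman_ge/tree_values_leaf.
elim: k => [_|k ih kn].
  apply: sumr_le0 => l _; rewrite mulr_ge0_le0// /x /y !big_ord0.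
  exact: bellman00.
apply: le_trans (ih (ltnW kn)).
rewrite [leLHS](partition_big (pi k) xpredT)//= [leRHS](partition_big (pi k) xpredT)//=.
apply: ler_sum => b _.
case: (pickP (fun l => pi k l == b)) => [l0 /eqP hl0|none]; last by rewrite !big_pred0.
have cst l : pi k l == b -> x k l = x k l0 /\ y k l = y k l0.
  move=> /eqP hl; have e j := ad k l l0 (ltnW kn) (etrans hl (esym hl0)) j.
  split; apply: eq_bigr => i _; rewrite !e//; exact: ltnW.
rewrite (eq_bigr (fun l => mu l * bellman (x k l0 + (N k.+1 l - N k l))
    (y k l0 + eps k *: (N k.+1 l - N k l)))); last first.
  move=> l /cst[<- <-]; by rewrite /x /y !big_ord_recr.
apply: (le_trans (bellman_jensen _ _ _ mu0 (mart k b kn))) => //.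
rewrite mulr_suml; apply: ler_sum => l /cst[-> ->] //.
Qed.

End bellman.

(** * Approximation of martingales *)

Section approximation.
Context d (T : measurableType d) (R : realType) (P : probability T R).
Context (X : completeNormedModType R).
Local Notation mlab := (labelling (@measurable d T)).
Local Notation bI := (@bochner_integral d T R P X).
Let sA := @sigma_algebra_measurable d T.

(** On a fibre of measure 0 the mean is 0 by convention, and the integral of f
    vanishes by [bochner_integral_cauchy_schwarz]. *)
Lemma cond_mean_integral (L : finType) (p : T -> L) (phi : L -> R) (f : T -> X) :
  mlab p -> L2 P f ->
  bI (fun t => phi (p t) *: cond_mean P p f t) = bI (fun t => phi (p t) *: f t).
Proof.
move=> hp hf.
pose e b := bI (fun u => (p u == b)%:R *: f u).
have Lb b : L2 P (fun u => (p u == b)%:R *: f u) := L2M (fun l => (l == b)%:R) hp hf.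
transitivity (bI ((fun b => phi b *: ((fine (P (p @^-1` [set b])))^-1 *: e b)) \o p)).
  by [].
rewrite bochner_integral_label//.
transitivity (\sum_b phi b *: e b).
  apply: eq_bigr => b _; rewrite !scalerA.
  have [p0|pn] := eqVneq (fine (P (p @^-1` [set b]))) 0; last first.
    by rewrite mulrAC divff// mul1r.
  have -> : e b = 0; last by rewrite !scaler0.
  have h0 t : ~ (p @^-1` [set b]) t -> (p t == b)%:R *: f t = 0.
    by move=> tb; case: eqP => [/tb//|_]; rewrite scale0r.
  have := bochner_integral_cauchy_schwarz (hp b) (Lb b) h0.
  rewrite -(fineK (fin_num_measure P _ (hp b))) p0 mul0e -/(e b) => h.
  have : `|e b| ^+ 2 == 0 by rewrite eq_le exprn_ge0// andbT -lee_fin.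
  by rewrite expf_eq0/= normr_eq0 => /eqP.
transitivity (bI (fun u => \sum_b phi b *: ((p u == b)%:R *: f u))).
  rewrite bochner_integral_sum; last by move=> b; apply: L2Z; exact: Lb.
  by apply: eq_bigr => b _; rewrite bochner_integralZ.
congr bI; apply/funext => u.
rewrite (bigD1 (p u))//= eqxx scale1r big1 ?addr0// => b.
by rewrite eq_sym => /negPf ->; rewrite scale0r scaler0.
Qed.

Lemma sq_integral_label (L : finType) (q : T -> L) (g : L -> X) : mlab q ->
  sq_integral P (g \o q) = (\sum_l fine (P (q @^-1` [set l])) * `|g l| ^+ 2)%:E.
Proof.
move=> hq; rewrite /sq_integral (integral_label P (phi := fun l => `|g l| ^+ 2) hq); last first.
  by move=> l; rewrite exprn_ge0.
rewrite -sumEFin; apply: eq_bigr => l _.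
by rewrite [RHS]EFinM [RHS]muleC fineK// fin_num_measure.
Qed.

Lemma L2norm_le_scale (c : R) (f g : T -> X) : 0 <= c ->
  (sq_integral P f <= (c ^+ 2)%:E * sq_integral P g)%E -> (L2norm P f <= c%:E * L2norm P g)%E.
Proof.
move=> c0 h; rewrite !L2normE.
have -> : c%:E = sqrte (c ^+ 2)%:E by rewrite /= sqrtr_sqr ger0_norm.
rewrite -sqrteM ?lee_fin ?sqr_ge0// lee_sqrt//.
by rewrite mule_ge0 ?sq_integral_ge0// lee_fin sqr_ge0.
Qed.

Variables (F : nat -> set (set T)) (M : nat -> T -> X).
Hypothesis hM : martingale P F M.
Hypothesis hL : forall n, L2 P (M n).

Let hF : filtration F. Proof. by case: hM. Qed.
Let sF k : sigma_algebra setT (F k). Proof. by case: hF. Qed.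
Let Fm k : F k `<=` measurable. Proof. by case: hF. Qed.
Let Fle j k : (j <= k)%N -> F j `<=` F k.
Proof.
move=> jk; rewrite -(subnKC jk); elim: (k - j)%N => [|i ih]; first by rewrite addn0.
by rewrite addnS; apply: subset_trans ih _; case: hF.
Qed.

Variables (c : R).
Hypothesis c0 : 0 <= c.
Hypothesis finite_ineq : finite_UMD X c.

(** Choose simple functions s_k, measurable at time k, at distance dl from
    M_k, and let M'_k be the conditional mean of M_k given s_0, ..., s_k.
    Since conditional means are contractions and fix s_k, the distance of M'_k
    to M_k is at most 2 dl. Since M is a martingale, so is M'; it takes
    finitely many values and becomes a martingale on a finite set of
    labels. *)
Lemma martingale_approx (n : nat) (eps : nat -> R) (dl : R) :
  (forall i, (eps i == 1) || (eps i == -1)) -> 0 < dl ->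
  exists M' : nat -> T -> X,
   (forall k, (k <= n)%N -> L2 P (M' k) /\
      (L2norm P (fun t => M k t - M' k t)%R <= (2 * dl)%:E)%E) /\
   (L2norm P (fun t => \sum_(i < n) eps i *: mdiff M' i t)%R <=
    c%:E * L2norm P (fun t => \sum_(i < n) mdiff M' i t)%R)%E.
Proof.
move=> heps dl0.
have H k : exists s, simple (F k) s /\ (L2norm P (fun t => M k t - s t)%R <= dl%:E)%E.
  apply: L2_simple_dense => //; first by case: hM.
  by have [] := hL k.
have [s hs] := choice H.
have [v hv] : exists v : seq X, forall k, (k <= n)%N -> forall t, s k t \in v.
  elim: n => [|m [v hv]].
    have [[/finite_seqP[v hv] _] _] := hs 0%N; exists v => k; rewrite leqn0 => /eqP -> t.
    have : range (s 0%N) (s 0%N t) by exists t.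
    by rewrite hv.
  have [[/finite_seqP[v' hv'] _] _] := hs m.+1; exists (v ++ v') => k.
  rewrite leq_eqVlt => /predU1P[->|km] t; rewrite mem_cat; last by rewrite hv.
  have : range (s m.+1) (s m.+1 t) by exists t.
  by rewrite hv' /= => ->; rewrite orbT.
(* All the s_k with k <= n take their values in one list v, so that one finite
   type of labels serves for all times. *)
pose kap k t : 'I_(size v).+1 := inord (index (s k t) v).
have kapF k : labelling (F k) (kap k).
  have [/simple_label[m [k' [v' [hk' E]]]] _] := hs k.
  rewrite /kap E; exact: (labelling_comp (sF k) (fun i => inord (index (v' i) v)) hk').
have kapE k t : (k <= n)%N -> s k t = nth 0 v (kap k t).
  move=> kn; rewrite inordK ?nth_index ?hv//.
  by rewrite ltnS index_size.
pose L := {ffun 'I_n.+1 -> 'I_(size v).+1}.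
pose q t : L := [ffun j : 'I_n.+1 => kap j t].
(* Forget the labels after time k. *)
pose pi k (l : L) : L := [ffun j : 'I_n.+1 => if (j <= k)%N then l j else ord0].
have pipi j k l : (j <= k)%N -> pi j (pi k l) = pi j l.
  move=> jk; apply/ffunP => i; rewrite !ffunE; case: ifP => // ij.
  by rewrite (leq_trans ij jk).
pose qk k t := pi k (q t).
have qkF k : labelling (F k) (qk k).
  rewrite (_ : qk k = fun t => [ffun j : 'I_n.+1 => if (j <= k)%N then kap j t else ord0]); last first.
    by apply/funext => t; apply/ffunP => j; rewrite !ffunE.
  apply: labelling_ffun => // j; have [jk|_] := boolP (j <= k)%N.
    by move=> l; apply: (Fle jk); exact: kapF.
  exact: labelling_cst.
have qkm k : mlab (qk k) by move=> l; apply: (@Fm k); exact: qkF.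
have hq : mlab q.
  have -> : q = qk n.
    apply/funext => t; apply/ffunP => j; rewrite !ffunE.
    by rewrite -ltnS ltn_ord.
  exact: qkm.
pose N k (l : L) : X := (fine (P (qk k @^-1` [set pi k l])))^-1 *:
  bI (fun u => (qk k u == pi k l)%:R *: M k u).
pose M' k := cond_mean P (qk k) (M k).
have M'E k : M' k = N k \o q by [].
exists M'; split.
  move=> k kn.
  have LM' : L2 P (M' k) by rewrite M'E; apply: L2_simple; exact: label_simple.
  split=> //.
  have [simps hsk] := hs k.
  have ssimp : simple measurable (s k).
    by have [h1 h2] := simps; split=> // x; exact/Fm/h2.
  have Ls := L2_simple P ssimp.
  have kn' : (k < n.+1)%N by [].
  pose vk (l : L) : X := nth 0 v (l (Ordinal kn')).
  have sE : s k = vk \o qk k.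
    by apply/funext => t; rewrite /vk /= !ffunE /= leqnn; exact: kapE.
  have LD := L2B (hL k) Ls.
  rewrite (@L2norm_ae _ _ _ _ _ _
    (fun t => (M k t - s k t) - cond_mean P (qk k) (fun u => M k u - s k u) t)); last first.
    apply: filterS (cond_mean_label P vk (qkm k)) => t ht.
    rewrite (cond_meanB t (qkm k) (hL k) Ls) sE ht /=.
    by rewrite opprB addrA subrK.
  have [sD _] := LD.
  have Lc : L2 P (cond_mean P (qk k) (fun u => M k u - s k u)).
    apply: L2_simple.
    exact: (label_simple sA (fun b => (fine (P (qk k @^-1` [set b])))^-1 *:
       bI (fun u => (qk k u == b)%:R *: (M k u - s k u))) (qkm k)).
  have [sc _] := Lc.
  rewrite (le_trans (L2normB sD sc))// (_ : 2 * dl = dl + dl); last by ring.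
  rewrite EFinD leeD// (le_trans (cond_mean_contract (qkm k) LD))//.
pose mu l := fine (P (q @^-1` [set l])).
have mu0 l : 0 <= mu l by apply: fine_ge0.
have ad k l l' : (k <= n)%N -> pi k l = pi k l' -> forall j, (j <= k)%N -> N j l = N j l'.
  move=> kn hl j jk.
  have e : pi j l = pi j l' by rewrite -(pipi j k)// hl pipi.
  by rewrite /N e.
have mart k b : (k < n)%N -> \sum_(l | pi k l == b) mu l *: (N k.+1 l - N k l) = 0.
  move=> kn.
  have main j : (k <= j)%N -> \sum_(l | pi k l == b) mu l *: N j l =
      bI (fun u => (qk k u == b)%:R *: M j u).
    move=> kj.
    transitivity (bI ((fun l => (pi k l == b)%:R *: N j l) \o q)).
      rewrite bochner_integral_label// [LHS]big_mkcond/=; apply: eq_bigr => l _.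
      by case: (pi k l == b); rewrite ?scale1r// scale0r scaler0.
    transitivity (bI (fun t => (pi k (qk j t) == b)%:R *: cond_mean P (qk j) (M j) t)).
      by congr bI; apply/funext => t; rewrite /= /qk pipi.
    rewrite (cond_mean_integral (fun l => (pi k l == b)%:R) (qkm j) (hL j)).
    by congr bI; apply/funext => t; rewrite /qk pipi.
  under eq_bigr do rewrite scalerBr.
  rewrite sumrB !main//.
  have [_ _ _ /(_ k)[_ _ _ hcond]] := hM.
  have FA := qkF k b.
  have := hcond _ FA; rewrite /bochner_integral_on.
  have E (f : T -> X) : (fun t => \1_(qk k @^-1` [set b]) t *: f t) = (fun u => (qk k u == b)%:R *: f u).
    apply/funext => t; rewrite indicE; congr ((nat_of_bool _)%:R *: _).
    by apply/idP/eqP => [/set_mem//|h]; apply/mem_set.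
  by rewrite !E => ->; rewrite subrr.
apply: L2norm_le_scale => //.
rewrite (_ : (fun t => _) = (fun l => \sum_(i < n) eps i *: (N i.+1 l - N i l)) \o q)//.
rewrite (_ : (fun t => \sum_(i < n) mdiff M' i t) = (fun l => \sum_(i < n) (N i.+1 l - N i l)) \o q)//.
rewrite !sq_integral_label// -EFinM lee_fin.
exact: (@finite_ineq L L mu n pi N eps mu0 heps ad mart).
Qed.

(** Both sides of the inequality for M' differ from those for M by at most a
    multiple of dl. *)
Lemma martingale_transform_bound (n : nat) (eps : nat -> R) :
  (forall i, (eps i == 1) || (eps i == -1)) ->
  (L2norm P (fun t => \sum_(i < n) eps i *: mdiff M i t)%R <=
    c%:E * L2norm P (fun t => \sum_(i < n) mdiff M i t)%R)%E.
Proof.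
move=> heps; apply/lee_addgt0Pr => e e0.
have d0 : 0 < (1 + c) * (n.+1%:R * 4) by rewrite !mulr_gt0// ltr_pwDl.
pose dl := e / ((1 + c) * (n.+1%:R * 4)).
have dl0 : 0 < dl by rewrite divr_gt0.
have [M' [hM' hineq]] := martingale_approx n heps dl0.
have sumle (m : nat) (f : nat -> T -> X) (a : R) : 0 <= a -> (forall i, (i < m)%N -> L2 P (f i)) ->
    (forall i, (i < m)%N -> L2norm P (f i) <= a%:E)%E ->
    (L2norm P (fun t => \sum_(i < m) f i t)%R <= (m%:R * a)%:E)%E.
  move=> a0 hf hfa.
  suff : strongly_measurable P (fun t => \sum_(i < m) f i t) /\
    (L2norm P (fun t => \sum_(i < m) f i t)%R <= (m%:R * a)%:E)%E by case.
  elim: m hf hfa => [|m ih] hf hfa.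
    have E : (fun t => \sum_(i < 0) f i t) = fun=> 0 by apply/funext => t; rewrite big_ord0.
    rewrite E mul0r; have [s0 _] := @L2_0 _ T R P X; split=> //.
    by apply: L2norm_bounded => // t; rewrite normr0.
  have [s1 h1] := ih (fun i im => hf i (ltnW im)) (fun i im => hfa i (ltnW im)).
  have [s2 _] := hf m (ltnSn m).
  have E : (fun t => \sum_(i < m.+1) f i t) = fun t => \sum_(i < m) f i t + f m t.
    by apply/funext => t; rewrite big_ord_recr.
  rewrite E; split; first exact: strongly_measurableD.
  rewrite (le_trans (L2normD s1 s2))// -natr1 mulrDl mul1r EFinD leeD//.
  exact: hfa.
have dD i : (i < n)%N -> L2 P (fun t => mdiff M i t - mdiff M' i t) /\
   (L2norm P (fun t => mdiff M i t - mdiff M' i t)%R <= (4 * dl)%:E)%E.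
  move=> iN; have [L1 n1] := hM' i.+1 iN; have [L2' n2] := hM' i (ltnW iN).
  have La := L2B (hL i.+1) L1; have Lb := L2B (hL i) L2'.
  have -> : (fun t => mdiff M i t - mdiff M' i t) =
      (fun t => (M i.+1 t - M' i.+1 t) - (M i t - M' i t)).
    by apply/funext => t; rewrite /mdiff !opprB addrACA [RHS]addrACA [X in _ + X = _]addrC.
  split; first exact: L2B.
  have [sa _] := La; have [sb _] := Lb.
  rewrite (le_trans (L2normB sa sb))// (_ : 4 * dl = 2 * dl + 2 * dl); last by ring.
  by rewrite EFinD leeD.
have LdM i : L2 P (mdiff M i) by apply: L2B.
have LdM' i : (i < n)%N -> L2 P (mdiff M' i).
  by move=> iN; apply: L2B; [case: (hM' i.+1 iN)|case: (hM' i (ltnW iN))].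
(* The approximation is only controlled up to time n. *)
pose ze i := if (i < n)%N then mdiff M' i else fun=> 0.
have Lze i : L2 P (ze i) by rewrite /ze; case: ifP => [/LdM'//|_]; exact: L2_0.
have Eze (co : nat -> R) : (fun t => \sum_(i < n) co i *: mdiff M' i t) = fun t => \sum_(i < n) co i *: ze i t.
  by apply/funext => t; apply: eq_bigr => i _; rewrite /ze ltn_ord.
have close (co : nat -> R) (f g : nat -> T -> X) : (forall i, `|co i| = 1) ->
    (forall i, L2 P (f i)) -> (forall i, L2 P (g i)) ->
    (forall i, (i < n)%N -> L2norm P (fun t => f i t - g i t)%R <= (4 * dl)%:E)%E ->
    (L2norm P (fun t => \sum_(i < n) co i *: f i t)%R <=
     L2norm P (fun t => \sum_(i < n) co i *: g i t)%R + (n%:R * (4 * dl))%:E)%E.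
  move=> hco hf hg hfg.
  have -> : (fun t => \sum_(i < n) co i *: f i t) =
     (fun t => \sum_(i < n) co i *: g i t + \sum_(i < n) co i *: (f i t - g i t)).
    apply/funext => t; rewrite -big_split/=; apply: eq_bigr => i _.
    by rewrite scalerBr addrC subrK.
  have [s1 _] : L2 P (fun t => \sum_(i < n) co i *: g i t) by apply: L2_sum => i; exact: L2Z.
  have hfgL i : L2 P (fun t => co i *: (f i t - g i t)) by apply: L2Z; exact: L2B.
  have [s2 _] : L2 P (fun t => \sum_(i < n) co i *: (f i t - g i t)) by apply: L2_sum => i; exact: hfgL.
  rewrite (le_trans (L2normD s1 s2))// leeD2l//.
  apply: (sumle n (fun i t => co i *: (f i t - g i t))) => //.
    by rewrite mulr_ge0// ltW.
  move=> i iN; rewrite L2normZ ?hco ?mul1e ?hfg//.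
  by have [] := L2B (hf i) (hg i).
have zeE i : (i < n)%N -> ze i = mdiff M' i by rewrite /ze => ->.
have h1 : (L2norm P (fun t => \sum_(i < n) eps i *: mdiff M i t)%R <=
     L2norm P (fun t => \sum_(i < n) eps i *: ze i t)%R + (n%:R * (4 * dl))%:E)%E.
  apply: close => //.
    by move=> i; case/orP: (heps i) => /eqP ->; rewrite ?normrN1 ?normr1.
  by move=> i iN; rewrite zeE//; have [] := dD i iN.
have h2 : (L2norm P (fun t => \sum_(i < n) ze i t)%R <=
     L2norm P (fun t => \sum_(i < n) mdiff M i t)%R + (n%:R * (4 * dl))%:E)%E.
  have E1 (h : nat -> T -> X) : (fun t => \sum_(i < n) 1 *: h i t) = fun t => \sum_(i < n) h i t.
    by apply/funext => t; apply: eq_bigr => i _; rewrite scale1r.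
  rewrite -(E1 ze) -(E1 (mdiff M)).
  apply: (close (fun=> 1)) => // [i|i iN]; first by rewrite normr1.
  rewrite zeE// (@L2norm_norm _ _ _ P X _ (fun t => mdiff M i t - mdiff M' i t)).
    by have [] := dD i iN.
  by move=> t; rewrite distrC.
have Esum : (fun t => \sum_(i < n) mdiff M' i t) = fun t => \sum_(i < n) ze i t.
  by apply/funext => t; apply: eq_bigr => i _; rewrite /ze ltn_ord.
rewrite Eze Esum in hineq.
set eta := n%:R * (4 * dl) in h1 h2.
have eta0 : 0 <= eta by apply: mulr_ge0 => //; apply: mulr_ge0 => //; exact: ltW.
have etae : c * eta + eta <= e.
  have key : c * eta + eta = e * (n%:R / n.+1%:R).
    have c1 : 1 + c != 0 by rewrite gt_eqF// ltr_pwDl.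
    have m0 : n.+1%:R != 0 :> R by rewrite pnatr_eq0.
    rewrite /eta /dl; move: (n.+1%:R) m0 => m m0.
    by field; rewrite m0 c1.
  rewrite key.
  by rewrite ger_pMr// ler_pdivrMr// mul1r ler_nat.
apply: (le_trans h1).
apply: (@le_trans _ _ (c%:E * (L2norm P (fun t => \sum_(i < n) mdiff M i t)%R + eta%:E) + eta%:E)%E).
  by rewrite leeD2r// (le_trans hineq)// lee_wpmul2l.
rewrite ge0_muleDr ?L2norm_ge0 ?lee_fin// -EFinM -addeA -EFinD leeD2l// lee_fin.
Qed.

End approximation.

(** * The equivalence *)

Section main.
Context (R : realType) (X : completeNormedModType R).

Lemma walsh_UMD :
  (forall f : R -> X, L2 (@lebesgue01 R) f ->
     L2norm (@lebesgue01 R) (fun t => f t - walsh_sum n f t)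
       @[n --> \oo] --> 0%:E) -> UMD X.
Proof.
move=> /walsh_uniformly_bounded[C [C0 hC]].
have c0 : 0 <= 2 * C + 1 by rewrite addr_ge0// mulr_ge0.
exists (2 * C + 1); split=> // d T P F M hM hL n eps heps.
apply: (martingale_transform_bound hM hL c0) => [|i].
  exact: (finite_martingale_ineq (reach00 C0 hC)).
by case: (heps i) => ->; rewrite eqxx ?orbT.
Qed.

End main.

Theorem corollary1 (R : realType) (X : completeNormedModType R) :
  (forall f : R -> X, L2 (@lebesgue01 R) f ->
     L2norm (@lebesgue01 R) (fun t => f t - walsh_sum n f t)
       @[n --> \oo] --> 0%:E)
  <-> UMD X.
Proof. by split; [exact: walsh_UMD|move=> h f; exact: UMD_walsh_converges]. Qed.
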